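(* Let $\mathcal{A}$ be a finite alphabet and $\eta\colon\mathbb{Z}^2\to\mathcal{A}$. If there exist $n,k\in\mathbb{N}$ with $k\leq 3$ such that $P_\eta(R_{n,k})\leq nk$, then there is at most one nonexpansive line for the dynamical system $X_\eta$.
   Context: $\mathbb{N}=\{1,2,3,\dots\}$ and $R_{n,k}=\{0,\dots,n-1\}\times\{0,\dots,k-1\}$. Give $\mathcal{A}$ the discrete topology and $\mathcal{A}^{\mathbb{Z}^2}$ the product topology, with $\mathbb{Z}^2$-action $(T^{\vec u}f)(\vec x)=f(\vec x+\vec u)$. $X_\eta$ is the closure of $\{T^{\vec u}\eta:\vec u\in\mathbb{Z}^2\}$, endowed with the action $T$. $P_\eta(R_{n,k})$ is the number of distinct restrictions $(T^{\vec u}\eta)|_{R_{n,k}}$, $\vec u\in\mathbb{Z}^2$. Let $d$ on $X_\eta$ be a metric compatible with the topology. A line $\ell\subset\mathbb{R}^2$ is expansive if there exist $r>0$ and $\delta>0$ such that whenever $f,g\in X_\eta$ satisfy $d(T^{\vec u}f,T^{\vec u}g)<\delta$ for all $\vec u\in\mathbb{Z}^2$ whose Euclidean distance to $\ell$ is less than $r$, then $f=g$. A line that is not expansive is nonexpansive. (Non)expansiveness is invariant under translation of the line, and nonexpansive lines are counted up to translation, i.e. as lines through the origin. *)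

(* Defs.v *)
From mathcomp Require Import all_boot all_order all_algebra.
From mathcomp Require Import all_classical all_reals all_analysis.

Set Implicit Arguments.
Unset Strict Implicit.
Unset Printing Implicit Defensive.
Import Order.TTheory GRing.Theory Num.Theory.

Local Open Scope classical_set_scope.
Local Open Scope ring_scope.

Section Subshift.
Variable A : finType.

Definition config : Type :=
  {ptws int * int -> discrete_topology A}.

Definition shift_config (u : int * int) (f : config) : config := fun x => f (x + u).

Definition orbit_closure (eta : config) : set config :=
  closure [set shift_config u eta | u in [set: int * int]].

(* The index [(i, j) : 'I_n * 'I_k] stands for the point (i, j) of the
   rectangle R_{n,k}. *)
Definition pattern (eta : config) (n k : nat) (u : int * int) :
    {ffun 'I_n * 'I_k -> A} :=
  [ffun i : 'I_n * 'I_k => shift_config u eta ((i.1 : nat)%:Z, (i.2 : nat)%:Z)].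

Definition complexity (eta : config) (n k : nat) : nat :=
  #|[pred w : {ffun 'I_n * 'I_k -> A} | `[< exists u, w = pattern eta n k u >]]|.

End Subshift.

Section Metric.
Variables (R : realType) (T : topologicalType).

(* [d] is a metric on the subset [X], inducing the subspace topology of [X];
   its values outside of [X] are irrelevant. *)
Record compatible_metric (X : set T) (d : T -> T -> R) : Prop := {
  cmetric_ge0 : forall f g, X f -> X g -> 0 <= d f g;
  cmetric_eq0 : forall f g, X f -> X g -> d f g = 0 <-> f = g;
  cmetric_sym : forall f g, X f -> X g -> d f g = d g f;
  cmetric_triangle : forall f g h, X f -> X g -> X h -> d f h <= d f g + d g h;
  cmetric_nbhs : forall f (U : set T), X f ->
    within X (nbhs f) U <->
    exists2 e : R, 0 < e & forall g, X g -> d f g < e -> U g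
}.

End Metric.

Section Expansiveness.
Variable R : realType.

Definition is_line (l : set (R * R)) : Prop :=
  exists p v : R * R, v != (0, 0) /\
    l = [set (p.1 + t * v.1, p.2 + t * v.2) | t in [set: R]].

Definition translate (w : R * R) (l : set (R * R)) : set (R * R) :=
  [set x + w | x in l].

(* The norm of the library on [R * R] is the sup norm, hence this explicit
   Euclidean distance. *)
Definition euclidean_dist (x y : R * R) : R :=
  Num.sqrt ((x.1 - y.1) ^+ 2 + (x.2 - y.2) ^+ 2).

Definition dist_to_set (x : R * R) (l : set (R * R)) : R :=
  inf [set euclidean_dist x y | y in l].

Definition embedZ2 (u : int * int) : R * R := (u.1%:~R, u.2%:~R).

Definition expansive (A : finType) (X : set (config A))
    (d : config A -> config A -> R) (l : set (R * R)) : Prop :=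
  exists r delta : R, [/\ 0 < r, 0 < delta &
    forall f g, X f -> X g ->
      (forall u : int * int, dist_to_set (embedZ2 u) l < r ->
         d (shift_config u f) (shift_config u g) < delta) ->
      f = g].

End Expansiveness.

(* Main.v *)
(* Let [T] be minimal among the convex subsets of the window that have at most as many
   patterns as cells. The letter at a vertex of [T] is then determined by the letters on the
   rest of [T], and if a face of [T] has m points, at most m - 1 patterns on the rest of [T]
   are ambiguous. Filling in vertices, equality near a line spreads to the whole plane unless
   the line is parallel to an edge of [T]; so a nonexpansive line has a rational direction
   which is nondeterministic: a half plane bounded by it does not determine the next line.

   Having no more patterns than cells, [T] also carries a linear relation between the letters
   in each of its translates. Combined with the Morse-Hedlund theorem for the ambiguous
   patterns along a face, it shows that two configurations which agree on a strip in a
   nonhorizontal direction, but not everywhere, are periodic in that direction, with a period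
   that depends on n and the alphabet only; so are, horizontally, two configurations which
   agree on k - 1 rows.

   Suppose that there are two nonparallel nondeterministic directions. If one of them is
   horizontal and only one other is not, or if none is horizontal, then the periodicity of
   one configuration along one direction, seen by [eta] on a large box, spreads in [eta] to a
   strip along the other direction and from there to the plane, which contradicts the first
   direction being nondeterministic. Otherwise [T], having height at most 3, is a hexagon with
   sides parallel to three nondeterministic directions. Compare a horizontally periodic
   configuration with a translate of [eta] that agrees with it on a large box: the first
   windows showing a difference force each row of the configuration to be the translate of
   the row below it by a fixed vector, so that the rows below determine the next row, against
   the nondeterminism of the horizontal direction. *)

From Stdlib Require Import ZArith Lia.
Require Import Defs.
From mathcomp Require Import all_classical all_reals all_analysis.
From mathcomp Require Import all_boot all_order all_algebra.
From mathcomp Require Import boolp zify ssrZ ring lra.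
Set Implicit Arguments.
Unset Strict Implicit.
Unset Printing Implicit Defensive.
Import Order.TTheory GRing.Theory Num.Theory.

(* [%Z] is taken by [int_scope]. *)
Delimit Scope Z_scope with ZZ.
Local Open Scope Z_scope.

(** * Counting lemmas and one-dimensional periodicity *)

(** The bound on the height enters through lattice geometry. With at most three rows, a
    nonhorizontal edge of T has at most three points and no gaps; the parallel lines between the
    extreme levels of the linear relation still meet T in at least one point less than a
    nondeterministic edge has; and two nonhorizontal edge directions already fix the shape of T.
    Minimality is used through one inequality: removing r points from T has excess at most r - 1,
    that is, loses at most r - 1 patterns. For r = 1 this is the rule at a vertex, for r = 2 the
    uniqueness of the pair of windows at an edge of two points, for r = 3 that of two such pairs at
    the right ends of the hexagon. Two obstacles shape the rest. Periods have to be uniform, since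
    eta agrees with a periodic configuration only on a box and one fixed translation must be
    followed from there along a strip; hence the factorials. And the argument that makes the two
    sides of a nondeterministic line equivalent covers nonhorizontal directions only, so the two
    horizontal sides have to be distinguished. *)

Lemma Zof_factS (d K : nat) : (0 < d)%N -> (d <= K)%N ->
  exists m : nat, Z.of_nat K`! = Z.of_nat m * Z.of_nat d.
Proof.
move=> d0 dK; have /dvdnP[m ->] : (d %| K`!)%N by apply: dvdn_fact; rewrite d0.
by exists m; lia.
Qed.

Lemma fact_Zgt0 K : 0 < Z.of_nat K`!.
Proof. by have := fact_gt0 K; lia. Qed.

Lemma period_mul (B : Type) (s : Z -> B) (d : Z) :
  (forall t, s (t + d) = s t) -> forall (m : Z) t, s (t + m * d) = s t.
Proof.
move=> sd; have pos (m : nat) t : s (t + Z.of_nat m * d) = s t.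
  elim: m t => [|m IH] t; first by rewrite Z.mul_0_l Z.add_0_r.
  by rewrite -[RHS]IH -[RHS]sd; congr s; lia.
move=> m t; have [m0|m0] : 0 <= m \/ m <= 0 by lia.
  by rewrite -[RHS](pos (Z.to_nat m)) Z2Nat.id.
by rewrite -(pos (Z.to_nat (- m)) (t + _)) Z2Nat.id; [congr s; lia|lia].
Qed.

Lemma pigeonhole (St : finType) (S : {set St}) (s : Z -> St) (K : nat) (t : Z) :
  (#|S| <= K)%N -> (forall i, s i \in S) ->
  exists i j : nat, [/\ (i < j)%N, (j <= K)%N &
    s (t + Z.of_nat i) = s (t + Z.of_nat j)].
Proof.
move=> SK sS; pose f (i : 'I_K.+1) := s (t + Z.of_nat i).
have /injectivePn[i [j ij fij]] : ~~ injectiveb f.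
  apply/negP => /injectiveP finj.
  have : (#|f @: [set: 'I_K.+1]| <= #|S|)%N.
    by apply: subset_leq_card; apply/fintype.subsetP => _ /imsetP[i _ ->]; exact: sS.
  by rewrite card_imset // cardsT card_ord => /leq_trans /(_ SK); rewrite ltnn.
have [ltij|ltji|eij] := ltngtP i j.
- by exists i, j; split => //; rewrite -ltnS.
- by exists j, i; split => //; rewrite -ltnS.
- by case/eqP: ij; apply: val_inj.
Qed.

(** A coincidence found to the right of [t] propagates to the left, so [s] has a period [d <= K] on
    everything to the left of [t]. This [d] may depend on [t]; the factorial is a multiple of all
    candidates. *)
Lemma backward_det_periodic (St : finType) (S : {set St}) (s : Z -> St) (K : nat) :
  (#|S| <= K)%N -> (forall i, s i \in S) ->
  (forall i j, s (i + 1) = s (j + 1) -> s i = s j) ->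
  forall t, s (t + Z.of_nat K`!) = s t.
Proof.
(* Starting [K!] to the right of [t0] leaves room to walk back to [t0] in steps of [d]. *)
move=> SK sS sdet t0; set t := t0 + _.
have [i [j [ij jK sij]]] := pigeonhole t SK sS.
have back (m : nat) a b : s (a + Z.of_nat m) = s (b + Z.of_nat m) -> s a = s b.
  elim: m a b => [|m IH] a b; first by rewrite !Z.add_0_r.
  rewrite !Nat2Z.inj_succ => H; apply: IH; apply: sdet.
  by rewrite -!Z.add_assoc -!Z.add_1_r in H *.
pose d := (j - i)%N.
have per a : a <= t -> s a = s (a + Z.of_nat d).
  move=> at_; apply: (back (Z.to_nat (t - a) + i)%N).
  have -> : a + Z.of_nat (Z.to_nat (t - a) + i)%N = t + Z.of_nat i by lia.
  by rewrite sij; congr s; rewrite /d; lia.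
have d0 : (0 < d)%N by rewrite subn_gt0.
have dK : (d <= K)%N by rewrite (leq_trans (leq_subr _ _)).
have [m Em] := Zof_factS d0 dK.
have ind (q : nat) : (q <= m)%N -> s (t0 + Z.of_nat q * Z.of_nat d) = s t0.
  elim: q => [|q IH] qm; first by congr s; lia.
  rewrite -IH; last by lia.
  rewrite [RHS]per; last by rewrite /t Em; nia.
  by congr s; lia.
by rewrite /t Em ind.
Qed.

Lemma forward_det_periodic (St : finType) (S : {set St}) (s : Z -> St) (K : nat) :
  (#|S| <= K)%N -> (forall i, s i \in S) ->
  (forall i j, s i = s j -> s (i + 1) = s (j + 1)) ->
  forall t, s (t + Z.of_nat K`!) = s t.
Proof.
move=> SK sS sdet t.
have H i j : s (- (i + 1)) = s (- (j + 1)) -> s (- i) = s (- j).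
  by move=> /sdet; rewrite !(_ : forall z, - (z + 1) + 1 = - z) //; lia.
have := @backward_det_periodic _ S (fun i => s (- i)) K SK (fun i => sS _) H.
move=> /(_ (- t - Z.of_nat K`!)) E.
by rewrite (_ : t + _ = - (- t - Z.of_nat K`!)) -?E; [congr s; lia|lia].
Qed.

(** * The Morse-Hedlund theorem *)

Section MorseHedlund.
Variables (B : finType) (s : Z -> B).

Definition block (j : nat) (t : Z) : {ffun 'I_j -> B} :=
  [ffun i : 'I_j => s (t + Z.of_nat i)].

Definition blocks (j : nat) : {set {ffun 'I_j -> B}} :=
  [set w | `[< exists t, w = block j t >]].

Lemma block_in j t : block j t \in blocks j.
Proof. by rewrite inE; apply/asboolP; exists t. Qed.

Lemma block_eqP j t t' :
  block j t = block j t' <-> (forall i, (i < j)%N -> s (t + Z.of_nat i) = s (t' + Z.of_nat i)).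
Proof.
split=> [/ffunP E i ij|E].
  by have := E (Ordinal ij); rewrite !ffunE.
by apply/ffunP => i; rewrite !ffunE E.
Qed.

Definition cut_block j (w : {ffun 'I_j.+1 -> B}) : {ffun 'I_j -> B} :=
  [ffun i : 'I_j => w (widen_ord (leqnSn j) i)].

Lemma cut_blockE j t : cut_block (block j.+1 t) = block j t.
Proof. by apply/ffunP => i; rewrite !ffunE. Qed.

Lemma blocks_cut j : [set cut_block w | w in blocks j.+1] = blocks j.
Proof.
apply/setP => w; apply/imsetP/idP => [[x]|].
  by rewrite inE => /asboolP[t ->] ->; rewrite cut_blockE block_in.
by rewrite inE => /asboolP[t ->]; exists (block j.+1 t); rewrite ?block_in ?cut_blockE.
Qed.

(** The number of blocks, at least one for length 0, cannot increase at every step up to [c]; where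
    it does not, a block of length [j] determines the letter after it. The bound [d <= c], sharper
    than the period [c!], matters where a period has to fit into a window. *)
Lemma morse_hedlund_period (c : nat) : (#|blocks c| <= c)%N -> (0 < c)%N ->
  exists2 d : nat, (0 < d <= c)%N & forall t, s (t + Z.of_nat d) = s t.
Proof.
move=> cc c0.
have [j jc jdet] : exists2 j : nat, (j < c)%N & (#|blocks j.+1| <= #|blocks j|)%N.
  apply: contrapT => /forall2NP H.
  have H' j : (j < c)%N -> (#|blocks j| < #|blocks j.+1|)%N.
    by move=> jc; case: (H j) => // /negP; rewrite -ltnNge.
  have : forall j, (j <= c)%N -> (j < #|blocks j|)%N.
    elim=> [|j IH] jc; first by apply/card_gt0P; exists (block 0 0); exact: block_in.
    by apply: leq_ltn_trans (H' _ jc); apply: IH; exact: ltnW.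
  by move=> /(_ c (leqnn c)); rewrite ltnNge cc.
have mono i : (#|blocks i| <= #|blocks i.+1|)%N.
  by rewrite -blocks_cut leq_imset_card.
have jc' : (#|blocks j| <= c)%N.
  apply: leq_trans cc; have : (j <= c)%N by exact: ltnW.
  elim: c {c0 jc} => [|c IH]; first by rewrite leqn0 => /eqP->.
  rewrite leq_eqVlt => /orP[/eqP-> //|]; rewrite ltnS => /IH/leq_trans; apply; exact: mono.
have inj : {in blocks j.+1 &, injective (@cut_block j)}.
  apply/imset_injP; rewrite blocks_cut eqn_leq jdet andbT; exact: mono.
have det i i' : block j i = block j i' -> s (i + Z.of_nat j) = s (i' + Z.of_nat j).
  rewrite -(cut_blockE j i) -(cut_blockE j i') => /inj; rewrite !block_in => /(_ isT isT)
    /block_eqP; apply.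
  exact: ltnSn.
have fdet i i' : block j i = block j i' -> block j (i + 1) = block j (i' + 1).
  move=> E; apply/block_eqP => l lj.
  have [lj1|] := boolP (l.+1 < j)%N.
    by move/block_eqP: E => /(_ _ lj1); rewrite !(_ : forall z,
      z + Z.of_nat l.+1 = z + 1 + Z.of_nat l) //; lia.
  move=> lj1; have e z : z + 1 + Z.of_nat l = z + Z.of_nat j by lia.
  by rewrite !e; exact: det.
have sper t : s (t + Z.of_nat c`!) = s t.
  have := forward_det_periodic jc' (block_in j) fdet (t - Z.of_nat j).
  move=> E; have := det _ _ E; rewrite (_ : _ - _ + _ + _ = t + Z.of_nat c`!); last by lia.
  by move=> ->; congr s; lia.
(* The pigeonhole gives a period at most [c] only far to the right; the period [c!] then carries it
   to every [t]. *)
have [i [i' [ii' i'c E]]] := pigeonhole 0 jc' (block_in j).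
exists (i' - i)%N; first by lia.
have fwd (m : nat) : block j (Z.of_nat i + Z.of_nat m) = block j (Z.of_nat i' + Z.of_nat m).
  elim: m => [|m IH]; first by move: E; rewrite !Z.add_0_l !Z.add_0_r.
  by rewrite Nat2Z.inj_succ -Z.add_1_r !Z.add_assoc; apply: fdet.
have fwd' t : Z.of_nat i + Z.of_nat j <= t -> s t = s (t + Z.of_nat (i' - i)).
  move=> it; have := det _ _ (fwd (Z.to_nat (t - Z.of_nat i - Z.of_nat j))).
  by rewrite !(_ : forall z, z + _ + _ = z - Z.of_nat i + t); [|lia..] => H;
    rewrite (_ : t = Z.of_nat i - Z.of_nat i + t); [rewrite H; congr s; lia|lia].
move=> t; pose q := Z.of_nat i + Z.of_nat j + Z.abs t.
have F := fact_Zgt0 c.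
rewrite -(period_mul sper q (t + _)) -[RHS](period_mul sper q t).
rewrite [RHS]fwd'; last by rewrite /q; nia.
by congr s; lia.
Qed.

(** The form in which the theorem is applied: [k t] is an ambiguous pattern seen at [t] that
    contains [c] consecutive letters of [s], so few ambiguous patterns leave few blocks. *)
Lemma morse_hedlund_code (D : finType) (S : {set D}) (k : Z -> D) (c : nat) :
  (#|S| <= c)%N -> (forall t, k t \in S) ->
  (forall t t', k t = k t' -> forall i, (i < c)%N -> s (t + Z.of_nat i) = s (t' + Z.of_nat i)) ->
  exists2 d : nat, (0 < d <= c)%N & forall t, s (t + Z.of_nat d) = s t.
Proof.
move=> Sc kS kdet; apply: morse_hedlund_period; last first.
  by apply: leq_trans Sc; apply/card_gt0P; exists (k 0).
apply: leq_trans Sc.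
pose g (d : D) : {ffun 'I_c -> B} :=
  if pselect (exists t, k t = d) is left H then block c (projT1 (cid H)) else block c 0.
apply: leq_trans (leq_imset_card g S).
apply: subset_leq_card; apply/fintype.subsetP => w; rewrite inE => /asboolP[t ->].
apply/imsetP; exists (k t) => //; rewrite /g; case: pselect => [H|]; last by case; exists t.
by case: (cid H) => t' /= kt'; apply/block_eqP => i ic; apply: kdet ic.
Qed.

End MorseHedlund.

(** * Maps that lose few values: fibres and collisions *)

Section Excess.
Variables (E V : finType) (f : E -> V) (S : {set E}) (c : nat).
Hypothesis Sc : (#|S| <= #|f @: S| + c)%N.

(** Dropping [Y] loses no value of [f], so [S :\: Y] still has at least [#|f @: S|] elements. *)
Lemma card_redundant (Y : {set E}) : Y \subset S ->
  (forall x, x \in Y -> exists y, [/\ y \in S, y \notin Y & f y = f x]) -> (#|Y| <= c)%N.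
Proof.
move=> YS H; have : (#|f @: S| <= #|S :\: Y|)%N.
  apply: leq_trans (leq_imset_card f _); apply: subset_leq_card.
  apply/fintype.subsetP => _ /imsetP[x xS ->]; have [/H[y [yS yY <-]]|xY] := boolP (x \in Y).
    by apply: imset_f; rewrite inE yY.
  by apply: imset_f; rewrite inE xY.
rewrite cardsD (setIidPr YS); have := subset_leq_card YS; lia.
Qed.

(** One chosen preimage for each value in [Y] is redundant, since the value is attained a second
    time. *)
Lemma card_ambiguous (Y : {set V}) :
  (forall v, v \in Y -> exists a b, [/\ a \in S, b \in S, a != b, f a = v & f b = v]) ->
  (#|Y| <= c)%N.
Proof.
move=> H.
have [->|[v0 v0Y]] := set_0Vmem Y; first by rewrite cards0.
have [e0 _] := H _ v0Y.
pose g v := if pselect (exists a, a \in S /\ f a = v) is left H then projT1 (cid H) else e0.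
have gP v : v \in Y -> g v \in S /\ f (g v) = v.
  move=> vY; rewrite /g; case: pselect => [H'|[]]; first by case: (cid H').
  by have [a [b [aS _ _ fa _]]] := H _ vY; exists a.
have ginj : {in Y &, injective g}.
  by move=> v w vY wY gvw; rewrite -(gP _ vY).2 -(gP _ wY).2 gvw.
rewrite -(card_in_imset ginj); apply: card_redundant.
  by apply/fintype.subsetP => _ /imsetP[v vY ->]; exact: (gP _ vY).1.
move=> _ /imsetP[v vY ->]; have [a [b [aS bS ab fa fb]]] := H _ vY.
have key y : y \in S -> f y = v -> y != g v -> exists y0, [/\ y0 \in S,
  y0 \notin g @: Y & f y0 = f (g v)].
  move=> yS fy yg; exists y; split => //; last by rewrite (gP _ vY).2.
  apply/imsetP => -[w wY yw]; move: yg; rewrite yw => /eqP; apply.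
  by congr g; rewrite -fy yw (gP _ wY).2.
have [ag|ag] := eqVneq a (g v); last exact: (key a).
by apply: (key b) => //; rewrite -ag eq_sym.
Qed.

End Excess.

Section SmallExcess.
Variables (E V : finType) (f : E -> V) (S : {set E}).

Lemma excess0_inj : (#|S| <= #|f @: S|)%N -> {in S &, injective f}.
Proof.
by move=> H; apply/imset_injP; rewrite eqn_leq leq_imset_card.
Qed.

(** A fibre of three points, or two nontrivial fibres, would give two redundant points. *)
Lemma excess1_unique a b x y : (#|S| <= #|f @: S| + 1)%N ->
  a \in S -> b \in S -> x \in S -> y \in S -> a != b -> x != y -> f a = f b -> f x = f y ->
  (x \in [set a; b]) && (y \in [set a; b]).
Proof.
move=> Sc aS bS xS yS ab xy fab fxy.
have two (u v w : E) : u \in S -> v \in S -> w \in S -> u != v -> u != w -> v != w ->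
    f u = f v -> f u = f w -> False.
  move=> uS vS wS uv uw vw fuv fuw.
  suff : (#|[set v; w]| <= 1)%N by rewrite cards2 vw.
  apply: (card_redundant Sc); first by rewrite subUset !sub1set vS.
  by move=> z /set2P[]->; exists u; rewrite !inE negb_or uv uw; split.
have other (z z' : E) : z \in S -> z' \in S -> z != z' -> f z = f z' -> z \notin [set a;
  b] -> False.
  move=> zS z'S zz' fz; rewrite !inE negb_or => /andP[za zb].
  have [fza|fza] := eqVneq (f z) (f a).
    by apply: (two a b z) => //; rewrite eq_sym.
  have zz'a : z' != a by apply: contraNneq fza => <-; rewrite fz.
  have zz'b : z' != b by apply: contraNneq fza => z'b; rewrite fz z'b fab.
  suff : (#|[set a; z]| <= 1)%N by rewrite cards2 eq_sym za.
  apply: (card_redundant Sc); first by rewrite subUset !sub1set aS.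
  move=> w /set2P[]->.
    by exists b; rewrite !inE negb_or eq_sym ab (eq_sym b) zb; split.
  by exists z'; rewrite !inE negb_or zz'a eq_sym zz'; split.
apply/andP; split; apply/negPn/negP => H.
  exact: (other x y).
by apply: (other y x) => //; rewrite eq_sym.
Qed.

(** Three redundant points are impossible. This excludes a fibre of four points ([three]), a fibre
    of three next to another nontrivial one ([twoone]) and three nontrivial fibres ([threecl]). The
    two given pairs then exhaust all collisions, either inside one fibre of three points or as two
    separate fibres. *)
Lemma excess2_unique a b d e x y : (#|S| <= #|f @: S| + 2)%N ->
  a \in S -> b \in S -> d \in S -> e \in S -> x \in S -> y \in S ->
  a != b -> d != e -> x != y -> a \notin [set d; e] -> f a = f b -> f d = f e -> f x = f y ->
  [/\ x \in [set a; b; d; e], y \in [set a; b; d; e] &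
      (b \in [set d; e]) \/
      ((x \in [set a; b]) /\ (y \in [set a; b]) \/ (x \in [set d; e]) /\ (y \in [set d; e]))].
Proof.
move=> Sc aS bS dS eS xS yS ab de xy ade fab fde fxy.
have red := @card_redundant _ _ f S 2 Sc.
move: ade; rewrite !inE negb_or => /andP[ad ae].
have three (u v w z : E) : u \in S -> v \in S -> w \in S -> z \in S ->
   uniq [:: u; v; w; z] -> f v = f u -> f w = f u -> f z = f u -> False.
  move=> uS vS wS zS; rewrite /= !inE !negb_or => /and4P[/and3P[uv uw uz] /andP[vw vz] wz _]
    fv fw fz.
  suff : (#|[set v; w; z]| <= 2)%N by rewrite -setUA cardsU1 cards2 !inE negb_or vw vz wz.
  apply: red; first by rewrite !subUset !sub1set vS wS.
  move=> t; rewrite !inE -orbA => /or3P[] /eqP->; exists u; rewrite !inE !negb_or uv uw uz;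
    split => //.
have twoone (u v w z t : E) : u \in S -> v \in S -> w \in S -> z \in S -> t \in S ->
   uniq [:: u; v; w] -> z != t -> f v = f u -> f w = f u -> f z = f t -> f z <> f u -> False.
  move=> uS vS wS zS tS; rewrite /= !inE !negb_or => /and3P[/andP[uv uw] vw _] zt fv fw fz fzu.
  have diff q q' : f q = f z -> f q' = f u -> q != q'.
    by move=> E1 E2; apply/eqP => qq; apply: fzu; rewrite -E1 qq.
  have zv : z != v by apply: diff.
  have zw : z != w by apply: diff.
  suff : (#|[set v; w; z]| <= 2)%N.
    by rewrite -setUA cardsU1 cards2 !inE negb_or vw eq_sym zv eq_sym zw.
  apply: red; first by rewrite !subUset !sub1set vS wS.
  move=> q; rewrite !inE -orbA => /or3P[] /eqP->.
  - by exists u; rewrite !inE !negb_or uv uw (eq_sym u) (diff z u); split.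
  - by exists u; rewrite !inE !negb_or uv uw (eq_sym u) (diff z u); split.
  - have tv : t != v by apply: diff.
    have tw : t != w by apply: diff.
    by exists t; rewrite !inE !negb_or tv tw eq_sym zt; split.
have threecl (u v w z t q : E) : u \in S -> v \in S -> w \in S -> z \in S -> t \in S -> q \in S ->
   u != v -> w != z -> t != q -> f v = f u -> f z = f w -> f q = f t ->
   f u <> f w -> f u <> f t -> f w <> f t -> False.
  move=> uS vS wS zS tS qS uv wz tq fv fz fq uw ut wt.
  have ne (x0 y0 : E) : f x0 <> f y0 -> x0 != y0 by move=> H; apply/eqP => xy0; apply: H;
    rewrite xy0.
  suff : (#|[set u; w; t]| <= 2)%N by rewrite -setUA cardsU1 cards2 !inE negb_or !ne.
  apply: red; first by rewrite !subUset !sub1set uS wS.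
  move=> r; rewrite !inE -orbA => /or3P[] /eqP->.
  - by exists v; rewrite !inE !negb_or eq_sym uv !ne // fv.
  - exists z; rewrite !inE !negb_or (eq_sym z w) wz !ne // fz //; exact: nesym.
  - exists q; rewrite !inE !negb_or (eq_sym q t) tq !ne // fq //; exact: nesym.
have [fad|/eqP fad] := eqVneq (f a) (f d).
- have bde : b \in [set d; e].
    rewrite !inE; apply/negPn/negP; rewrite negb_or => /andP[bd be].
    apply: (three a b d e) => //; last by rewrite -fde -fad.
    by rewrite /= !inE !negb_or ab ad ae bd be de.
  have fe : f e = f a by rewrite -fde -fad.
  have [fxa|/eqP fxa] := eqVneq (f x) (f a); last first.
    exfalso; apply: (twoone a d e x y) => //.
    by rewrite /= !inE negb_or ad ae de.
  have cls z : z \in S -> f z = f a -> (z == a) || (z == b) || (z == d) || (z == e).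
    move=> zS fza; apply/negPn/negP; rewrite !negb_or -!andbA => /and4P[za zb zd ze].
    apply: (three a d e z) => //.
    by rewrite /= !inE !negb_or ad ae de (eq_sym a) za (eq_sym d) zd (eq_sym e) ze.
  by split; [exact: cls|apply: cls => //; rewrite -fxy|left; move: bde; rewrite !inE].
- have [fxa|/eqP fxa] := eqVneq (f x) (f a).
    have cls z : z \in S -> f z = f a -> (z == a) || (z == b).
      move=> zS fza; apply/negPn/negP; rewrite !negb_or => /andP[za zb].
      apply: (twoone a b z d e) => //; last exact: nesym.
      by rewrite /= !inE !negb_or ab (eq_sym a) za (eq_sym b) zb.
    have cx := cls _ xS fxa; have cy : (y == a) || (y == b) by apply: cls; rewrite -?fxy.
    by split; [rewrite cx|rewrite cy|right; left].
  have [fxd|/eqP fxd] := eqVneq (f x) (f d).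
    have cls z : z \in S -> f z = f d -> (z == d) || (z == e).
      move=> zS fza; apply/negPn/negP; rewrite !negb_or => /andP[za zb].
      apply: (twoone d e z a b) => //.
      by rewrite /= !inE !negb_or de (eq_sym d) za (eq_sym e) zb.
    have cx := cls _ xS fxd; have cy : (y == d) || (y == e) by apply: cls; rewrite -?fxy.
    by split; [rewrite -orbA cx orbT|rewrite -orbA cy orbT|right; right].
  exfalso; apply: (threecl a b d e x y) => //; exact: nesym.
Qed.

End SmallExcess.

(** * Patterns and generating sets *)

Section Patterns.
Variables (A : finType) (n : nat).
Notation cfg := (Z -> Z -> A).
Notation C := ('I_n * 'I_3)%type.

Definition cx (i : C) : Z := Z.of_nat i.1.
Definition cy (i : C) : Z := Z.of_nat i.2.

Lemma cell_bounds (i : C) : 0 <= cx i < Z.of_nat n /\ 0 <= cy i <= 2.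
Proof. by have := ltn_ord i.1; have := ltn_ord i.2; rewrite /cx /cy; lia. Qed.

Lemma cell_inj (i j : C) : cx i = cx j -> cy i = cy j -> i = j.
Proof.
case: i j => [i1 i2] [j1 j2]; rewrite /cx /cy /= => /Nat2Z.inj/val_inj-> /Nat2Z.inj/val_inj->.
by [].
Qed.

Lemma cellP (x y : Z) : 0 <= x < Z.of_nat n -> 0 <= y <= 2 ->
  exists i : C, cx i = x /\ cy i = y.
Proof.
move=> hx hy; have x1 : (Z.to_nat x < n)%N by lia.
have y1 : (Z.to_nat y < 3)%N by lia.
by exists (Ordinal x1, Ordinal y1); rewrite /cx /cy /=; lia.
Qed.

Definition shiftc (a b : Z) (h : cfg) : cfg := fun x y => h (x + a) (y + b).

(** The orbit closure of [eta] in combinatorial form; [orbit_closure_hull] relates it to the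
    topological one. *)
Definition in_hull (eta h : cfg) := forall r, exists u v, forall x y,
  Z.abs x <= r -> Z.abs y <= r -> h x y = eta (x + u) (y + v).

Lemma in_hull_refl eta : in_hull eta eta.
Proof. by move=> r; exists 0, 0 => x y _ _; rewrite !Z.add_0_r. Qed.

Lemma in_hull_shift eta h a b : in_hull eta h -> in_hull eta (shiftc a b h).
Proof.
move=> H r; have [u [v E]] := H (r + Z.abs a + Z.abs b).
exists (a + u), (b + v) => x y hx hy; rewrite /shiftc E; [|lia..].
by rewrite !Z.add_assoc.
Qed.

(** The value [None] off [T] lets the patterns on all subsets of the window share one type. *)
Definition pat (T : {set C}) (h : cfg) (x y : Z) : {ffun C -> option A} :=
  [ffun i => if i \in T then Some (h (x + cx i) (y + cy i)) else None].

Definition pats (eta : cfg) (T : {set C}) : {set {ffun C -> option A}} :=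
  [set w | `[< exists x y, w = pat T eta x y >]].

Lemma pat_eqP T h h' x y x' y' : pat T h x y = pat T h' x' y' <->
  (forall i, i \in T -> h (x + cx i) (y + cy i) = h' (x' + cx i) (y' + cy i)).
Proof.
split=> [/ffunP E i iT|E]; last first.
  by apply/ffunP => i; rewrite !ffunE; case: ifP => // iT; rewrite E.
by have := E i; rewrite !ffunE iT => -[].
Qed.

Lemma pat_hull eta T h x y : in_hull eta h -> pat T h x y \in pats eta T.
Proof.
move=> H; rewrite inE; apply/asboolP.
have [u [v E]] := H (Z.abs x + Z.abs y + Z.of_nat n + 3).
exists (x + u), (y + v); apply/pat_eqP => i iT.
by have := cell_bounds i => ib; rewrite E; [congr eta; lia|lia..].
Qed.

Definition restr (T : {set C}) (w : {ffun C -> option A}) : {ffun C -> option A} :=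
  [ffun i => if i \in T then w i else None].

Lemma restr_pat (T T' : {set C}) h x y : T' \subset T -> restr T' (pat T h x y) = pat T' h x y.
Proof.
move=> sT; apply/ffunP => i; rewrite !ffunE; case: ifP => // iT'.
by rewrite (fintype.subsetP sT _ iT').
Qed.

Lemma restr_pats (T T' : {set C}) eta : T' \subset T ->
  [set restr T' w | w in pats eta T] = pats eta T'.
Proof.
move=> sT; apply/setP => w; apply/imsetP/idP => [[x]|].
  rewrite inE => /asboolP[u [v ->]] ->; rewrite restr_pat // pat_hull //; exact: in_hull_refl.
rewrite inE => /asboolP[u [v ->]]; exists (pat T eta u v); rewrite ?restr_pat //.
by apply: pat_hull; exact: in_hull_refl.
Qed.

(* Weaker than being the set of lattice points of a convex polygon. *)
Record convex (T : {set C}) : Prop := Convex {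
  convex_row : forall i j k, i \in T -> k \in T -> cy i = cy j -> cy j = cy k ->
    cx i <= cx j <= cx k -> j \in T;
  convex_mid : forall i j k, i \in T -> k \in T -> cy i = 0 -> cy j = 1 -> cy k = 2 ->
    cx i + cx k = 2 * cx j -> j \in T }.

Definition flev (f g : Z) (i : C) := f * cx i + g * cy i.

(** A strict lexicographic maximum of two linear functionals is an extreme point: it lies neither
    between two other points of its row nor midway between two others. *)
Lemma convex_lex T x f g f' g' : convex T ->
  (forall i, i \in T -> i != x -> flev f g i < flev f g x \/
     flev f g i = flev f g x /\ flev f' g' i < flev f' g' x) ->
  convex (T :\ x).
Proof.
rewrite /flev => -[cI cM] H; split=> i j k /setD1P[ix iT] /setD1P[kx kT].
  move=> yij yjk xijk; apply/setD1P; split; last exact: cI xijk.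
  apply/eqP => jx; subst j.
  have xix : cx i <> cx x by move=> E; case/eqP: ix; exact: cell_inj.
  have xkx : cx k <> cx x by move=> E; case/eqP: kx; exact: cell_inj.
  have [l|[e l]] := H _ iT ix; have [l'|[e' l']] := H _ kT kx; nia.
move=> y0 y1 y2 xm; apply/setD1P; split; last exact: cM xm.
apply/eqP => jx; subst j.
have [l|[e l]] := H _ iT ix; have [l'|[e' l']] := H _ kT kx; nia.
Qed.

Lemma convex_cut T f g M : convex T -> convex [set i in T | flev f g i <? M].
Proof.
rewrite /flev => -[cI cM]; split=> i j k; rewrite !inE => /andP[iT /Z.ltb_lt iM]
  /andP[kT /Z.ltb_lt kM].
  move=> yij yjk xijk; rewrite (cI i j k) //=; apply/Z.ltb_lt.
  have [f0|f0] : 0 <= f \/ f <= 0 by lia.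
    have := Z.mul_le_mono_nonneg_l (cx j) (cx k) f f0; rewrite yjk; lia.
  have := Z.mul_le_mono_nonpos_l (cx i) (cx j) f f0; rewrite -yij; lia.
by move=> y0 y1 y2 xm; rewrite (cM i j k) //=; apply/Z.ltb_lt; nia.
Qed.

Definition rows (k : nat) : {set C} := [set i : C | (i.2 < k)%N].

Lemma card_rows k : (k <= 3)%N -> #|rows k| = (n * k)%N.
Proof.
move=> k3; have -> : rows k = setX [set: 'I_n] [set j : 'I_3 | (j < k)%N].
  by apply/setP => -[i j]; rewrite !inE.
rewrite cardsX cardsT card_ord; congr muln.
by rewrite -sum1dep_card (big_ord_narrow k3) sum1_card card_ord.
Qed.

Lemma convex_rows k : convex (rows k).
Proof.
split=> i j l; rewrite !inE /cy; lia.
Qed.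

(** A height at which the count drops to the number of cells. By [lc_gt], agreement on [k - 1] rows
    of a rectangle leaves at most [n] ambiguous patterns, which makes agreement on so few rows
    meaningful. *)
Record low_complexity (eta : cfg) (k : nat) : Prop := LowComplexity {
  lc_k0 : (0 < k)%N;
  lc_k3 : (k <= 3)%N;
  lc_le : (#|pats eta (rows k)| <= n * k)%N;
  lc_gt : (n * k.-1 < #|pats eta (rows k.-1)|)%N }.

Lemma low_complexity_ex eta k : (k <= 3)%N ->
  (#|pats eta (rows k)| <= n * k)%N -> exists k', low_complexity eta k'.
Proof.
elim: k => [|k IH] k3 H.
  have : (0 < #|pats eta (rows 0)|)%N.
    by apply/card_gt0P; exists (pat (rows 0) eta 0 0); apply: pat_hull; exact: in_hull_refl.
  by rewrite muln0 in H; lia.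
have [H'|H'] := leqP #|pats eta (rows k)| (n * k).
  by apply: IH H'; exact: ltnW.
by exists k.+1.
Qed.

Record generating (eta : cfg) (k : nat) (T : {set C}) : Prop := Generating {
  gen_lc : low_complexity eta k;
  gen_convex : convex T;
  gen_rows : T \subset rows k;
  gen_le : (#|pats eta T| <= #|T|)%N;
  gen_min : forall T', convex T' -> T' \proper T -> (#|T'| < #|pats eta T'|)%N }.

Lemma generating_ex eta k : low_complexity eta k -> exists T, generating eta k T.
Proof.
move=> lc.
pose P (T : {set C}) := `[< [/\ convex T, T \subset rows k & (#|pats eta T| <= #|T|)%N] >].
have P0 : P (rows k).
  apply/asboolP; split; [exact: convex_rows|by []|].
  by rewrite card_rows; [exact: (lc_le lc)|exact: (lc_k3 lc)].
case: (arg_minnP (fun T : {set C} => #|T|) P0) => T /asboolP[cT sT leT] minT.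
exists T; split => // T' cT' pT'; rewrite ltnNge; apply/negP => le'.
have := minT T'; rewrite leqNgt (proper_card pT') => H.
suff: false by []; apply: H; apply/asboolP; split => //.
exact: subset_trans (proper_sub pT') sT.
Qed.

Section Window.
Variables (eta : cfg) (k : nat) (T : {set C}).
Hypothesis gT : generating eta k T.
Notation X := (in_hull eta).

(** [T] has at most [#|T|] patterns, while [T'], by minimality, has at least [#|T'| + 1]. All
    statements about vertices, faces and differing windows come from this inequality. *)
Lemma gen_excess (T' : {set C}) : convex T' -> T' \proper T ->
  (#|pats eta T| <= #|[set restr T' w | w in pats eta T]| + (#|T| - #|T'| - 1))%N.
Proof.
move=> cT' pT'; rewrite restr_pats ?proper_sub //.
have := gen_min gT cT' pT'; have := gen_le gT; have := proper_card pT'.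
move: #|pats eta T| #|pats eta T'| #|T| #|T'| => p p' t t'; lia.
Qed.

(** Removing a single point has excess zero, so restriction to [T :\ x] is injective on patterns.
    The two windows may lie at different places of different configurations. *)
Lemma vertex_rule x h h' u v u' v' : x \in T -> convex (T :\ x) -> X h -> X h' ->
  (forall i, i \in T -> i != x -> h (u + cx i) (v + cy i) = h' (u' + cx i) (v' + cy i)) ->
  h (u + cx x) (v + cy x) = h' (u' + cx x) (v' + cy x).
Proof.
move=> xT cTx Xh Xh' E.
have pT : T :\ x \proper T by rewrite properD1.
have := gen_excess cTx pT; rewrite (cardsD1 x T) xT.
rewrite (_ : _ - _ - 1 = 0)%N; last by lia.
rewrite addn0 => /excess0_inj inj.
have /inj : pat T h u v \in pats eta T by exact: pat_hull.
move=> /(_ (pat T h' u' v')); rewrite pat_hull // !restr_pat ?proper_sub // => H.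
have /pat_eqP : pat T h u v = pat T h' u' v'; last exact.
apply: H => //; apply/pat_eqP => i /setD1P[ix iT]; exact: E.
Qed.

Definition ambiguous (T' : {set C}) : {set {ffun C -> option A}} :=
  [set w | `[< exists a b, [/\ a \in pats eta T, b \in pats eta T, a != b,
    restr T' a = w & restr T' b = w] >]].

Lemma card_ambiguous_pats (T' : {set C}) : convex T' -> T' \proper T ->
  (#|ambiguous T'| <= #|T| - #|T'| - 1)%N.
Proof.
move=> cT' pT'; apply: (card_ambiguous (gen_excess cT' pT')) => w.
by rewrite inE => /asboolP.
Qed.

Lemma ambiguousP (T' : {set C}) h h' u v u' v' i : T' \proper T -> X h -> X h' ->
  (forall i, i \in T' -> h (u + cx i) (v + cy i) = h' (u' + cx i) (v' + cy i)) ->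
  i \in T -> h (u + cx i) (v + cy i) <> h' (u' + cx i) (v' + cy i) ->
  pat T' h u v \in ambiguous T'.
Proof.
move=> pT' Xh Xh' E iT ne; rewrite inE; apply/asboolP.
exists (pat T h u v), (pat T h' u' v'); split; rewrite ?pat_hull ?restr_pat ?proper_sub //.
  by apply/eqP => /pat_eqP/(_ _ iT).
by apply/pat_eqP => j /E->.
Qed.

End Window.
End Patterns.

(** * Linear relations *)

(** Coprimality in Bezout form, because the coefficients are used: [(q, - p)] has level one and is
    transversal to [(a, b)]. *)
Definition prim (a b : Z) := exists p q, p * a + q * b = 1.
(** The values index the lattice lines of direction [(a, b)]; passing to [(- a, - b)] exchanges the
    two sides. *)
Definition lev (a b x y : Z) := b * x - a * y.

Lemma primN a b : prim a b -> prim (- a) (- b).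
Proof. by move=> [p [q E]]; exists (- p), (- q); lia. Qed.

Lemma prim_col a b x y : prim a b -> lev a b x y = 0 -> exists j, x = j * a /\ y = j * b.
Proof.
rewrite /lev => -[p [q E]] H; exists (p * x + q * y); have e : b * x = a * y by lia.
have Ex := congr1 (Z.mul x) E; have Ey := congr1 (Z.mul y) E.
have e1 := congr1 (Z.mul q) e; have e2 := congr1 (Z.mul p) e.
lia.
Qed.

Lemma prim_neq0 a b : prim a b -> a <> 0 \/ b <> 0.
Proof. by move=> [p [q E]]; nia. Qed.

Lemma integral_multiple (m : nat) (u : 'I_m -> rat) :
  exists (D : int) (z : 'I_m -> int), D != 0%R /\ forall i, (D%:~R * u i = (z i)%:~R)%R.
Proof.
exists (\prod_i denq (u i))%R, (fun i => numq (u i) * \prod_(j | j != i) denq (u j))%R.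
split; first by apply/prodf_neq0 => i _; exact: denq_neq0.
by move=> i; rewrite (bigD1 i) //= !intrM numqE mulrC mulrA.
Qed.

Section Relation.
Variables (A : finType) (n : nat).
Notation cfg := (Z -> Z -> A).
Notation C := ('I_n * 'I_3)%type.

Definition val_of (a : A) : int := Posz (enum_rank a).

Lemma val_of_inj : injective val_of.
Proof. by move=> a b [] /ord_inj/enum_rank_inj. Qed.

Lemma val_of_bound a : (0 <= val_of a <= #|A|%:Z)%R.
Proof. by rewrite /val_of lez_nat ltnW // ltn_ord. Qed.

Definition psum (c : C -> int) (e : Z -> Z -> int) (x y : Z) : int :=
  (\sum_i c i * e (x + cx i)%ZZ (y + cy i)%ZZ)%R.

Lemma psumB c e f x y : psum c (fun x y => (e x y - f x y)%R) x y = (psum c e x y - psum c f x y)%R.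
Proof. by rewrite /psum -sumrB; apply: eq_bigr => i _; rewrite mulrBr. Qed.

Lemma psum_shift c e s t x y :
  psum c (fun x y => e (x + s)%ZZ (y + t)%ZZ) x y = psum c e (x + s)%ZZ (y + t)%ZZ.
Proof. by apply: eq_bigr => i _; congr (_ * e _ _)%R; lia. Qed.

Lemma psum_single c e i0 x y : (forall i, c i <> 0%R -> i <> i0 -> e (x + cx i) (y + cy i) = 0%R) ->
  psum c e x y = (c i0 * e (x + cx i0)%ZZ (y + cy i0)%ZZ)%R.
Proof.
move=> H; rewrite /psum (bigD1 i0) //= big1 ?addr0 // => i /eqP ii0.
by have [->|/eqP ci] := eqVneq (c i) 0%R; rewrite ?mul0r // H // mulr0.
Qed.

Record relation (eta : cfg) (T : {set C}) (c : C -> int) (k0 : int) : Prop := IsRelation {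
  rel_nz : exists i, c i <> 0%R;
  rel_T : forall i, c i <> 0%R -> i \in T;
  rel_sum : forall h, in_hull eta h -> forall x y, psum c (fun x y => val_of (h x y)) x y = k0 }.

(** The matrix with a row for each cell of [T], one more row of constants and a column for each
    pattern has more rows than columns, hence a nonzero vector in its left kernel. After clearing
    denominators, the coefficients of the cells cannot all vanish, since the constant would vanish
    with them. *)
Lemma relation_ex eta k (T : {set C}) : generating eta k T -> exists c k0, relation eta T c k0.
Proof.
move=> gT; have leT := gen_le gT.
have P0 : pat T eta 0 0 \in pats eta T by apply: pat_hull; exact: in_hull_refl.
have [x0 x0T] : exists x0, x0 \in T by apply/card_gt0P; apply: leq_trans leT; apply/card_gt0P;
  exists (pat T eta 0 0).
pose vo (o : option A) : rat := if o is Some a then ((val_of a)%:~R)%R else 0%R.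
pose M := (\matrix_(i < #|T|.+1, j < #|pats eta T|)
  if unlift ord0 i is Some i' then vo ((enum_val j : {ffun C ->
    option A}) (enum_val i')) else -1)%R.
have : kermx M != 0%R.
  rewrite kermx_eq0 /row_free neq_ltn; apply/orP; left.
  by apply: leq_ltn_trans (rank_leq_col M) _; rewrite ltnS.
move=> /rowV0Pn[u /sub_kermxP uM u0].
have [D [z [D0 Dz]]] := integral_multiple (fun i => u ord0 i).
have key (w : {ffun C -> option A}) : w \in pats eta T ->
    (\sum_(i < #|T|) (z (lift ord0 i))%:~R * vo (w (enum_val i)) = (z ord0)%:~R :> rat)%R.
  move=> wP; have := congr1 (fun B : 'rV_ _ => (D%:~R * B ord0 (enum_rank_in P0 w))%R) uM.
  rewrite !mxE mulr0 big_ord_recl !mxE unlift_none mulrN1 mulrDr mulrN Dz => /eqP.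
  rewrite addrC subr_eq0 => /eqP <-; rewrite mulr_sumr; apply: eq_bigr => i _.
  by rewrite !mxE liftK enum_rankK_in // mulrA Dz.
pose c (i : C) := if i \in T then z (lift ord0 (enum_rank_in x0T i)) else 0%R.
have cT i : c i <> 0%R -> i \in T by rewrite /c; case: ifP.
have sumc h x y : in_hull eta h -> psum c (fun x y => val_of (h x y)) x y = z ord0.
  move=> Xh; apply: (intr_inj (R := rat)); rewrite -(key (pat T h x y)); last exact: pat_hull.
  rewrite /psum (bigID (fun i => i \in T)) /= [X in (_ + X)%R]big1 ?addr0; last first.
    by move=> i /negbTE iT; rewrite /c iT mul0r.
  rewrite rmorph_sum /= big_enum_val /=; apply: eq_bigr => j _.
  by rewrite rmorphM /= /c enum_valP enum_valK_in ffunE enum_valP.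
exists c, (z ord0); split => //; last by move=> h Xh x y; exact: sumc.
apply: contrapT => /forallNP c0.
have c0' i : c i = 0%R by apply: contrapT.
have z0 : z ord0 = 0%R.
  by rewrite -(sumc eta 0 0 (in_hull_refl eta)) /psum big1 // => i _; rewrite c0' mul0r.
case/eqP: u0; apply/rowP => i; rewrite !mxE.
suff : (D%:~R * u ord0 i == 0)%R by rewrite mulf_eq0 intr_eq0 (negbTE D0) => /eqP.
rewrite Dz intr_eq0; case: (unliftP ord0 i) => [j ->|->]; last by rewrite z0.
by have := c0' (enum_val j); rewrite /c enum_valP enum_valK_in => ->.
Qed.

(* [K0] exceeds [n + 2] and the number of values that the difference of two configurations
   takes on a segment of [n + 3] cells. *)
Definition K0 : nat := ((4 * #|A|).+1 ^ (n + 3) + n)%N.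
Definition Nper : Z := Z.of_nat K0`!.

Lemma Nper_gt0 : 0 < Nper.
Proof. exact: fact_Zgt0. Qed.

Section Propagate.
Variables (c : C -> int) (e : Z -> Z -> int) (k0 : int) (a b : Z).
Hypothesis ab : prim a b.
Hypothesis e_bound : forall x y, (`|e x y| <= #|A|%:Z)%R.
Hypothesis e_sum : forall x y, psum c e x y = k0.

Lemma line_cell (i j : C) : lev a b (cx i) (cy i) = lev a b (cx j) (cy j) ->
  exists2 t, cx j = cx i + t * a /\ cy j = cy i + t * b & Z.abs t <= Z.of_nat n + 2.
Proof.
move=> lij; have [t [tx ty]] : exists t, cx j - cx i = t * a /\ cy j - cy i = t * b.
  by apply: prim_col => //; move: lij; rewrite /lev; lia.
exists t; first by lia.
have := cell_bounds i; have := cell_bounds j; have [a0|b0] := prim_neq0 ab; nia.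
Qed.

(** The increment [u] of [e] under the translation vanishes on the levels just below, so on the new
    line the top face of the relation is a linear recurrence for [u]. Bounded integers leave
    finitely many states, so [u] is [Nper]-periodic along the line and [e] grows linearly in steps
    of [Nper]; as [e] is bounded, the increment is zero. *)
Lemma propagate_level (c0 c1 : Z) :
  (forall i, c i <> 0%R -> c0 <= lev a b (cx i) (cy i) <= c1) ->
  (exists i, c i <> 0%R /\ lev a b (cx i) (cy i) = c1) ->
  forall M, (forall x y, M + c0 <= lev a b x y < M + c1 ->
    e (x + Nper * a) (y + Nper * b) = e x y) ->
  forall x y, lev a b x y = M + c1 -> e (x + Nper * a) (y + Nper * b) = e x y.
Proof.
move=> cc [i1 [ci1 li1]] M per x y lxy.
pose u x y := (e (x + Nper * a)%ZZ (y + Nper * b)%ZZ - e x y)%R.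
pose q := #|A|.
have u_bound x' y' : (`|u x' y'| <= (2 * q)%N%:Z)%R.
  by rewrite /u /q; have := e_bound x' y'; have := e_bound (x' + Nper * a) (y' + Nper * b); lia.
have u_sum x' y' : psum c u x' y' = 0%R.
  by rewrite /u psumB (psum_shift c e (Nper * a)) !e_sum subrr.
pose P (i : C) := (c i != 0%R) && (lev a b (cx i) (cy i) =? c1).
have Pi1 : P i1 by rewrite /P li1 Z.eqb_refl andbT; apply/eqP.
have [i0 Pi0 i0min] : exists2 i0, P i0 & forall j, P j ->
  a * cx i0 + b * cy i0 <= a * cx j + b * cy j.
  have [M' HM'] : exists M', forall j : C, - M' <= a * cx j + b * cy j.
    exists ((Z.abs a + Z.abs b) * (Z.of_nat n + 3)) => j; have := cell_bounds j; nia.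
  case: (arg_minnP (fun i => Z.to_nat (a * cx i + b * cy i + M')) Pi1) => i0 Pi0 H.
  by exists i0 => // j /H; have := HM' j; have := HM' i0; lia.
move: (Pi0); rewrite /P => /andP[/eqP ci0 /Z.eqb_eq li0].
pose z t := u (x + t * a) (y + t * b).
pose L := (n + 3)%N.
(* Solving the relation for the first cell [i0] of the top face expresses [z t] by later values, at
   distance at most [n + 2]. *)
have det t t' : (forall j, (j < L)%N -> z (t + 1 + Z.of_nat j) = z (t' + 1 + Z.of_nat j)) ->
  z t = z t'.
  move=> E; pose D x' y' := (u (x' + t * a)%ZZ (y' + t * b)%ZZ - u (x' + t' * a)%ZZ (y' + t' *
    b)%ZZ)%R.
  have D_sum x' y' : psum c D x' y' = 0%R.
    by rewrite /D psumB (psum_shift c u (t * a)) (psum_shift c u (t' * a)) !u_sum subrr.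
  have := D_sum (x - cx i0) (y - cy i0); rewrite (psum_single (i0 := i0)).
    move/eqP; rewrite mulf_eq0 => /orP[/eqP//|]; rewrite /D subr_eq0 => /eqP.
    by rewrite !Z.sub_add.
  move=> i ci ii0; have := cc _ ci => li; apply/eqP; rewrite /D subr_eq0; apply/eqP.
  have [li1'|li1'] : lev a b (cx i) (cy i) = c1 \/ lev a b (cx i) (cy i) < c1 by lia.
    have [j [jx jy] jn] : exists2 t, cx i = cx i0 + t * a /\
      cy i = cy i0 + t * b & Z.abs t <= Z.of_nat n + 2.
      by apply: line_cell; rewrite li0.
    have Pi : P i by rewrite /P li1' Z.eqb_refl andbT; apply/eqP.
    have := i0min _ Pi; rewrite jx jy => jmin.
    have j0 : 0 <= j by have [] := prim_neq0 ab; nia.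
    have j1 : j <> 0 by move=> j0'; apply: ii0; apply: cell_inj; rewrite ?jx ?jy j0'; lia.
    have /E : (Z.to_nat (j - 1) < L)%N by rewrite /L; lia.
    rewrite /z; move=> H; have e1 s : s + 1 + Z.of_nat (Z.to_nat (j - 1)) = s + j by lia.
    rewrite !e1 in H.
    rewrite !(_ : forall s, x - cx i0 + (cx i0 + j * a) + s * a = x + (s + j) * a); try by lia.
    by rewrite !(_ : forall s, y - cy i0 + (cy i0 + j * b) + s * b = y + (s + j) * b); try by lia.
  have z0 s : u (x - cx i0 + cx i + s * a) (y - cy i0 + cy i + s * b) = 0%R.
    apply/eqP; rewrite subr_eq0; apply/eqP; apply: per; move: lxy li0 li li1'; rewrite /lev; lia.
  by rewrite !z0.
pose code (v : int) : 'I_(4 * q).+1 := inord (absz (v + (2 * q)%N%:Z)%R).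
have code_inj v w : (`|v| <= (2 * q)%N%:Z)%R -> (`|w| <= (2 * q)%N%:Z)%R -> code v = code w ->
  v = w.
  by move=> hv hw /(congr1 val); rewrite /= !inordK; lia.
pose s t : {ffun 'I_L -> 'I_(4 * q).+1} := [ffun j : 'I_L => code (z (t + Z.of_nat j))].
have card_s : (#|[set: {ffun 'I_L -> 'I_(4 * q).+1}]| <= K0)%N.
  by rewrite cardsT card_ffun !card_ord /K0 /q /L leq_addr.
have sdet i j : s (i + 1) = s (j + 1) -> s i = s j.
  move=> /ffunP E; have E' l : (l < L)%N -> z (i + 1 + Z.of_nat l) = z (j + 1 + Z.of_nat l).
    by move=> lL; have := E (Ordinal lL); rewrite !ffunE; apply: code_inj; exact: u_bound.
  apply/ffunP => -[l lL]; rewrite !ffunE /=; congr code.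
  case: l lL => [|l] lL; first by rewrite !Z.add_0_r; exact: det.
  by rewrite !(_ : forall s, s + Z.of_nat l.+1 = s + 1 + Z.of_nat l); try lia; apply: E';
    exact: ltnW.
have zper t : z (t + Nper) = z t.
  have := backward_det_periodic card_s (fun t => in_setT (s t)) sdet t.
  have L0 : (0 < L)%N by rewrite /L addn3.
  move=> /ffunP/(_ (Ordinal L0)); rewrite !ffunE /= !Z.add_0_r.
  by apply: code_inj; exact: u_bound.
have zper' (m : nat) : z (Z.of_nat m * Nper) = u x y.
  rewrite -(_ : z 0 = u x y); last by rewrite /z; congr u; lia.
  by rewrite -(period_mul zper (Z.of_nat m) 0).
have lin (m : nat) : e (x + Z.of_nat m * Nper * a)%ZZ (y + Z.of_nat m * Nper * b)%ZZ = (e x y +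
  m%:Z * u x y)%R.
  elim: m => [|m IH]; first by rewrite mul0r addr0; congr e; lia.
  have -> : (m.+1%:Z * u x y = m%:Z * u x y + u x y)%R by rewrite -addn1 PoszD mulrDl mul1r.
  rewrite addrA -IH -[X in (_ = _ + X)%R](zper' m) /z /u addrC subrK; congr e; lia.
have : u x y = 0%R.
  (* [e] varies by at most [2 * q], so a nonzero integer increment repeated [2 * q + 1] times is too
     much. *)
  have := lin (2 * q).+1; have := e_bound (x + Z.of_nat (2 * q).+1 * Nper * a) (y + Z.of_nat (2 *
    q).+1 * Nper * b).
  have := e_bound x y; rewrite -/q; move: (u x y) (e x y) (e _ _) => U E1 E2; nia.
by move/eqP; rewrite subr_eq0 => /eqP.
Qed.

End Propagate.

End Relation.

Lemma levN a b x y : lev (- a) (- b) x y = - lev a b x y.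
Proof. by rewrite /lev; lia. Qed.

Lemma lev_shift a b x y t : lev a b (x + t * a) (y + t * b) = lev a b x y.
Proof. by rewrite /lev; lia. Qed.

Lemma levD a b x y x' y' : lev a b (x + x') (y + y') = lev a b x y + lev a b x' y'.
Proof. by rewrite /lev; lia. Qed.

Lemma lev_decomp a b p q x y : p * a + q * b = 1 ->
  exists t, x = lev a b x y * q + t * a /\ y = - lev a b x y * p + t * b.
Proof.
move=> E; have ab : prim a b by exists p, q.
have := @prim_col a b (x - lev a b x y * q) (y + lev a b x y * p) ab.
case; last by move=> t [tx ty]; exists t; lia.
have := congr1 (Z.mul (lev a b x y)) E; rewrite /lev; lia.
Qed.

Lemma Z_ind_up (P : Z -> Prop) (M : Z) :
  (forall l, M <= l -> (forall l', M <= l' < l -> P l') -> P l) -> forall l, M <= l -> P l.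
Proof.
move=> H l Ml; suff : forall (m : nat) l, M <= l -> l < M + Z.of_nat m -> P l.
  by move=> /(_ (Z.to_nat (l - M + 1)) l Ml); apply; lia.
elim=> [|m IH] l' Ml' lm; first by lia.
by apply: H => // l'' l''l; apply: IH; lia.
Qed.

(** * Transversal periodicity from determinism *)

Section LevelStates.
Variables (V : finType) (W : nat) (per : nat).

Definition state_period : Z :=
  Z.of_nat (#|[set: {ffun 'I_W * 'I_per -> V}]|)`!.

Lemma state_period_gt0 : 0 < state_period.
Proof. exact: fact_Zgt0. Qed.

(** By the period along [(a, b)], the contents of [W] consecutive levels form finitely many states,
    and [(q, - p)] moves up by one level. As levels determine the one below, the states form a
    backward deterministic sequence. The period depends only on the number of states, so it is
    common to all such [E]. *)
Lemma level_periodic (E : Z -> Z -> V) (a b p q : Z) : p * a + q * b = 1 -> (0 < W)%N ->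
  (0 < per)%N ->
  (forall x y, E (x + Z.of_nat per * a) (y + Z.of_nat per * b) = E x y) ->
  (forall s t, (forall x y, 1 <= lev a b x y <= Z.of_nat W ->
       E (x + s * q) (y - s * p) = E (x + t * q) (y - t * p)) ->
     forall x y, lev a b x y = 0 -> E (x + s * q) (y - s * p) = E (x + t * q) (y - t * p)) ->
  forall x y, E (x + state_period * q) (y - state_period * p) = E x y.
Proof.
move=> Eab W0 per0 Eper Edet.
have Eper' m x y : E (x + m * (Z.of_nat per * a)) (y + m * (Z.of_nat per * b)) = E x y.
  have := @period_mul _ (fun t => E (x + t * a) (y + t * b)) (Z.of_nat per) _ m 0.
  rewrite !Z.add_0_l !Z.mul_0_l !Z.add_0_r !Z.mul_assoc; apply => t.
  by rewrite -[RHS]Eper; congr E; lia.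
pose s (l : Z) : {ffun 'I_W * 'I_per -> V} :=
  [ffun jr : 'I_W * 'I_per => E ((l + Z.of_nat jr.1) * q + Z.of_nat jr.2 * a) (- (l + Z.of_nat
    jr.1) * p + Z.of_nat jr.2 * b)].
have sP l l' : s l = s l' -> forall x y, 0 <= lev a b x y < Z.of_nat W ->
    E (x + l * q) (y - l * p) = E (x + l' * q) (y - l' * p).
  move=> /ffunP Es x y xy; have [t [tx ty]] := lev_decomp x y Eab.
  have pp : 0 < Z.of_nat per by lia.
  have := Z.mod_pos_bound t _ pp; have := Z.div_mod t (Z.of_nat per).
  set r := t mod _; set m := t / _ => td rb.
  have jW : (Z.to_nat (lev a b x y) < W)%N by lia.
  have rW : (Z.to_nat r < per)%N by lia.
  have := Es (Ordinal jW, Ordinal rW); rewrite !ffunE /= !Z2Nat.id; try by lia.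
  move=> H; rewrite -(Eper' m) -[RHS](Eper' m) in H.
  have td' : t = Z.of_nat per * m + r by apply: td; lia.
  set v := lev a b x y in tx ty H *.
  have e1 z : x + z * q = (z + v) * q + r * a + m * (Z.of_nat per * a) by rewrite tx td'; lia.
  have e2 z : y - z * p = - (z + v) * p + r * b + m * (Z.of_nat per * b) by rewrite ty td'; lia.
  by rewrite !e1 !e2.
have sdet i j : s (i + 1) = s (j + 1) -> s i = s j.
  move=> Es; have Es' := sP _ _ Es.
  have up x y : 1 <= lev a b x y <= Z.of_nat W -> E (x + i * q) (y - i * p) = E (x + j * q) (y - j
    * p).
    move=> xy; have := Es' (x - q) (y + p).
    rewrite !(_ : forall z, x - q + (z + 1) * q = x + z * q); try by lia.
    rewrite !(_ : forall z, y + p - (z + 1) * p = y - z * p); try by lia.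
    by apply; move: xy; rewrite /lev; lia.
  have dn := Edet _ _ up.
  apply/ffunP => -[k r]; rewrite !ffunE /=.
  have := @dn (Z.of_nat k * q + Z.of_nat r * a) (- Z.of_nat k * p + Z.of_nat r * b).
  have := @up (Z.of_nat k * q + Z.of_nat r * a) (- Z.of_nat k * p + Z.of_nat r * b).
  rewrite !(_ : forall z, Z.of_nat k * q + Z.of_nat r * a + z * q = (z + Z.of_nat k) * q + Z.of_nat
    r * a); try by lia.
  rewrite !(_ : forall z, - Z.of_nat k * p + Z.of_nat r * b - z * p = - (z + Z.of_nat k) * p +
    Z.of_nat r * b); try by lia.
  have -> : lev a b (Z.of_nat k * q + Z.of_nat r * a) (- Z.of_nat k * p + Z.of_nat r * b) =
    Z.of_nat k.
    by have := congr1 (Z.mul (Z.of_nat k)) Eab; rewrite /lev; lia.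
  have kW := ltn_ord k; move=> U D.
  have [k0|k0] : Z.of_nat k = 0 \/ 1 <= Z.of_nat k by lia.
    exact: D.
  by apply: U; lia.
have sper t : s (t + state_period) = s t.
  exact: (backward_det_periodic (leqnn _) (fun t => in_setT (s t)) sdet).
move=> x y; set l := lev a b x y.
have := sP _ _ (sper l) (x - l * q) (y + l * p).
rewrite (_ : lev a b _ _ = 0); last by have := congr1 (Z.mul l) Eab; rewrite /l /lev; lia.
move=> H; rewrite -[RHS](_ : E (x - l * q + l * q) (y + l * p - l * p) = _); last by congr E; lia.
rewrite -H; last by lia.
by congr E; lia.
Qed.

End LevelStates.

(** * Propagation by the relation, and the faces of its support *)

Section Faces.
Variables (A : finType) (n : nat).
Notation cfg := (Z -> Z -> A).
Notation C := ('I_n * 'I_3)%type.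
Notation N := (Nper A n).

Lemma arg_max_cell (P : pred C) (F : C -> Z) i0 : P i0 ->
  exists2 i, P i & forall j, P j -> F j <= F i.
Proof.
move=> Pi0; pose B := \sum_(i : C) Z.to_nat (Z.abs (F i)).
have HB i : Z.abs (F i) <= Z.of_nat B by rewrite /B (bigD1 i) //=; lia.
case: (arg_maxnP (fun i => Z.to_nat (F i + Z.of_nat B)) Pi0) => i Pi H.
by exists i => // j /H; have := HB j; have := HB i; lia.
Qed.

Record level_range (a b : Z) (c : C -> int) (c0 c1 : Z) : Prop := LevelRange {
  lr_bound : forall i, c i <> 0%R -> c0 <= lev a b (cx i) (cy i) <= c1;
  lr_min : exists i, c i <> 0%R /\ lev a b (cx i) (cy i) = c0;
  lr_max : exists i, c i <> 0%R /\ lev a b (cx i) (cy i) = c1 }.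

Lemma level_rangeN a b c c0 c1 : level_range a b c c0 c1 -> level_range (- a) (- b) c (- c1) (- c0).
Proof.
move=> [H [i [ci li]] [j [cj lj]]]; split.
- by move=> l /H; rewrite levN; lia.
- by exists j; rewrite levN lj.
- by exists i; rewrite levN li.
Qed.

Lemma level_range_ex a b (c : C -> int) : (exists i, c i <> 0%R) ->
  exists c0 c1, level_range a b c c0 c1.
Proof.
move=> [i0 /eqP ci0].
have [i /eqP ci mi] := arg_max_cell (P := fun i => c i != 0%R) (fun i => lev a b (cx i) (cy i)) ci0.
have [j /eqP cj mj] := arg_max_cell (P := fun i => c i != 0%R) (fun i => - lev a b (cx i) (cy i))
  ci0.
exists (lev a b (cx j) (cy j)), (lev a b (cx i) (cy i)); split; first 1 last.
- by exists j.
- by exists i.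
by move=> l /eqP cl; have := mi _ cl; have := mj _ cl; lia.
Qed.

Lemma propagate_up (c : C -> int) (e : Z -> Z -> int) k0 a b c0 c1 M : prim a b ->
  (forall x y, (`|e x y| <= #|A|%:Z)%R) -> (forall x y, psum c e x y = k0) ->
  level_range a b c c0 c1 ->
  (forall x y, M + c0 <= lev a b x y < M + c1 -> e (x + N * a) (y + N * b) = e x y) ->
  forall x y, M + c0 <= lev a b x y -> e (x + N * a) (y + N * b) = e x y.
Proof.
move=> ab eb es lr H x y lxy.
have [l El] : exists l, lev a b x y = l by exists (lev a b x y).
rewrite El in lxy; move: l lxy x y El; apply: Z_ind_up => l Ml IH x y El.
have [lM|lM] : l < M + c1 \/ M + c1 <= l by lia.
  by apply: H; lia.
apply: (propagate_level ab eb es (lr_bound lr) (lr_max lr) (M := l - c1)); last by lia.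
by move=> x' y' l'; apply: (IH (lev a b x' y')) => //; lia.
Qed.

Lemma propagate (c : C -> int) (e : Z -> Z -> int) k0 a b c0 c1 M : prim a b ->
  (forall x y, (`|e x y| <= #|A|%:Z)%R) -> (forall x y, psum c e x y = k0) ->
  level_range a b c c0 c1 ->
  (forall x y, M + c0 <= lev a b x y < M + c1 -> e (x + N * a) (y + N * b) = e x y) ->
  forall x y, e (x + N * a) (y + N * b) = e x y.
Proof.
move=> ab eb es lr H x y.
have [lxy|lxy] : M + c0 <= lev a b x y \/ lev a b x y < M + c0 by lia.
  exact: propagate_up ab eb es lr H x y lxy.
have H' : forall x y, (1 - M) + - c1 <= lev (- a) (- b) x y < (1 - M) + - c0 ->
  e (x + N * - a) (y + N * - b) = e x y.
  move=> x' y'; rewrite levN => l'; rewrite -[LHS]H; first by congr e; lia.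
  by move: l'; rewrite /lev; lia.
rewrite -(propagate_up (primN ab) eb es (level_rangeN lr) H'); first by congr e; lia.
rewrite levN lev_shift.
have [i [ci li]] := lr_min lr; have := lr_bound lr ci; lia.
Qed.

Section Relation.
Variables (eta : cfg) (T : {set C}) (c : C -> int) (k0 : int).
Hypothesis rel : relation eta T c k0.
Notation X := (in_hull eta).

Definition periodic (a b : Z) (h : cfg) := forall x y, h (x + a) (y + b) = h x y.

Lemma val_bound (h : cfg) x y : (`|val_of (h x y)| <= #|A|%:Z)%R.
Proof. by have := val_of_bound (h x y); lia. Qed.

Lemma val_diff_bound (f g : cfg) x y : (`|(val_of (f x y) - val_of (g x y))%R| <= #|A|%:Z)%R.
Proof. by have := val_of_bound (f x y); have := val_of_bound (g x y); lia. Qed.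

Lemma periodic_spread h a b c0 c1 M : prim a b -> X h -> level_range a b c c0 c1 ->
  (forall x y, M + c0 <= lev a b x y < M + c1 -> h (x + N * a) (y + N * b) = h x y) ->
  periodic (N * a) (N * b) h.
Proof.
move=> ab Xh lr H x y; apply: val_of_inj.
apply: (propagate (e := fun x y => val_of (h x y)) ab (val_bound h) (rel_sum rel Xh) lr).
by move=> x' y' /H->.
Qed.

Section Pair.
Variables (f g : cfg) (a b c0 c1 W : Z).
Hypothesis (Xf : X f) (Xg : X g) (ab : prim a b) (lr : level_range a b c c0 c1).
Hypothesis (W1 : c1 - c0 <= W).
Hypothesis agree : forall x y, - W <= lev a b x y < 0 -> f x y = g x y.
Hypothesis differ : f 0 0 <> g 0 0.

Let e x y : int := (val_of (f x y) - val_of (g x y))%R.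

Let e_sum x y : psum c e x y = 0%R.
Proof. by rewrite /e psumB !(rel_sum rel) // subrr. Qed.

Let e0 x y : f x y = g x y -> e x y = 0%R.
Proof. by rewrite /e => ->; rewrite subrr. Qed.

Let e1 : e 0 0 <> 0%R.
Proof. by move/eqP; rewrite subr_eq0 => /eqP/val_of_inj. Qed.

(** If [i] were the only cell of top level, the relation placed with [i] at the origin would see a
    difference at the origin alone. *)
Lemma max_face_two i : c i <> 0%R -> lev a b (cx i) (cy i) = c1 ->
  exists j, [/\ c j <> 0%R, j <> i & lev a b (cx j) (cy j) = c1].
Proof.
move=> ci li; apply: contrapT => /forallNP H.
have := e_sum (0 - cx i) (0 - cy i); rewrite (psum_single (i0 := i)).
  by rewrite !Z.sub_add => /eqP; rewrite mulf_eq0 => /orP[]/eqP.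
move=> j cj ji; apply/e0/agree.
have := lr_bound lr cj.
have : lev a b (cx j) (cy j) <> c1 by move=> lj; case: (H j).
move: li; rewrite /lev; lia.
Qed.

(** If [i] were the only cell of lowest level, the relation would determine levels downwards. The
    difference [e] would then vanish on all negative levels, be periodic along [(a, b)] and, by
    [level_periodic], also transversally; so it would vanish at the origin. *)
Lemma min_face_two i : c i <> 0%R -> lev a b (cx i) (cy i) = c0 ->
  exists j, [/\ c j <> 0%R, j <> i & lev a b (cx j) (cy j) = c0].
Proof.
move=> ci li; apply: contrapT => /forallNP H.
have up j : c j <> 0%R -> j <> i -> c0 < lev a b (cx j) (cy j) <= c1.
  move=> cj ji; have := lr_bound lr cj.
  have : lev a b (cx j) (cy j) <> c0 by move=> lj; case: (H j).
  lia.
have det (D : Z -> Z -> int) : (forall x y, psum c D x y = 0%R) -> forall M,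
    (forall x y, M < lev a b x y <= M + (c1 - c0) -> D x y = 0%R) ->
      forall x y, lev a b x y = M -> D x y = 0%R.
  move=> D_sum M D0 x y lxy; have := D_sum (x - cx i) (y - cy i); rewrite (psum_single (i0 := i)).
    by rewrite !Z.sub_add => /eqP; rewrite mulf_eq0 => /orP[]/eqP.
  by move=> j cj ji; apply: D0; have := up _ cj ji; move: li lxy; rewrite /lev; lia.
have neg x y : lev a b x y < 0 -> e x y = 0%R.
  move=> lxy; have [l El] : exists l, - lev a b x y = l by exists (- lev a b x y).
  have l1 : 1 <= l by lia.
  move: l l1 x y lxy El; apply: Z_ind_up => l l1 IH x y lxy El.
  have [lW|lW] : l <= W \/ W < l by lia.
    by apply/e0/agree; lia.
  apply: (det e e_sum (- l)); last by lia.
  move=> x' y' l'; apply: (IH (- lev a b x' y')); last by []; last by lia.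
  by have := lr_bound lr ci; lia.
have eper : forall x y, e (x + N * a) (y + N * b) = e x y.
  apply: (propagate ab (val_diff_bound f g) e_sum lr (M := - c1)) => x y lxy.
  by change (e (x + N * a) (y + N * b) = e x y); rewrite !neg ?lev_shift //; lia.
have [p [q pq]] := ab.
pose Q := #|A|; pose code (v : int) : 'I_(2 * Q).+1 := inord (absz (v + Q%:Z)%R).
have code_inj v w : (`|v| <= Q%:Z)%R -> (`|w| <= Q%:Z)%R -> code v = code w -> v = w.
  by move=> hv hw /(congr1 val); rewrite /= !inordK; lia.
have eb x y : (`|e x y| <= Q%:Z)%R by exact: val_diff_bound.
pose E x y := code (e x y).
pose W' := (Z.to_nat (c1 - c0) + 1)%N.
have N0 : (0 < (K0 A n)`!)%N by exact: fact_gt0.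
have W0 : (0 < W')%N by rewrite /W' addn1.
have Eper x y : E (x + N * a) (y + N * b) = E x y by rewrite /E eper.
have Edet s t : (forall x y, 1 <= lev a b x y <= Z.of_nat W' ->
      E (x + s * q) (y - s * p) = E (x + t * q) (y - t * p)) ->
    forall x y, lev a b x y = 0 -> E (x + s * q) (y - s * p) = E (x + t * q) (y - t * p).
  move=> Est x y lxy; rewrite /E; congr code.
  pose D x y := (e (x + s * q)%ZZ (y + - (s * p))%ZZ - e (x + t * q)%ZZ (y + - (t * p))%ZZ)%R.
  have D_sum x' y' : psum c D x' y' = 0%R.
    by rewrite /D psumB (psum_shift c e (s * q)) (psum_shift c e (t * q)) !e_sum subrr.
  suff : D x y = 0%R by move/eqP; rewrite subr_eq0 => /eqP.
  apply: (det D D_sum 0) => // x' y' l'; apply/eqP; rewrite subr_eq0; apply/eqP.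
  by apply: (code_inj _ _ (eb _ _) (eb _ _)); apply: Est; rewrite /W'; lia.
have := level_periodic pq W0 N0 Eper Edet.
move=> /(_ (0 - state_period 'I_(2 * Q).+1 W' (K0 A n)`! * q) (0 + state_period 'I_(2 * Q).+1 W'
  (K0 A n)`! * p)).
move=> /(code_inj _ _ (eb _ _) (eb _ _)); have := state_period_gt0 'I_(2 * Q).+1 W' (K0 A n)`!.
set P := state_period _ _ _ => P0; rewrite Z.sub_add Z.add_simpl_r => H0.
apply: e1; rewrite H0; apply: neg; have := congr1 (Z.mul P) pq; rewrite /lev; lia.
Qed.

End Pair.
End Relation.
End Faces.

(** * Equality on a strip forces periodicity *)

Section Strips.
Variables (A : finType) (n : nat).
Notation cfg := (Z -> Z -> A).
Notation C := ('I_n * 'I_3)%type.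
Notation N := (Nper A n).

Definition in_cells (T : {set C}) (x y : Z) := exists2 i, i \in T & cx i = x /\ cy i = y.

Lemma in_cellsE (T : {set C}) i : i \in T -> in_cells T (cx i) (cy i).
Proof. by exists i. Qed.

Lemma in_cells_row (T : {set C}) x x' x'' y : convex T ->
  in_cells T x y -> in_cells T x'' y -> x <= x' <= x'' -> in_cells T x' y.
Proof.
move=> cT [i iT [<- yi]] [k kT [<- yk]] xx.
have bi := cell_bounds i; have bk := cell_bounds k.
have [|//|j [jx jy]] := @cellP n x' y; try lia.
exists j => //; apply: (convex_row cT iT kT); lia.
Qed.

Lemma in_cells_mid (T : {set C}) x x' x'' : convex T ->
  in_cells T x 0 -> in_cells T x'' 2 -> x + x'' = 2 * x' -> in_cells T x' 1.
Proof.
move=> cT [i iT [<- yi]] [k kT [<- yk]] xx.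
have bi := cell_bounds i; have bk := cell_bounds k.
have [|//|j [jx jy]] := @cellP n x' 1; try lia.
exists j => //; apply: (convex_mid cT iT kT); lia.
Qed.

Lemma K0_ge (a0 : A) : (n + 2 <= K0 A n)%N.
Proof.
have A0 : (0 < #|A|)%N by apply/card_gt0P; exists a0.
have : (n + 3 < (4 * #|A|).+1 ^ (n + 3))%N by apply: ltn_expl; lia.
rewrite /K0; lia.
Qed.

#[global] Opaque K0.

Lemma small_period_Nper (B : Type) (s : Z -> B) (d : nat) : A -> (0 < d <= n + 2)%N ->
  (forall t, s (t + Z.of_nat d) = s t) -> forall t, s (t + N) = s t.
Proof.
move=> a0 /andP[d0 dn] sd t.
have [m Em] := Zof_factS d0 (leq_trans dn (K0_ge a0)).
by rewrite /Nper Em (period_mul sd).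
Qed.

Definition below (a b M : Z) (T : {set C}) : {set C} := [set i in T | flev b (- a) i <? M].

Lemma belowP a b M T i : i \in below a b M T <-> i \in T /\ lev a b (cx i) (cy i) < M.
Proof.
rewrite inE /lev /flev; split=> [/andP[-> /Z.ltb_lt]|[-> H]]; first by split => //; lia.
by apply/Z.ltb_lt; lia.
Qed.

(** The face is required to have no gaps, so that it can slide along its line by one point at a
    time. *)
Record max_face (T : {set C}) (a b M X0 Y0 : Z) (m : nat) : Prop := MaxFace {
  mf_le : forall i, i \in T -> lev a b (cx i) (cy i) <= M;
  mf_lev : lev a b X0 Y0 = M;
  mf_in : forall j, 0 <= j < Z.of_nat m -> in_cells T (X0 + j * a) (Y0 + j * b);
  mf_eq : forall i, i \in T -> lev a b (cx i) (cy i) = M ->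
    exists2 j, 0 <= j < Z.of_nat m & cx i = X0 + j * a /\ cy i = Y0 + j * b }.

(** A crude bound on the levels within a window: a strip of this width contains the part of a window
    below its face. *)
Definition lev_width (a b : Z) := 2 * (Z.abs a + Z.abs b) * (Z.of_nat n + 3).

Lemma lev_widthP a b (i j : C) : lev a b (cx i) (cy i) - lev a b (cx j) (cy j) <= lev_width a b.
Proof. by rewrite /lev_width /lev; have := cell_bounds i; have := cell_bounds j; nia. Qed.

Lemma max_face_card T a b M X0 Y0 m : max_face T a b M X0 Y0 m -> (0 < m)%N ->
  (#|T| - #|below a b M T| <= m)%N.
Proof.
move=> mf m0; have [i0 i0T _] : in_cells T (X0 + 0 * a) (Y0 + 0 * b) by apply: (mf_in mf); lia.
pose f (j : 'I_m) : C :=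
  odflt i0 [pick i | (cx i =? X0 + Z.of_nat j * a) && (cy i =? Y0 + Z.of_nat j * b)].
have sT : T \subset below a b M T :|: f @: [set: 'I_m].
  apply/fintype.subsetP => i iT; rewrite in_setU.
  have [lM|lM] : lev a b (cx i) (cy i) < M \/ lev a b (cx i) (cy i) = M by have := mf_le mf iT; lia.
    by apply/orP; left; apply/belowP.
  apply/orP; right; have [j jm [jx jy]] := mf_eq mf iT lM.
  have jm' : (Z.to_nat j < m)%N by lia.
  apply/imsetP; exists (Ordinal jm') => //; rewrite /f; case: pickP => [i' /=|/(_ i)] /=.
    rewrite Z2Nat.id; last by lia.
    by move=> /andP[/Z.eqb_eq ix /Z.eqb_eq iy]; apply: cell_inj; lia.
  by rewrite Z2Nat.id; [rewrite jx jy !Z.eqb_refl|lia].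
have := subset_leq_card sT; have := (leq_card_setU (below a b M T) (f @: [set: 'I_m])).1.
have := leq_imset_card f [set: 'I_m]; rewrite cardsT card_ord.
move: #|_ @: _| #|_ :|: _| #|T| #|below a b M T| => *; lia.
Qed.

Section Face.
Variables (eta : cfg) (k : nat) (T : {set C}).
Hypothesis gT : generating eta k T.
Notation X := (in_hull eta).

Lemma face_vertex a b M X0 Y0 m j i : max_face T a b M X0 Y0 m -> prim a b ->
  i \in T -> (j = 0 \/ j = Z.of_nat m - 1) -> cx i = X0 + j * a -> cy i = Y0 + j * b ->
    convex (T :\ i).
Proof.
move=> mf ab iT jm ix iy.
pose s := if j =? 0 then -1 else 1.
apply: (@convex_lex _ T i b (- a) (s * a) (s * b) (gen_convex gT)) => i' i'T i'i.
have li : lev a b (cx i) (cy i) = M by have := mf_lev mf; rewrite ix iy /lev; lia.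
have [lM|lM] : lev a b (cx i') (cy i') < M \/ lev a b (cx i') (cy i') = M by have := mf_le mf i'T;
  lia.
  by left; move: lM li; rewrite /lev /flev; lia.
right; split; first by move: lM li; rewrite /lev /flev; lia.
have [j' j'm [jx jy]] := mf_eq mf i'T lM.
have jj' : j <> j' by move=> e; case/eqP: i'i; apply: cell_inj; lia.
have ab0 := prim_neq0 ab.
rewrite /flev ix iy jx jy /s; case: (Z.eqb_spec j 0) => j0; first by nia.
have : j' < j by lia.
by nia.
Qed.

(** If one window on the line showed no difference on its face, the vertex rule at both ends of the
    face would spread agreement along the whole line. So every window on the line shows a
    difference, and its part below the face is ambiguous. *)
Lemma face_windows_ambiguous a b M X0 Y0 m h h' x0 y0 : max_face T a b M X0 Y0 m -> prim a b ->
  (0 < m)%N ->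
  X h -> X h' -> (forall x y, - lev_width a b <= lev a b x y < 0 -> h x y = h' x y) ->
  lev a b x0 y0 = 0 -> h x0 y0 <> h' x0 y0 ->
  forall x y, lev a b x y = 0 -> pat (below a b M T) h (x - X0) (y - Y0) \in ambiguous eta T (below
    a b M T).
Proof.
move=> mf ab m0 Xh Xh' agr l0 ne x y lxy.
have [i0 i0T [i0x i0y]] : in_cells T (X0 + 0 * a) (Y0 + 0 * b) by apply: (mf_in mf); lia.
have [i1 i1T [i1x i1y]] : in_cells T (X0 + (Z.of_nat m - 1) * a) (Y0 + (Z.of_nat m - 1) * b).
  by apply: (mf_in mf); lia.
have pT : below a b M T \proper T.
  apply/properP; split; first by apply/fintype.subsetP => i /belowP[].
  exists i0 => //; apply/negP => /belowP[_]; have := mf_lev mf; rewrite i0x i0y /lev; lia.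
have agrw u v i : lev a b u v = 0 -> i \in T -> lev a b (cx i) (cy i) < M ->
    h (u - X0 + cx i) (v - Y0 + cy i) = h' (u - X0 + cx i) (v - Y0 + cy i).
  move=> luv iT li; apply: agr.
  have := @lev_widthP a b i0 i; have := mf_lev mf.
  rewrite i0x i0y; move: li luv; rewrite /lev; lia.
pose z t (g : cfg) := g (x0 + t * a) (y0 + t * b).
have lz t : lev a b (x0 + t * a) (y0 + t * b) = 0 by rewrite lev_shift.
have step t : (forall j, 0 <= j < Z.of_nat m - 1 -> z (t + j) h = z (t + j) h') ->
    z (t + (Z.of_nat m - 1)) h = z (t + (Z.of_nat m - 1)) h' /\ z (t - 1) h = z (t - 1) h'.
  move=> E; split.
    have := @vertex_rule _ _ _ _ _ gT i1 h h' (x0 + t * a - X0) (y0 + t * b - Y0) (x0 + t * a - X0)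
      (y0 + t * b - Y0) i1T.
    have -> : x0 + t * a - X0 + cx i1 = x0 + (t + (Z.of_nat m - 1)) * a by lia.
    have -> : y0 + t * b - Y0 + cy i1 = y0 + (t + (Z.of_nat m - 1)) * b by lia.
    apply => //; first by apply: (face_vertex mf ab i1T _ i1x i1y); right.
    move=> i iT ii1; have [lM|lM] : lev a b (cx i) (cy i) < M \/ lev a b (cx i) (cy i) = M by have
      := mf_le mf iT; lia.
      exact: agrw.
    have [j jm [jx jy]] := mf_eq mf iT lM.
    have j1 : j <> Z.of_nat m - 1 by move=> e; case/eqP: ii1; apply: cell_inj; lia.
    have := E j; rewrite /z jx jy.
    rewrite !(_ : forall s, x0 + t * a - X0 + (X0 + s * a) = x0 + (t + s) * a); try lia.
    rewrite !(_ : forall s, y0 + t * b - Y0 + (Y0 + s * b) = y0 + (t + s) * b); try lia.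
    by apply; lia.
  have := @vertex_rule _ _ _ _ _ gT i0 h h' (x0 + (t - 1) * a - X0) (y0 + (t - 1) * b - Y0) (x0 +
    (t - 1) * a - X0) (y0 + (t - 1) * b - Y0) i0T.
  have -> : x0 + (t - 1) * a - X0 + cx i0 = x0 + (t - 1) * a by lia.
  have -> : y0 + (t - 1) * b - Y0 + cy i0 = y0 + (t - 1) * b by lia.
  apply => //; first by apply: (face_vertex mf ab i0T _ i0x i0y); left.
  move=> i iT ii0; have [lM|lM] : lev a b (cx i) (cy i) < M \/ lev a b (cx i) (cy i) = M by have :=
    mf_le mf iT; lia.
    exact: agrw.
  have [j jm [jx jy]] := mf_eq mf iT lM.
  have j1 : j <> 0 by move=> e; case/eqP: ii0; apply: cell_inj; lia.
  have := E (j - 1); rewrite /z jx jy.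
  have -> : x0 + (t - 1) * a - X0 + (X0 + j * a) = x0 + (t + (j - 1)) * a by lia.
  have -> : y0 + (t - 1) * b - Y0 + (Y0 + j * b) = y0 + (t + (j - 1)) * b by lia.
  by apply; lia.
have [j jm ne'] : exists2 j, 0 <= j < Z.of_nat m &
    h (x - X0 + (X0 + j * a)) (y - Y0 + (Y0 + j * b)) <> h' (x - X0 + (X0 + j * a)) (y - Y0 + (Y0 +
      j * b)).
  apply: contrapT => H; apply: ne.
  have [t [tx ty]] : exists t, x - x0 = t * a /\ y - y0 = t * b.
    by apply: prim_col => //; move: lxy l0; rewrite /lev; lia.
  have base j : 0 <= j < Z.of_nat m -> z (t + j) h = z (t + j) h'.
    move=> jm; apply: contrapT => E; apply: H; exists j => //.
    have -> : x - X0 + (X0 + j * a) = x0 + (t + j) * a by lia.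
    by have -> : y - Y0 + (Y0 + j * b) = y0 + (t + j) * b by lia.
  have dn (s : nat) : forall j, 0 <= j < Z.of_nat m -> z (t - Z.of_nat s + j) h = z (t - Z.of_nat s
    + j) h'.
    elim: s => [|s IH] j jm; first by rewrite Z.sub_0_r; exact: base.
    have [|_ E0] := step (t - Z.of_nat s); first by move=> j' j'm; apply: IH; lia.
    have [j0|j0] : j = 0 \/ 1 <= j by lia.
      by rewrite (_ : t - _ + j = t - Z.of_nat s - 1) //; lia.
    by rewrite (_ : t - _ + j = t - Z.of_nat s + (j - 1)); [apply: IH; lia|lia].
  have up (s : nat) : forall j, 0 <= j < Z.of_nat m -> z (t + Z.of_nat s + j) h = z (t + Z.of_nat s
    + j) h'.
    elim: s => [|s IH] j jm; first by rewrite Z.add_0_r; exact: base.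
    have [|E0 _] := step (t + Z.of_nat s + 1).
      move=> j' j'm; rewrite (_ : t + _ + 1 + j' = t + Z.of_nat s + (j' + 1)); [apply: IH; lia|lia].
    have [j0|j0] : j = Z.of_nat m - 1 \/ j < Z.of_nat m - 1 by lia.
      by rewrite (_ : t + _ + j = t + Z.of_nat s + 1 + (Z.of_nat m - 1)) //; lia.
    by rewrite (_ : t + _ + j = t + Z.of_nat s + (j + 1)); [apply: IH; lia|lia].
  have fin g : g x0 y0 = z 0 g by rewrite /z; congr g; lia.
  rewrite !fin; have [t0|t0] : 0 <= t \/ t <= 0 by lia.
    by have := dn (Z.to_nat t) 0; rewrite (_ : t - _ + 0 = 0); [apply; lia|lia].
  by have := up (Z.to_nat (- t)) 0; rewrite (_ : t + _ + 0 = 0); [apply; lia|lia].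
have [i iT [ix iy]] := mf_in mf jm.
apply: (ambiguousP pT Xh Xh' (u' := x - X0) (v' := y - Y0) _ iT); last by rewrite ix iy.
by move=> i' /belowP[i'T li']; exact: agrw.
Qed.

End Face.
End Strips.

(** * Morse-Hedlund along an edge of the window *)

Section StripPeriod.
Variables (A : finType) (n : nat).
Notation cfg := (Z -> Z -> A).
Notation C := ('I_n * 'I_3)%type.
Notation N := (Nper A n).

(** Since [b > 0], three rows leave only the steps 0, 1 and 2 from the lowest point of the face, and
    a gap at step 1 is filled by a midpoint. *)
Lemma max_face_ex (T : {set C}) a b i0 : convex T -> prim a b -> 0 < b -> i0 \in T ->
  exists M X0 Y0 m, [/\ max_face T a b M X0 Y0 m, (0 < m <= 3)%N,
    0 <= Y0 & (Z.of_nat m - 1) * b + Y0 <= 2].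
Proof.
move=> cT ab b0 i0T.
have [iM iMT maxM] := arg_max_cell (P := fun i => i \in T) (fun i => lev a b (cx i) (cy i)) i0T.
set M := lev a b (cx iM) (cy iM) in maxM.
have PM : (iM \in T) && (lev a b (cx iM) (cy iM) =? M) by rewrite iMT Z.eqb_refl.
have [w /andP[wT /Z.eqb_eq lw] minw] := arg_max_cell (P := fun i => (i \in T) && (lev a b (cx i)
  (cy i) =? M)) (fun i => - cy i) PM.
pose F j := in_cells T (cx w + j * a) (cy w + j * b).
have bw := cell_bounds w.
have Feq i : i \in T -> lev a b (cx i) (cy i) = M -> exists j, [/\ cx i = cx w + j * a,
  cy i = cy w + j * b, 0 <= j & j * b + cy w <= 2].
  move=> iT li; have [j [jx jy]] : exists t, cx i - cx w = t * a /\ cy i - cy w = t * b.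
    by apply: prim_col => //; move: li lw; rewrite /lev; lia.
  have bi := cell_bounds i; exists j; split; try lia.
  have := minw i; rewrite iT li Z.eqb_refl => /(_ isT); nia.
have FE i j : i \in T -> cx i = cx w + j * a -> cy i = cy w + j * b -> F j by move=> iT ix iy;
  exists i.
have F0 : F 0 by exists w => //; split; lia.
have FB j : F j -> j * b + cy w <= 2 by move=> [i iT [ix iy]]; have := cell_bounds i; lia.
have F21 : F 2 -> F 1.
  move=> F2; have := FB _ F2 => B2; have b1 : b = 1 by lia.
  have y0 : cy w = 0 by lia.
  have w0 : in_cells T (cx w) 0 by rewrite -y0; exact: in_cellsE.
  have w2 : in_cells T (cx w + 2 * a) 2 by move: F2; rewrite /F y0 b1.
  by rewrite /F y0 b1; apply: (in_cells_mid cT w0 w2); lia.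
have mk m : (0 < m <= 3)%N -> F (Z.of_nat m - 1) -> (forall j, Z.of_nat m <= j <= 2 -> ~ F j) ->
  exists M X0 Y0 m, [/\ max_face T a b M X0 Y0 m, (0 < m <= 3)%N,
  0 <= Y0 & (Z.of_nat m - 1) * b + Y0 <= 2].
  move=> m3 Fm Fn; exists M, (cx w), (cy w), m; split => //; [|lia|exact: FB].
  split => // [j jm|i iT li].
    have [->|[->|j1]] : j = 0 \/ j = Z.of_nat m - 1 \/ j = 1 by lia.
    - exact: F0.
    - exact: Fm.
    have [m2|m2] : m = 2%N \/ m = 3%N by lia.
      by subst m j; exact: Fm.
    by subst m j; exact: F21.
  have [j [jx jy j0 jb]] := Feq i iT li; exists j => //.
  have [//|jm] : j < Z.of_nat m \/ Z.of_nat m <= j by lia.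
  by case: (Fn j); [nia|exact: (FE i)].
have [F2|nF2] := pselect (F 2); first by apply: (mk 3%N) => // j; lia.
have [F1|nF1] := pselect (F 1).
  by apply: (mk 2%N) => // j j2; rewrite (_ : j = 2) //; lia.
apply: (mk 1%N) => // j j2; have [->|->] // : j = 1 \/ j = 2 by lia.
Qed.

Section Generating.
Variables (eta : cfg) (k : nat) (T : {set C}) (c : C -> int) (k0 : int).
Hypothesis gT : generating eta k T.
Hypothesis rel : relation eta T c k0.
Notation X := (in_hull eta).

Lemma T_nonempty : exists i, i \in T.
Proof. by have [i ci] := rel_nz rel; exists i; exact: (rel_T rel ci). Qed.

(** A face with a single point is a vertex, whose letter is determined by the strip. *)
Lemma max_face_ge2 a b M X0 Y0 m h h' : max_face T a b M X0 Y0 m -> prim a b -> (0 < m)%N ->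
  X h -> X h' -> (forall x y, - lev_width n a b <= lev a b x y < 0 -> h x y = h' x y) ->
  h 0 0 <> h' 0 0 -> (1 < m)%N.
Proof.
move=> mf ab m0 Xh Xh' agr ne; rewrite ltn_neqAle m0 andbT; apply/eqP => m1; subst m.
have [i iT [ix iy]] : in_cells T (X0 + 0 * a) (Y0 + 0 * b) by apply: (mf_in mf); lia.
apply: ne; have := @vertex_rule _ _ _ _ _ gT i h h' (- cx i) (- cy i) (- cx i) (- cy i) iT.
rewrite !Z.add_opp_diag_l; apply => //.
  by apply: (face_vertex gT mf ab iT _ ix iy); left.
move=> j jT ji; apply: agr; have := @lev_widthP _ a b i j.
have lj : lev a b (cx j) (cy j) <> M.
  move=> /(mf_eq mf jT)[t t1 [tx ty]]; case/eqP: ji; have t0 : t = 0 by lia.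
  by apply: cell_inj; rewrite ?tx ?ty ?ix ?iy t0.
have e1 : X0 = cx i by lia.
have e2 : Y0 = cy i by lia.
by have := mf_le mf jT; have := mf_lev mf; rewrite e1 e2; move: lj; rewrite /lev; lia.
Qed.

(** The bound [m - 1] matches the number of ambiguous patterns, as Morse-Hedlund needs. For [b = 1]
    and [m = 2], two pairs of cells in three rows share a row, which is filled between the extreme
    levels. For [m = 3] the face reaches every row, so the rows of both cells of lowest level are
    filled up to it. For [b = 2], odd levels are met in row 1, at midpoints between rows 0 and 2. *)
Lemma level_coverage a b M X0 Y0 m c0 c1 : max_face T a b M X0 Y0 m -> prim a b -> 0 < b ->
  (1 < m <= 3)%N ->
  0 <= Y0 -> (Z.of_nat m - 1) * b + Y0 <= 2 -> level_range a b c c0 c1 ->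
  (exists i j, [/\ c i <> 0%R, c j <> 0%R, i <> j, lev a b (cx i) (cy i) = c0 & lev a b (cx j) (cy
    j) = c0]) ->
  (exists i j, [/\ c i <> 0%R, c j <> 0%R, i <> j, lev a b (cx i) (cy i) = c1 & lev a b (cx j) (cy
    j) = c1]) ->
  forall l, c0 <= l < c1 -> exists x y, lev a b x y = l /\
    forall j, 0 <= j < Z.of_nat m - 1 -> in_cells T (x + j * a) (y + j * b).
Proof.
move=> mf ab b0 m3 Y00 mb lr [i [i' [ci ci' ii' li li']]] [j [j' [cj cj' jj' lj lj']]] l lc.
have iT := rel_T rel ci; have i'T := rel_T rel ci'; have jT := rel_T rel cj;
  have j'T := rel_T rel cj'.
have cT := gen_convex gT.
have c1M : c1 <= M by have := mf_le mf jT; lia.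
have bi := cell_bounds i; have bi' := cell_bounds i'; have bj := cell_bounds j;
  have bj' := cell_bounds j'.
have [t [tx ty]] : exists t, cx i' - cx i = t * a /\ cy i' - cy i = t * b.
  by apply: prim_col => //; move: li li'; rewrite /lev; lia.
have t0 : t <> 0 by move=> t0; apply: ii'; apply: cell_inj; lia.
have [s [sx sy]] : exists s, cx j' - cx j = s * a /\ cy j' - cy j = s * b.
  by apply: prim_col => //; move: lj lj'; rewrite /lev; lia.
have s0 : s <> 0 by move=> s0; apply: jj'; apply: cell_inj; lia.
have iC := in_cellsE iT; have i'C := in_cellsE i'T; have jC := in_cellsE jT;
  have j'C := in_cellsE j'T.
have [b1|b2] : b = 1 \/ b = 2 by nia.
- subst b; have row r x x'' y'' : in_cells T x r -> in_cells T x'' y'' -> y'' = r ->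
  lev a 1 x r = c0 -> l <= lev a 1 x'' r ->
      in_cells T (l + a * r) r.
    move=> h1 h2 y''r l1 l2; rewrite y''r in h2; apply: (in_cells_row cT h1 h2); move: l1 l2;
      rewrite /lev; lia.
  have [m2|m3'] : m = 2%N \/ m = 3%N by lia.
    subst m; have [z [z' [zC z'C lz lz' zz']]] : exists z z' : C, [/\ in_cells T (cx z) (cy z),
      in_cells T (cx z') (cy z'),
        lev a 1 (cx z) (cy z) = c0, lev a 1 (cx z') (cy z') = c1 & cy z' = cy z].
      have [e|[e|[e|e]]] : cy i = cy j \/ cy i = cy j' \/ cy i' = cy j \/ cy i' = cy j' by lia.
      + by exists i, j.
      + by exists i, j'.
      + by exists i', j.
      + by exists i', j'.
    exists (l + a * cy z), (cy z); split; first by rewrite /lev; lia.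
    move=> q q1; have -> : q = 0 by lia.
    rewrite !Z.mul_0_l !Z.add_0_r.
    by apply: (row _ _ _ _ zC z'C zz' lz); move: lz'; rewrite zz'; lia.
  subst m; have Y0' : Y0 = 0 by lia.
  have w0 : in_cells T (X0 + 0 * a) (Y0 + 0 * 1) by apply: (mf_in mf).
  have w1 : in_cells T (X0 + 1 * a) (Y0 + 1 * 1) by apply: (mf_in mf).
  have w2 : in_cells T (X0 + 2 * a) (Y0 + 2 * 1) by apply: (mf_in mf).
  have lw := mf_lev mf.
  have fill y (z : C) : z \in T -> lev a 1 (cx z) (cy z) = c0 -> cy z = y ->
    in_cells T (l + a * y) y.
    move=> zT lz <-; have bz := cell_bounds z.
    have [e|[e|e]] : cy z = 0 \/ cy z = 1 \/ cy z = 2 by lia.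
    + by apply: (row _ _ _ _ (in_cellsE zT) w0); [lia|exact: lz|move: lw; rewrite /lev Y0' e; lia].
    + by apply: (row _ _ _ _ (in_cellsE zT) w1); [lia|exact: lz|move: lw; rewrite /lev Y0' e; lia].
    + by apply: (row _ _ _ _ (in_cellsE zT) w2); [lia|exact: lz|move: lw; rewrite /lev Y0' e; lia].
  have fin r : in_cells T (l + a * r) r -> in_cells T (l + a * (r + 1)) (r + 1) ->
    exists x y, lev a 1 x y = l /\
    forall j, 0 <= j < Z.of_nat 3 - 1 -> in_cells T (x + j * a) (y + j * 1).
    move=> f0 f1; exists (l + a * r), r; split; first by rewrite /lev; lia.
    move=> q q2; have [->|->] : q = 0 \/ q = 1 by lia.
      by rewrite !Z.mul_0_l !Z.add_0_r.
    by rewrite (_ : l + a * r + 1 * a = l + a * (r + 1)) ?Z.mul_1_l //; lia.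
  have Fi := fill _ _ iT li erefl; have Fi' := fill _ _ i'T li' erefl.
  have [e|[e|[[e e']|[e e']]]] : cy i' = cy i + 1 \/ cy i = cy i' + 1 \/ (cy i = 0 /\
    cy i' = 2) \/ (cy i' = 0 /\ cy i = 2) by lia.
  + by apply: (fin (cy i)) => //; rewrite -e.
  + by apply: (fin (cy i')) => //; rewrite -e.
  + apply: (fin 0); first by rewrite -e.
    rewrite e in Fi; rewrite e' in Fi'; apply: (in_cells_mid cT Fi Fi'); lia.
  + apply: (fin 0); first by rewrite -e.
    rewrite e in Fi'; rewrite e' in Fi; apply: (in_cells_mid cT Fi' Fi); lia.
- subst b; have m2 : m = 2%N by lia.
  subst m; have Y0' : Y0 = 0 by lia.
  have w0 : in_cells T (X0 + 0 * a) (Y0 + 0 * 2) by apply: (mf_in mf).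
  have w1 : in_cells T (X0 + 1 * a) (Y0 + 1 * 2) by apply: (mf_in mf).
  have lw := mf_lev mf; have [p [q pq]] := ab.
  rewrite Y0' Z.mul_0_l Z.add_0_r in w0.
  have [z [z' [z0 z2 lz lz']]] : exists z z', [/\ in_cells T z 0, in_cells T z' 2,
    lev a 2 z 0 = c0 & lev a 2 z' 2 = c0].
    have [e|e] : (cy i = 0 /\ cy i' = 2) \/ (cy i' = 0 /\ cy i = 2) by lia.
      case: e => e e'; rewrite e in li iC; rewrite e' in li' i'C.
      by exists (cx i), (cx i').
    case: e => e e'; rewrite e in li' i'C; rewrite e' in li iC.
    by exists (cx i'), (cx i).
  move: lz lz' lw; rewrite /lev Y0' => lz lz' lw.
  have [[h lh]|[h lh]] := Zeven.Z_modulo_2 l.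
    have f0 : in_cells T h 0 by apply: (in_cells_row cT z0 w0); lia.
    exists h, 0; split; first by rewrite /lev; lia.
    by move=> r r1; rewrite (_ : r = 0) ?Z.mul_0_l ?Z.add_0_r //; lia.
  have f0 : in_cells T h 0 by apply: (in_cells_row cT z0 w0); lia.
  have f2 : in_cells T (h + 1 + a) 2.
    by move: w1; rewrite Y0' => w1; apply: (in_cells_row cT z2 w1); lia.
  have [g ag] : exists g, a = 2 * g + 1.
    by have := Zeven.Z_modulo_2 a => -[[g ag]|[g ag]]; exists g; lia.
  exists (h + g + 1), 1; split; first by rewrite /lev; lia.
  move=> r r1; rewrite (_ : r = 0) ?Z.mul_0_l ?Z.add_0_r; last by lia.
  by apply: (in_cells_mid cT f0 f2); lia.
Qed.

(** The at most [m - 1] ambiguous patterns contain [m - 1] consecutive letters of every line in a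
    strip as wide as the relation needs. These lines get periods dividing [N], which the relation
    spreads to the plane. *)
Theorem strip_periodic a b h h' : prim a b -> 0 < b -> X h -> X h' ->
  (forall x y, - lev_width n a b <= lev a b x y < 0 -> h x y = h' x y) -> h 0 0 <> h' 0 0 ->
  periodic (N * a) (N * b) h.
Proof.
move=> ab b0 Xh Xh' agr ne.
have [i0 i0T] := T_nonempty.
have [M [X0 [Y0 [m [mf m3 Y00 mb]]]]] := max_face_ex (gen_convex gT) ab b0 i0T.
have m0 : (0 < m)%N by lia.
have m1 := max_face_ge2 mf ab m0 Xh Xh' agr ne.
have [c0 [c1 lr]] := level_range_ex a b (rel_nz rel).
have [u [cu lu]] := lr_min lr; have [v [cv lv]] := lr_max lr.
have cw : c1 - c0 <= lev_width n a b by rewrite -lu -lv; exact: lev_widthP.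
have [u' [cu' uu' lu']] := min_face_two rel Xh Xh' ab lr cw agr ne cu lu.
have [v' [cv' vv' lv']] := max_face_two rel Xh Xh' lr cw agr ne cv lv.
have cov : forall l, c0 <= l < c1 -> exists x y, lev a b x y = l /\
    forall j, 0 <= j < Z.of_nat m - 1 -> in_cells T (x + j * a) (y + j * b).
  apply: (level_coverage mf ab b0) => //; first by lia.
    by exists u, u'; split => //; exact: nesym.
  by exists v, v'; split => //; exact: nesym.
(* These are the levels that the relation meets, below its own top level, in windows with their face
   on level 0. *)
apply: (periodic_spread rel ab Xh lr (M := - M)) => x y lxy.
have [qx [qy [lq qT]]] := cov (lev a b x y + M) ltac:(lia).
have lw := mf_lev mf.
have [t [tx ty]] : exists t, x - (qx - X0) = t * a /\ y - (qy - Y0) = t * b.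
  by apply: prim_col => //; move: lq lw; rewrite /lev; lia.
pose s t := h (qx - X0 + t * a) (qy - Y0 + t * b).
pose kap t := pat (below a b M T) h (t * a - X0) (t * b - Y0).
have kapS t' : kap t' \in ambiguous eta T (below a b M T).
  apply: (face_windows_ambiguous gT mf ab m0 Xh Xh' agr (x0 := 0) (y0 := 0)) => //; rewrite /lev;
    lia.
have card_amb : (#|ambiguous eta T (below a b M T)| <= m - 1)%N.
  have pT : below a b M T \proper T.
    have [w wT [wx wy]] : in_cells T (X0 + 0 * a) (Y0 + 0 * b) by apply: (mf_in mf); lia.
    apply/properP; split; first by apply/fintype.subsetP => i /belowP[].
    exists w => //; apply/negP => /belowP[_]; have := mf_lev mf; rewrite wx wy /lev; lia.
  have cb : convex (below a b M T) by exact: (convex_cut _ _ _ (gen_convex gT)).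
  have := card_ambiguous_pats gT cb pT; have := max_face_card mf m0.
  by move: #|ambiguous _ _ _| #|T| #|below a b M T| => *; lia.
have kdet t1 t2 : kap t1 = kap t2 -> forall i, (i < m - 1)%N ->
  s (t1 + Z.of_nat i) = s (t2 + Z.of_nat i).
  move=> /pat_eqP E i im; have [z zT [zx zy]] := qT (Z.of_nat i) ltac:(lia).
  have := E z; rewrite zx zy /s.
  rewrite !(_ : forall r, r * a - X0 + (qx + Z.of_nat i * a) = qx - X0 + (r + Z.of_nat i) * a);
    try lia.
  rewrite !(_ : forall r, r * b - Y0 + (qy + Z.of_nat i * b) = qy - Y0 + (r + Z.of_nat i) * b);
    try lia.
  by apply; apply/belowP; split => //; rewrite zx zy lev_shift lq; have := lr_bound lr cv;
    have := mf_le mf (rel_T rel cv); lia.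
have [d d1 sd] := morse_hedlund_code card_amb kapS kdet.
have n0 : (0 < n)%N by have := ltn_ord i0.1; lia.
have sN := @small_period_Nper _ n _ s d (h 0 0) ltac:(lia) sd t.
by move: sN; rewrite /s => sN; transitivity (h (qx - X0 + (t + N) * a) (qy - Y0 + (t + N) * b));
  [congr h; lia|rewrite sN; congr h; lia].
Qed.

End Generating.
End StripPeriod.

(** * Nondeterministic directions *)

Section Nondeterminism.
Variables (A : finType) (n : nat).
Notation cfg := (Z -> Z -> A).
Notation C := ('I_n * 'I_3)%type.
Notation N := (Nper A n).

(* Nondeterminism of the direction [(a, b)]: the sign of [(a, b)] selects the side. *)
Definition nd (eta : cfg) (a b : Z) := forall W, exists h h',
  [/\ in_hull eta h, in_hull eta h', forall x y, - W <= lev a b x y < 0 ->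
    h x y = h' x y & h 0 0 <> h' 0 0].

Definition xrefl (h : cfg) : cfg := fun x y => h (- x) y.
Definition yrefl (h : cfg) : cfg := fun x y => h x (- y).

Lemma xreflK h : xrefl (xrefl h) = h.
Proof. by apply/funext => x; apply/funext => y; rewrite /xrefl Z.opp_involutive. Qed.

Lemma yreflK h : yrefl (yrefl h) = h.
Proof. by apply/funext => x; apply/funext => y; rewrite /yrefl Z.opp_involutive. Qed.

Lemma in_hull_xrefl eta h : in_hull eta h -> in_hull (xrefl eta) (xrefl h).
Proof.
move=> H r; have [u [v E]] := H r; exists (- u), v => x y hx hy.
by rewrite /xrefl E; [congr eta; lia|lia..].
Qed.

Lemma in_hull_yrefl eta h : in_hull eta h -> in_hull (yrefl eta) (yrefl h).
Proof.
move=> H r; have [u [v E]] := H r; exists u, (- v) => x y hx hy.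
by rewrite /yrefl E; [congr eta; lia|lia..].
Qed.

Lemma nd_xrefl eta a b : nd eta a b -> nd (xrefl eta) a (- b).
Proof.
move=> H W; have [h [h' [Xh Xh' agr ne]]] := H W.
exists (xrefl h), (xrefl h'); split; rewrite /xrefl //; try exact: in_hull_xrefl.
by move=> x y l; apply: agr; move: l; rewrite /lev; lia.
Qed.

Lemma nd_yrefl eta a b : nd eta a b -> nd (yrefl eta) (- a) b.
Proof.
move=> H W; have [h [h' [Xh Xh' agr ne]]] := H W.
exists (yrefl h), (yrefl h'); split; rewrite /yrefl //; try exact: in_hull_yrefl.
by move=> x y l; apply: agr; move: l; rewrite /lev; lia.
Qed.

Lemma card_pats_xrefl eta k : (#|pats (n := n) (xrefl eta) (rows n k)| <= #|pats (n := n) eta (rows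
  n k)|)%N.
Proof.
pose F (w : {ffun C -> option A}) : {ffun C -> option A} := [ffun i : C => w (rev_ord i.1, i.2)].
apply: leq_trans (leq_imset_card F _); apply: subset_leq_card; apply/fintype.subsetP => w.
rewrite inE => /asboolP[x [y ->]].
apply/imsetP; exists (pat (rows n k) eta (- x - (Z.of_nat n - 1)) y).
  by apply: pat_hull; exact: in_hull_refl.
apply/ffunP => i; rewrite !ffunE !inE /=; case: ifP => // _; congr Some.
rewrite /xrefl /cx /cy /=; congr eta; have := ltn_ord i.1.
by move: (nat_of_ord i.1) => u; lia.
Qed.

Lemma card_pats_yrefl eta k : (k <= 3)%N ->
  (#|pats (n := n) (yrefl eta) (rows n k)| <= #|pats (n := n) eta (rows n k)|)%N.
Proof.
move=> k3.
pose F (w : {ffun C -> option A}) : {ffun C -> option A} :=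
  [ffun i : C => if (i.2 < k)%N then w (i.1, inord (k.-1 - i.2)) else None].
apply: leq_trans (leq_imset_card F _); apply: subset_leq_card; apply/fintype.subsetP => w.
rewrite inE => /asboolP[x [y ->]].
apply/imsetP; exists (pat (rows n k) eta x (- y - (Z.of_nat k - 1))).
  by apply: pat_hull; exact: in_hull_refl.
apply/ffunP => i; rewrite !ffunE !inE /=; case: ifP => // ik.
have e : @inord 2 (k.-1 - i.2) = (k.-1 - i.2)%N :> nat by rewrite inordK; lia.
rewrite e ifT; last by lia.
congr Some; rewrite /yrefl /cx /cy /= e; congr eta.
by move: (nat_of_ord i.2) ik => u; lia.
Qed.

Lemma low_complexity_xrefl eta k : low_complexity n eta k -> low_complexity n (xrefl eta) k.
Proof.
move=> [k0 k3 le gt]; split => //; first exact: leq_trans (card_pats_xrefl _ _) le.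
by apply: leq_trans gt _; rewrite -{1}(xreflK eta); exact: card_pats_xrefl.
Qed.

Lemma low_complexity_yrefl eta k : low_complexity n eta k -> low_complexity n (yrefl eta) k.
Proof.
move=> [k0 k3 le gt]; split => //; first exact: leq_trans (card_pats_yrefl _ k3) le.
apply: leq_trans gt _; rewrite -{1}(yreflK eta); apply: card_pats_yrefl; lia.
Qed.

(** If the levels above determined level 0, the periodic configurations [h] and [h'] would have a
    common transversal period [P], and their difference at the origin would recur on level [- P],
    where the strip was chosen wide enough for them to agree. *)
Lemma nd_neg_pos eta k a b : low_complexity n eta k -> prim a b -> 0 < b -> nd eta a b ->
  nd eta (- a) (- b).
Proof.
move=> lc ab b0 ndab; have [T gT] := generating_ex lc; have [c [k0 rel]] := relation_ex gT.
move=> W1; apply: contrapT => /forallNP H.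
have det h h' : in_hull eta h -> in_hull eta h' ->
    (forall x y, 0 < lev a b x y <= W1 -> h x y = h' x y) -> h 0 0 = h' 0 0.
  move=> Xh Xh' agr; apply: contrapT => ne; case: (H h); exists h'; split => // x y.
  by rewrite levN => l; apply: agr; lia.
pose W := (Z.to_nat W1).+1; pose P := state_period A W (K0 A n)`!.
have P0 : 0 < P by exact: state_period_gt0.
have [h [h' [Xh Xh' agr ne]]] := ndab (Z.max P (lev_width n a b)).
have [p [q pq]] := ab.
have key g : in_hull eta g -> periodic (N * a) (N * b) g -> g 0 0 = g (- P * q) (P * p).
  move=> Xg gper.
  have N0 : (0 < (K0 A n)`!)%N by exact: fact_gt0.
  have Edet s t : (forall x y, 1 <= lev a b x y <= Z.of_nat W ->
       g (x + s * q) (y - s * p) = g (x + t * q) (y - t * p)) ->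
     forall x y, lev a b x y = 0 -> g (x + s * q) (y - s * p) = g (x + t * q) (y - t * p).
    move=> E x y l0; have := det (shiftc (x + s * q) (y - s * p) g) (shiftc (x + t * q) (y - t * p)
      g).
    rewrite /shiftc !Z.add_0_l; apply; try exact: in_hull_shift.
    move=> x' y' l'; have := E (x' + x) (y' + y).
    rewrite !Z.add_sub_assoc !Z.add_assoc; apply; rewrite levD l0 /W; lia.
  have := level_periodic pq (ltn0Sn _) N0 gper Edet (- P * q) (P * p).
  rewrite -/P => <-; congr g; lia.
have ne' : h' 0 0 <> h 0 0 by exact: nesym.
apply: (ne); rewrite (key h) ?(key h') //.
- apply: agr; have := congr1 (Z.mul P) pq; rewrite /lev; lia.
- apply: (strip_periodic gT rel ab b0 Xh' Xh) => // x y l; symmetry; apply: agr; lia.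
- by apply: (strip_periodic gT rel ab b0 Xh Xh') => // x y l; apply: agr; lia.
Qed.

Lemma nd_neg eta k a b : low_complexity n eta k -> prim a b -> b <> 0 -> nd eta a b ->
  nd eta (- a) (- b).
Proof.
move=> lc ab b0 ndab; have [b1|b1] : 0 < b \/ 0 < - b by lia.
  exact: nd_neg_pos lc ab b1 ndab.
have := @nd_neg_pos (yrefl (xrefl eta)) k (- a) (- b) (low_complexity_yrefl (low_complexity_xrefl
  lc)) (primN ab) b1.
move=> /(_ (nd_yrefl (nd_xrefl ndab))) /nd_yrefl/nd_xrefl.
by rewrite yreflK xreflK !Z.opp_involutive.
Qed.

(** The full rectangle replaces [T], so that agreement on [k - 1] rows is enough. Any [n]
    consecutive points of row [Y] contain a difference: otherwise the extreme cells in the top row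
    of the relation would spread agreement along the row. So all windows on the rows below are
    ambiguous; there are at most [n] such patterns and each shows [n] letters of every row. *)
Lemma rows_agree_up eta k (h h' : cfg) Y x1 : low_complexity n eta k -> in_hull eta h ->
  in_hull eta h' ->
  (forall x y, Y - (Z.of_nat k - 1) <= y < Y -> h x y = h' x y) -> h x1 Y <> h' x1 Y ->
  periodic N 0 h.
Proof.
move=> lc Xh Xh' agr ne; have [T gT] := generating_ex lc; have [c [k0 rel]] := relation_ex gT.
have k1 := lc_k0 lc; have k3 := lc_k3 lc.
have ab : prim (-1) 0 by exists (-1), 0.
have [c0 [c1 lr]] := level_range_ex (-1) 0 (rel_nz rel).
have levE x y : lev (-1) 0 x y = y by rewrite /lev; lia.
have cyT i : c i <> 0%R -> c0 <= cy i <= c1 /\ 0 <= cy i <= Z.of_nat k - 1.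
  move=> ci; have := lr_bound lr ci; rewrite levE; split => //.
  by have := fintype.subsetP (gen_rows gT) _ (rel_T rel ci); rewrite inE /cy; lia.
have [u [cu lu]] := lr_min lr; have [v [cv lv]] := lr_max lr; rewrite levE in lu;
  rewrite levE in lv.
have bu := cyT _ cu; have bv := cyT _ cv.
have n0 : (0 < n)%N by have := ltn_ord u.1; lia.
pose e x y : int := (val_of (h x y) - val_of (h' x y))%R.
have e_sum x y : psum c e x y = 0%R by rewrite /e psumB !(rel_sum rel) // subrr.
have e0 x y : h x y = h' x y -> e x y = 0%R by rewrite /e => ->; rewrite subrr.
have e1 x y : e x y = 0%R -> h x y = h' x y by move/eqP; rewrite subr_eq0 => /eqP/val_of_inj.
pose P i := (c i != 0%R) && (cy i =? c1).
have Pv : P v by rewrite /P lv Z.eqb_refl andbT; apply/eqP.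
have low x i : c i <> 0%R -> cy i <> c1 -> e (x + cx i) (Y - c1 + cy i) = 0%R.
  by move=> ci i1; apply/e0/agr; have := cyT _ ci; lia.
have step x : (forall j, 0 <= j < Z.of_nat n -> e (x + j) Y = 0%R) ->
    e (x + Z.of_nat n) Y = 0%R /\ e (x - 1) Y = 0%R.
  move=> E; split.
    have [w /andP[/eqP cw /Z.eqb_eq wy] wmax] := arg_max_cell (fun i => cx i) Pv.
    have := e_sum (x + Z.of_nat n - cx w) (Y - c1); rewrite (psum_single (i0 := w)).
      by rewrite Z.sub_add wy Z.sub_add => /eqP; rewrite mulf_eq0 => /orP[]/eqP.
    move=> i ci iw; have [iy|iy] := Z.eq_dec (cy i) c1; last exact: low.
    have := wmax i; rewrite /P iy Z.eqb_refl andbT => /(_ (introN eqP ci)) iwx.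
    have iwx' : cx i <> cx w by move=> ix; apply: iw; apply: cell_inj; lia.
    have := E (Z.of_nat n - cx w + cx i); have := cell_bounds i; have := cell_bounds w.
    have -> : x + Z.of_nat n - cx w + cx i = x + (Z.of_nat n - cx w + cx i) by lia.
    by rewrite iy Z.sub_add => bw bi; apply; lia.
  have [w /andP[/eqP cw /Z.eqb_eq wy] wmax] := arg_max_cell (fun i => - cx i) Pv.
  have := e_sum (x - 1 - cx w) (Y - c1); rewrite (psum_single (i0 := w)).
    by rewrite Z.sub_add wy Z.sub_add => /eqP; rewrite mulf_eq0 => /orP[]/eqP.
  move=> i ci iw; have [iy|iy] := Z.eq_dec (cy i) c1; last exact: low.
  have := wmax i; rewrite /P iy Z.eqb_refl andbT => /(_ (introN eqP ci)) iwx.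
  have iwx' : cx i <> cx w by move=> ix; apply: iw; apply: cell_inj; lia.
  have := E (cx i - cx w - 1); have := cell_bounds i; have := cell_bounds w.
  have -> : x - 1 - cx w + cx i = x + (cx i - cx w - 1) by lia.
  by rewrite iy Z.sub_add => bw bi; apply; lia.
have dif x : exists2 j, 0 <= j < Z.of_nat n & h (x + j) Y <> h' (x + j) Y.
  apply: contrapT => H; apply: ne; apply: e1.
  have base j : 0 <= j < Z.of_nat n -> e (x + j) Y = 0%R.
    by move=> jn; apply: e0; apply: contrapT => E; apply: H; exists j.
  have dn (s : nat) : forall j, 0 <= j < Z.of_nat n -> e (x - Z.of_nat s + j) Y = 0%R.
    elim: s => [|s IH] j jn; first by rewrite Z.sub_0_r; exact: base.
    have [_ E] := step _ IH.
    have [j0|j0] : j = 0 \/ 1 <= j by lia.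
      by rewrite (_ : x - _ + j = x - Z.of_nat s - 1) //; lia.
    by rewrite (_ : x - _ + j = x - Z.of_nat s + (j - 1)); [apply: IH; lia|lia].
  have up (s : nat) : forall j, 0 <= j < Z.of_nat n -> e (x + Z.of_nat s + j) Y = 0%R.
    elim: s => [|s IH] j jn; first by rewrite Z.add_0_r; exact: base.
    have [E _] := step _ IH.
    have [j0|j0] : j = Z.of_nat n - 1 \/ j < Z.of_nat n - 1 by lia.
      by rewrite (_ : x + _ + j = x + Z.of_nat s + Z.of_nat n) //; lia.
    by rewrite (_ : x + _ + j = x + Z.of_nat s + (j + 1)); [apply: IH; lia|lia].
  have [xx|xx] : x1 <= x \/ x <= x1 by lia.
    by have := dn (Z.to_nat (x - x1)) 0; rewrite (_ : x - _ + 0 = x1); [apply; lia|lia].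
  by have := up (Z.to_nat (x1 - x)) 0; rewrite (_ : x + _ + 0 = x1); [apply; lia|lia].
pose R := rows n k; pose R' := rows n k.-1.
have sR : R' \subset R by apply/fintype.subsetP => i; rewrite !inE; lia.
have x0n : (0 < n)%N by []. 
have [w [wx wy]] : exists i : C, cx i = 0 /\ cy i = Z.of_nat k - 1 by apply: cellP; lia.
have pR : R' \proper R.
  by apply/properP; split => //; exists w; rewrite !inE; move: wy; rewrite /cy; lia.
have card_amb : (#|ambiguous eta R R'| <= n)%N.
  have Sc : (#|pats eta R| <= #|[set restr R' x | x in pats eta R]| + n)%N.
    rewrite restr_pats //; have := lc_le lc; have := lc_gt lc.
    rewrite -/R -/R'; move: #|pats _ R| #|pats _ R'| => p p'; case: (k) k1 => // k' _ /=;
      rewrite mulnS; lia.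
  by apply: (card_ambiguous Sc) => r; rewrite inE => /asboolP.
pose kap t := pat R' h t (Y - (Z.of_nat k - 1)).
have kapS t : kap t \in ambiguous eta R R'.
  have [j jn nej] := dif t.
  have [i [ix iy]] : exists i : C, cx i = j /\ cy i = Z.of_nat k - 1 by apply: cellP; lia.
  apply: (ambiguousP pR Xh Xh' (i := i) (u' := t) (v' := Y - (Z.of_nat k - 1))).
  - by move=> i' i'R; apply: agr; move: i'R; rewrite inE /cy; lia.
  - by rewrite inE; move: iy; rewrite /cy; lia.
  - by rewrite ix iy Z.sub_add.
have rowper r : 0 <= r < Z.of_nat k - 1 -> forall t, h (t + N) (Y - (Z.of_nat k - 1) + r) = h t (Y
  - (Z.of_nat k - 1) + r).
  move=> rk; pose s t := h t (Y - (Z.of_nat k - 1) + r).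
  have kdet t1 t2 : kap t1 = kap t2 -> forall i, (i < n)%N ->
    s (t1 + Z.of_nat i) = s (t2 + Z.of_nat i).
    move=> /pat_eqP E i iN.
    have [z [zx zy]] : exists z : C, cx z = Z.of_nat i /\ cy z = r by apply: cellP; lia.
    have := E z; rewrite zx zy; apply; rewrite inE; move: zy; rewrite /cy; lia.
  have [d d1 sd] := morse_hedlund_code card_amb kapS kdet.
  by apply: (small_period_Nper (h 0 0) _ sd); lia.
have pers : periodic (N * -1) (N * 0) h.
  apply: (periodic_spread rel ab Xh lr (M := Y - c1)) => x' y'; rewrite levE => ly.
  rewrite Z.mul_0_r Z.add_0_r.
  have := rowper (y' - (Y - (Z.of_nat k - 1))) ltac:(lia) (x' + N * -1).
  have -> : x' + N * -1 + N = x' by lia.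
  by have -> : Y - (Z.of_nat k - 1) + (y' - (Y - (Z.of_nat k - 1))) = y' by lia.
move=> x y; have := pers (x + N) y.
by have -> : x + N + N * -1 = x; [lia|rewrite Z.mul_0_r !Z.add_0_r => <-].
Qed.

Theorem rows_agree_periodic eta k (h h' : cfg) Y x1 y1 : low_complexity n eta k ->
  in_hull eta h -> in_hull eta h' ->
  (forall x y, Y <= y < Y + (Z.of_nat k - 1) -> h x y = h' x y) -> h x1 y1 <> h' x1 y1 ->
  periodic N 0 h.
Proof.
move=> lc Xh Xh' agr ne; apply: contrapT => nper.
have up (g g' : cfg) et : low_complexity n et k -> in_hull et g -> in_hull et g' ->
  ~ periodic N 0 g -> forall Z0,
   (forall x y, Z0 <= y < Z0 + (Z.of_nat k - 1) -> g x y = g' x y) -> forall y, Z0 <= y ->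
     forall x, g x y = g' x y.
  move=> lc' Xg Xg' npg Z0 ag; apply: Z_ind_up => y Zy IH x.
  have [yk|yk] : y < Z0 + (Z.of_nat k - 1) \/ Z0 + (Z.of_nat k - 1) <= y by lia.
    by apply: ag; lia.
  apply: contrapT => ne'; apply: npg; apply: (rows_agree_up lc' Xg Xg' _ ne').
  by move=> x' y' y'b; apply: IH; lia.
apply: ne; have [Yy|Yy] : Y <= y1 \/ y1 < Y by lia.
  exact: up lc Xh Xh' nper _ agr _ Yy _.
have := up (yrefl h) (yrefl h') (yrefl eta) (low_complexity_yrefl lc) (in_hull_yrefl Xh)
  (in_hull_yrefl Xh') _ (- (Y + (Z.of_nat k - 1) - 1)) _ (- y1) _ x1.
rewrite /yrefl Z.opp_involutive; have k0 := lc_k0 lc; apply; last lia.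
  by move=> H; apply: nper => x y; have := H x (- y); rewrite !Z.add_0_r Z.opp_involutive.
by move=> x y yb; apply: agr; lia.
Qed.

End Nondeterminism.

(** * Spreading invariance to a strip *)

Section Compactness.
Variables (A : finType).
Notation cfg := (Z -> Z -> A).

(** Compactness of the full shift: along an ultrafilter containing all tails, each cell sees exactly
    one letter of the finite alphabet. *)
Lemma limit_config (hs : nat -> cfg) : exists h : cfg, forall (r : Z) (m : nat), exists2 i,
  (m <= i)%N & forall x y, Z.abs x <= r -> Z.abs y <= r -> hs i x y = h x y.
Proof.
pose F : set_system nat := fun B => exists m : nat, forall i, (m <= i)%N -> B i.
have FF : ProperFilter F.
  apply: Build_ProperFilter_ex.
    by move=> B [m H]; exists m; exact: H.
  split.
  - by exists 0%N.
  - move=> P Q [m H] [m' H']; exists (maxn m m') => i; rewrite geq_max => /andP[mi m'i].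
    by split; [exact: H|exact: H'].
  - by move=> P Q PQ [m H]; exists m => i /H; exact: PQ.
have [G [GU FG]] := ultraFilterLemma FF.
have ex x y : exists a, G (fun i : nat => hs i x y = a).
  apply: contrapT => /forallNP H.
  have : G (fun i : nat => hs i x y \notin enum A).
    elim: (enum A) => [|a s IH]; first by apply: filterE => i.
    have [/(H a)//|Ha] := in_ultra_setVsetC (fun i : nat => hs i x y = a) GU.
    apply: (filterS _ (filterI Ha IH)) => i [/= /eqP ne hi].
    by rewrite inE negb_or ne.
  by move=> /filter_ex[i] /=; rewrite mem_enum.
pose h x y := projT1 (cid (ex x y)).
have hG x y : G (fun i : nat => hs i x y = h x y) by exact: projT2 (cid (ex x y)).
exists h => r m.
pose pts := [seq (i, j) | i <- iota 0 (2 * Z.to_nat r).+1, j <- iota 0 (2 * Z.to_nat r).+1].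
have Gpts : G (fun i : nat => forall p, p \in pts ->
    hs i (Z.of_nat p.1 - r) (Z.of_nat p.2 - r) = h (Z.of_nat p.1 - r) (Z.of_nat p.2 - r)).
  elim: pts => [|p s IH]; first by apply: filterE => i.
  by apply: (filterS _ (filterI (hG (Z.of_nat p.1 - r) (Z.of_nat p.2 - r)) IH)) => i [/= E1 E2]
    p'; rewrite inE => /orP[/eqP->|/E2].
have Gm : G (fun i : nat => (m <= i)%N) by apply: FG; exists m.
have [i [/= Ei mi]] := filter_ex (filterI Gpts Gm).
exists i => // x y hx hy.
have := Ei (Z.to_nat (x + r), Z.to_nat (y + r)).
rewrite /= !Z2Nat.id; [|lia..].
rewrite !Z.add_simpl_r; apply.
by apply: allpairs_f; rewrite mem_iota; lia.
Qed.

Lemma in_hull_limit (eta : cfg) (hs : nat -> cfg) (h : cfg) :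
  (forall (r : Z) (m : nat), exists2 i, (m <= i)%N &
     forall x y, Z.abs x <= r -> Z.abs y <= r -> hs i x y = h x y) ->
  (forall i, in_hull eta (hs i)) -> in_hull eta h.
Proof.
move=> H Xhs r; have [i _ E] := H r 0%N; have [u [v E']] := Xhs i r.
by exists u, v => x y hx hy; rewrite -E // E'.
Qed.

(** Otherwise, counterexamples for larger and larger squares accumulate at a counterexample for [S].
    What is gained is a radius common to all [h]. *)
Lemma compact_rule (eta : cfg) (w1 w2 : Z) (S : Z -> Z -> Prop) :
  (forall h, in_hull eta h -> (forall x y, S x y -> h (x + w1) (y + w2) = h x y) ->
    h w1 w2 = h 0 0) ->
  exists2 D, 0 <= D & forall h, in_hull eta h ->
    (forall x y, S x y -> Z.abs x <= D -> Z.abs y <= D -> h (x + w1) (y + w2) = h x y) ->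
      h w1 w2 = h 0 0.
Proof.
move=> rule; apply: contrapT => /forall2NP H.
have ex (m : nat) : exists h, [/\ in_hull eta h, h w1 w2 <> h 0 0 &
    forall x y, S x y -> Z.abs x <= Z.of_nat m -> Z.abs y <= Z.of_nat m ->
      h (x + w1) (y + w2) = h x y].
  case: (H (Z.of_nat m)) => [|/existsNP[h /not_implyP[Xh /not_implyP[E ne]]]]; first by lia.
  by exists h.
pose hs m := projT1 (cid (ex m)).
have hsP m : [/\ in_hull eta (hs m), hs m w1 w2 <> hs m 0 0 &
    forall x y, S x y -> Z.abs x <= Z.of_nat m -> Z.abs y <= Z.of_nat m ->
      hs m (x + w1) (y + w2) = hs m x y].
  exact: projT2 (cid (ex m)).
have [h hl] := limit_config hs.
have Xh : in_hull eta h by apply: in_hull_limit hl _ => i; case: (hsP i).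
have [i _ Ei] := hl (Z.abs w1 + Z.abs w2) 0%N.
have [_ ne _] := hsP i; apply: ne; rewrite !Ei; try lia.
apply: rule => // x y Sxy.
have [j jm Ej] := hl (Z.abs x + Z.abs y + Z.abs w1 + Z.abs w2) (Z.to_nat (Z.abs x + Z.abs y)).
by have [_ _ E] := hsP j; rewrite -!Ej ?E //; lia.
Qed.

End Compactness.

(** * Fronts, and adding one level to a region of invariance *)

Section Fronts.
Variables (A : finType) (n : nat).
Notation cfg := (Z -> Z -> A).
Notation C := ('I_n * 'I_3)%type.
Notation N := (Nper A n).

(* Invariance under the translation by [(w1, w2)] crosses, locally, the boundary of the half
   plane [lev a b < 0]. *)
Definition front (eta : cfg) (a b w1 w2 : Z) := exists2 D, 0 <= D & forall h, in_hull eta h ->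
  forall x y, (forall dx dy, Z.abs dx <= D -> Z.abs dy <= D -> lev a b dx dy < 0 ->
       h (x + dx + w1) (y + dy + w2) = h (x + dx) (y + dy)) -> h (x + w1) (y + w2) = h x y.

Lemma front_rule (eta : cfg) a b w1 w2 :
  (forall h, in_hull eta h -> (forall x y, lev a b x y < 0 -> h (x + w1) (y + w2) = h x y) ->
    h w1 w2 = h 0 0) ->
  front eta a b w1 w2.
Proof.
move=> /compact_rule[D D0 H]; exists D => // h Xh x y E.
have := H (shiftc x y h) (in_hull_shift _ _ Xh); rewrite /shiftc !Z.add_0_l (Z.add_comm x)
  (Z.add_comm y).
apply => x' y' l hx hy; have := E x' y' hx hy l.
have -> : x + x' + w1 = x' + w1 + x by lia.
have -> : y + y' + w2 = y' + w2 + y by lia.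
by rewrite (Z.add_comm x) (Z.add_comm y).
Qed.

(** The configuration and its translate agree on the half plane, and a deterministic direction
    carries this to the boundary line. *)
Lemma front_not_nd (eta : cfg) a b w1 w2 : ~ nd eta a b -> front eta a b w1 w2.
Proof.
move=> /existsNP[W HW]; apply: front_rule => h Xh E; apply: contrapT => ne.
apply: HW; exists (shiftc w1 w2 h), h; split => //; first exact: in_hull_shift.
by move=> x y [_ l]; rewrite /shiftc E.
Qed.

(** Even a nondeterministic line lets through the period [N] in its own direction, by propagation
    with the relation. *)
Lemma front_parallel (eta : cfg) k a b : low_complexity n eta k -> prim a b ->
  front eta a b (N * a) (N * b).
Proof.
move=> lc ab; have [T gT] := generating_ex lc; have [c [k0 rel]] := relation_ex gT.
have [c0 [c1 lr]] := level_range_ex a b (rel_nz rel).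
apply: front_rule => h Xh E; apply: val_of_inj.
have := @propagate_up _ _ c (fun x y => val_of (h x y)) k0 a b c0 c1 (- c1) ab (val_bound h)
  (rel_sum rel Xh) lr.
move=> H; have := H _ 0 0; rewrite !Z.add_0_l; apply.
  by move=> x y l; rewrite E //; lia.
by have [i [ci li]] := lr_min lr; have := lr_bound lr ci; rewrite /lev; lia.
Qed.

End Fronts.

Section AddLevel.
Variables (n : nat).
Notation C := ('I_n * 'I_3)%type.
(** [zp] is the invariance to be spread, known for [psi < X] within [psi' < X'] and [lo <= chi],
    near the level [psi = X] to be added. [q] and [e] are the ends of the face of [T] where [psi] is
    largest. By [wide], the part of the new level close to [psi' = X'] stays away from the border
    [chi = lo], so that the arguments at the two ends do not interfere. *)
Variables (T : {set C}) (zp : Z -> Z -> Prop) (q e : C) (D E Ds : Z).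
Variables (psi psi' chi : Z -> Z -> Z).
Hypothesis psiD : forall x y dx dy, psi (x + dx) (y + dy) = psi x y + psi dx dy.
Hypothesis psi'D : forall x y dx dy, psi' (x + dx) (y + dy) = psi' x y + psi' dx dy.
Hypothesis chiD : forall x y dx dy, chi (x + dx) (y + dy) = chi x y + chi dx dy.
Hypothesis DE : D <= E.
Hypothesis nE : Z.of_nat n + 3 <= E.
Hypothesis psi'_bound : forall dx dy, Z.abs dx <= E -> Z.abs dy <= E -> Z.abs (psi' dx dy) <= Ds.
Hypothesis chi_bound : forall dx dy, Z.abs dx <= E -> Z.abs dy <= E -> Z.abs (chi dx dy) <= Ds.

Notation off i j f := (f (cx i - cx j) (cy i - cy j)).

Hypothesis vq : forall x y, (forall i, i \in T -> i != q ->
  zp (x + (cx i - cx q)) (y + (cy i - cy q))) -> zp x y.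
Hypothesis ve : forall x y, (forall i, i \in T -> i != e ->
  zp (x + (cx i - cx e)) (y + (cy i - cy e))) -> zp x y.
Hypothesis fr : forall x y, (forall dx dy, Z.abs dx <= D -> Z.abs dy <= D -> psi dx dy < 0 ->
  zp (x + dx) (y + dy)) -> zp x y.
Hypothesis q_face : forall i, i \in T -> i != q -> off i q psi < 0 \/ off i q psi = 0 /\
  off i q chi < 0.
Hypothesis q_max' : forall i, i \in T -> off i q psi' <= 0.
Hypothesis e_face : forall i, i \in T -> i != e -> off i e psi < 0 \/ off i e psi = 0 /\
  0 < off i e chi.
Hypothesis e_min : forall i, i \in T -> 0 <= off i e chi.

Variables (X X' lo : Z).
Hypothesis region : forall x y dx dy, psi x y = X -> psi' x y < X' -> lo <= chi x y ->
  Z.abs dx <= E -> Z.abs dy <= E -> psi dx dy < 0 -> psi' (x + dx) (y + dy) < X' ->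
  lo <= chi (x + dx) (y + dy) -> zp (x + dx) (y + dy).
Hypothesis wide : forall x y, psi x y = X -> lo <= chi x y -> X' - Ds <= psi' x y ->
  lo + 2 * Ds <= chi x y.

Let offE (i j : C) : Z.abs (cx i - cx j) <= E /\ Z.abs (cy i - cy j) <= E.
Proof. by have := cell_bounds i; have := cell_bounds j; lia. Qed.

(* The middle of the new level is filled by [fr], the part towards [chi] large by placing the
   vertex [q] there, the part towards [chi] small by placing the vertex [e] there. *)
Lemma add_level x y : psi x y = X -> psi' x y < X' -> lo <= chi x y -> zp x y.
Proof.
have E0 : 0 <= E by lia.
have Ds0 : 0 <= Ds by have := @chi_bound 0 0 ltac:(lia) ltac:(lia); lia.
have up l : lo + Ds <= l -> forall x y, chi x y = l -> psi x y = X -> psi' x y < X' -> zp x y.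
  move: l; apply: Z_ind_up => l l0 IH {}x {}y xl xX xX'.
  have [near|far] : psi' x y < X' - Ds \/ X' - Ds <= psi' x y by lia.
    apply: fr => dx dy hx hy hd.
    have hp := @psi'_bound dx dy ltac:(lia) ltac:(lia); have hc := @chi_bound dx dy ltac:(lia)
      ltac:(lia).
    by apply: region => //; rewrite ?psi'D ?chiD; lia.
  have xw := wide xX ltac:(lia) far.
  apply: vq => i iT iq; have [ox oy] := offE i q.
  have hp := q_max' iT; have hc := chi_bound ox oy.
  have [l1|[l1 l2]] := q_face iT iq.
    by apply: region => //; rewrite ?(psi'D x) ?(chiD x); lia.
  by apply: (IH (chi (x + (cx i - cx q)) (y + (cy i - cy q))));
    rewrite ?(psi'D x) ?(chiD x) ?(psiD x); lia.
move=> xX xX' xlo.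
have [l El] : exists l, - chi x y = l by exists (- chi x y).
have [up'|dn] : lo + Ds <= chi x y \/ chi x y < lo + Ds by lia.
  exact: (up _ up').
have Ml : - (lo + Ds) <= l by lia.
move: l Ml x y El xX xX' xlo dn; apply: Z_ind_up => l l0 IH x y xl xX xX' xlo dn.
have far : psi' x y < X' - Ds by have := wide xX xlo; lia.
apply: ve => i iT ie; have [ox oy] := offE i e.
have hp := psi'_bound ox oy; have hc := e_min iT.
have [l1|[l1 l2]] := e_face iT ie.
  by apply: region => //; rewrite ?(psi'D x) ?(chiD x); lia.
have [u1|u2] : lo + Ds <= chi (x + (cx i - cx e)) (y + (cy i - cy e)) \/ chi (x + (cx i - cx e)) (y
  + (cy i - cy e)) < lo + Ds by lia.
  by apply: (up _ u1); rewrite ?(psi'D x) ?(psiD x); lia.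
rewrite (chiD x) in u2.
by apply: (IH (- chi (x + (cx i - cx e)) (y + (cy i - cy e))));
  rewrite ?(psi'D x) ?(chiD x) ?(psiD x); lia.
Qed.

End AddLevel.

Lemma scaled_le d c x y : 0 < d -> 0 <= c -> d * x <= d * y + c -> x <= y + c.
Proof. by move=> d0 c0 H; nia. Qed.

(** Choice of the first apex of the wedge in [corner_strip], by its levels in the two directions:
    far out, and close to the middle of the strip. *)
Lemma apex_ex g g' dm XB XB' : 0 < g -> 0 < g' -> 0 <= XB -> 0 <= XB' ->
  exists X0 X0', [/\ XB <= X0, XB' <= X0' & Z.abs (g * X0' - g' * X0 - dm) <= g + g'].
Proof.
move=> g0 g'0 h h'; pose Y := XB + g * XB' + g + Z.abs dm.
have p1 : 0 <= g * XB' by nia.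
have p2 : Y <= g' * Y by rewrite -{1}(Z.mul_1_l Y); apply: Z.mul_le_mono_nonneg_r; lia.
exists Y, ((dm + g' * Y) / g).
have := Z.div_mod (dm + g' * Y) g ltac:(lia).
have := Z.mod_pos_bound (dm + g' * Y) g g0.
set r := _ mod _; set d := _ / _ => r0 Er.
split; [lia| |lia].
have : g * XB' <= g * d by rewrite {1}/Y in p2; lia.
by move=> H; apply/(Z.mul_le_mono_pos_l _ _ _ g0).
Qed.

(** A point of the strip on the new level [Y], with level [v] in the other direction, has so large a
    sum of levels that its neighbours remain in the half strip. *)
Lemma apex_behind g g' d Ds lo Y v c : 0 < g -> 0 < g' -> 0 < d -> 0 <= Ds ->
  2 * g * Ds + d * Z.abs lo <= Y -> d * c = g * v - g' * Y -> lo <= c -> 2 * Ds <= Y + v.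
Proof.
move=> g0 g'0 d0 Ds0 hY E hc.
have p1 : - (d * Z.abs lo) <= d * c by nia.
have p2 : 0 <= g * Ds by nia.
have p3 : 0 <= d * Z.abs lo by nia.
have Y0 : 0 <= Y by lia.
have p4 : Y <= g * Y by nia.
have p5 : 0 <= g' * Y by nia.
have : g * (2 * Ds) <= g * (Y + v) by lia.
by move=> H; apply/(Z.mul_le_mono_pos_l _ _ _ g0).
Qed.

(** An apex kept near the middle of the strip has both levels growing with their sum, so that it
    passes any given point. *)
Lemma apex_advance g g' u v s0 dm Y Y' : 0 < g -> 0 < g' -> 0 <= s0 ->
  Y + Y' = s0 + ((g + g') * (Z.abs u + Z.abs v + 2) + Z.abs dm) ->
  Z.abs (g * Y' - g' * Y - dm) <= g + g' -> u < Y /\ v < Y'.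
Proof.
move=> g0 g'0 s00 E iY; set K := g + g' in E iY; set W := Z.abs u + Z.abs v + 2 in E.
have W0 : 0 <= W by rewrite /W; lia.
have K0 : 0 < K by rewrite /K; lia.
have KW : 0 <= K * W by apply: Z.mul_nonneg_nonneg; lia.
have p1 : K * W <= g * (K * W) by nia.
have p1' : K * W <= g' * (K * W) by nia.
have p2 : Z.abs dm <= g * Z.abs dm by nia.
have p2' : Z.abs dm <= g' * Z.abs dm by nia.
have p3 : 0 <= g * s0 by nia.
have p3' : 0 <= g' * s0 by nia.
have e1 : K * Y = g * (Y + Y') - (g * Y' - g' * Y) by rewrite /K; lia.
have e2 : K * Y' = g' * (Y + Y') + (g * Y' - g' * Y) by rewrite /K; lia.
rewrite E in e1 e2.
have q1 : K * (W - 1) <= K * Y by lia.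
have q2 : K * (W - 1) <= K * Y' by lia.
have := proj2 (Z.mul_le_mono_pos_l (W - 1) Y K K0) q1.
have := proj2 (Z.mul_le_mono_pos_l (W - 1) Y' K K0) q2.
by rewrite /W; lia.
Qed.

Lemma cramer_bound d z p p' u v U : 0 < d -> d * z = p * v - p' * u ->
  Z.abs u <= U -> Z.abs v <= U -> Z.abs z <= (Z.abs p + Z.abs p') * U.
Proof.
move=> d0 E hu hv.
have h1 : Z.abs (p * v) <= Z.abs p * U by rewrite Z.abs_mul; apply: Z.mul_le_mono_nonneg_l; lia.
have h2 : Z.abs (p' * u) <= Z.abs p' * U by rewrite Z.abs_mul; apply: Z.mul_le_mono_nonneg_l; lia.
have h3 : Z.abs z <= Z.abs (d * z) by rewrite Z.abs_mul; nia.
lia.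
Qed.

(** * Spreading invariance along half strips *)

Section HalfStrips.
Variables (A : finType) (n : nat).
Notation cfg := (Z -> Z -> A).
Notation C := ('I_n * 'I_3)%type.
Notation N := (Nper A n).
Variables (eta : cfg) (k : nat) (T : {set C}).
Hypothesis gT : generating eta k T.
Notation X := (in_hull eta).
Variables (w1 w2 : Z).

Definition inv_at (h : cfg) (x y : Z) := h (x + w1) (y + w2) = h x y.

Lemma inv_at_vertex h q x y : X h -> q \in T -> convex (T :\ q) ->
  (forall i, i \in T -> i != q -> inv_at h (x + (cx i - cx q)) (y + (cy i - cy q))) -> inv_at h x y.
Proof.
move=> Xh qT cq H.
have := @vertex_rule _ _ _ _ _ gT q (shiftc w1 w2 h) h (x - cx q) (y - cy q) (x - cx q) (y - cy q)
  qT cq (in_hull_shift _ _ Xh) Xh.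
rewrite /shiftc !Z.sub_add; apply => i iT iq.
have := H i iT iq; rewrite /inv_at.
have -> : x + (cx i - cx q) = x - cx q + cx i by lia.
by have -> : y + (cy i - cy q) = y - cy q + cy i by lia.
Qed.

Lemma lev_bound a b dx dy E : Z.abs dx <= E -> Z.abs dy <= E ->
  Z.abs (lev a b dx dy) <= (Z.abs a + Z.abs b) * E.
Proof. by rewrite /lev; nia. Qed.

(** As the face spans all rows of [T], a window placed with its lower end [e] near the lower border,
    or its upper end [q] near the upper one, does not leave the strip. Here the height serves both
    as [psi'] and as [chi]. *)
Theorem single_strip a b M X0 Y0 m : prim a b -> 0 < b -> front eta a b w1 w2 ->
  max_face T a b M X0 Y0 m -> (0 < m)%N ->
  (forall i, i \in T -> Y0 <= cy i <= Y0 + (Z.of_nat m - 1) * b) ->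
  exists H0, forall H, H0 <= H -> exists L, forall h, X h ->
    (forall x y, Z.abs x <= L -> 0 <= y <= H -> inv_at h x y) ->
    forall x y, 0 <= x -> 0 <= y <= H -> inv_at h x y.
Proof.
move=> ab b0 [D D0 fr] mf m0 rng.
have [e eT [ex ey]] : in_cells T (X0 + 0 * a) (Y0 + 0 * b) by apply: (mf_in mf); lia.
have [q qT [qx qy]] : in_cells T (X0 + (Z.of_nat m - 1) * a) (Y0 + (Z.of_nat m - 1) * b).
  by apply: (mf_in mf); lia.
have cq : convex (T :\ q) by apply: (face_vertex gT mf ab qT _ qx qy); right.
have ce : convex (T :\ e) by apply: (face_vertex gT mf ab eT _ ex ey); left.
have lw := mf_lev mf.
pose E := D + Z.of_nat n + 3; pose Ds := (Z.abs a + Z.abs b) * E.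
have Ds1 : E <= Ds by rewrite /Ds /E; nia.
(* The height [3 * Ds] separates the border zones; the box contains the [Ds] levels of the strip
   below [- |a| * H], from which the induction starts. *)
exists (3 * Ds) => H HH; exists (2 * Z.abs a * H + Ds) => h Xh box x y x0 yH.
pose chi (_ y : Z) := y.
have fc i : i \in T -> lev a b (cx i) (cy i) < M \/ lev a b (cx i) (cy i) = M /\
    (cy i = cy q -> i = q) /\ (cy i = cy e -> i = e).
  move=> iT; have [lM|lM] : lev a b (cx i) (cy i) < M \/ lev a b (cx i) (cy i) = M by have := mf_le
    mf iT; lia.
    by left.
  right; split => //; have [j jm [jx jy]] := mf_eq mf iT lM.
  by split=> H'; apply: cell_inj => //; nia.
have lev_add x1 y1 dx dy : lev a b (x1 + dx) (y1 + dy) = lev a b x1 y1 + lev a b dx dy by exact: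
  levD.
suff main : forall l, - Z.abs a * H - Ds <= l -> forall x y, lev a b x y = l -> 0 <= y <= H ->
  inv_at h x y.
  by apply: (main (lev a b x y)) => //; rewrite /lev; nia.
apply: Z_ind_up => l l0 IH {}x {}y lxy {}yH {x0}.
have [small|large] : l < - Z.abs a * H \/ - Z.abs a * H <= l by lia.
  by apply: box => //; move: lxy; rewrite /lev; nia.
have := @add_level n T (inv_at h) q e D E Ds (lev a b) chi chi lev_add (fun _ _ _ _ => erefl) (fun
  _ _ _ _ => erefl).
move=> AL; apply: (AL _ _ _ _ _ _ _ _ _ _ _ l (H + 1) 0) => //; rewrite /chi; try lia.
- by move=> x' y'; exact: inv_at_vertex.
- by move=> x' y'; exact: inv_at_vertex.
- by move=> x' y' Hf; apply: (fr h Xh) => dx dy hx hy hd; exact: Hf.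
- move=> i iT iq; have := rng i iT; have [l1|[l1 [l2 _]]] := fc i iT.
    by left; move: l1; rewrite qx qy -lw /lev; lia.
  right; split; first by move: l1; rewrite qx qy -lw /lev; lia.
  have : cy i <> cy q by move=> /l2 iq'; case/eqP: iq.
  lia.
- by move=> i iT; have := rng i iT; lia.
- move=> i iT ie; have := rng i iT; have [l1|[l1 [_ l2]]] := fc i iT.
    by left; move: l1; rewrite ex ey -lw /lev; lia.
  right; split; first by move: l1; rewrite ex ey -lw /lev; lia.
  have : cy i <> cy e by move=> /l2 ie'; case/eqP: ie.
  lia.
- by move=> i iT; have := rng i iT; lia.
- move=> x' y' dx dy lx' yH' y0' hx hy hd yd yd'; apply: (IH (lev a b (x' + dx) (y' + dy))) => //;
  last by lia.
  by rewrite levD lx'; have := lev_bound (a := a) (b := b) hx hy; rewrite -/Ds; lia.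
Qed.

Section Corner.
Variables (a b a' b' : Z) (chi : Z -> Z -> Z) (g g' : Z) (q e e' : C).
Notation del := (b' * a - a' * b).
Notation off i j f := (f (cx i - cx j) (cy i - cy j)).

(* The maximal faces of [T] for [lev a b] (from [e] to [q]) and [lev a' b'] (from [q] to [e'])
   meet at [q]; along both, from [e] to [e'], the transversal functional [chi] increases. *)
Record corner : Prop := Corner {
  co_g : 0 < g;
  co_g' : 0 < g';
  co_del : 0 < del;
  co_add : forall x y dx dy, chi (x + dx) (y + dy) = chi x y + chi dx dy;
  co_bound : forall dx dy E, Z.abs dx <= E -> Z.abs dy <= E ->
    Z.abs (chi dx dy) <= (Z.abs (chi 1 0) + Z.abs (chi 0 1)) * E;
  co_rel : forall x y, del * chi x y = g * lev a' b' x y - g' * lev a b x y;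
  co_q : [/\ q \in T, e \in T & e' \in T];
  co_vertex : [/\ convex (T :\ q), convex (T :\ e) & convex (T :\ e')];
  co_q1 : forall i, i \in T -> i != q -> off i q (lev a b) < 0 \/ off i q (lev a b) = 0 /\
    off i q chi < 0;
  co_q2 : forall i, i \in T -> i != q -> off i q (lev a' b') < 0 \/ off i q (lev a' b') = 0 /\
    0 < off i q chi;
  co_e : forall i, i \in T -> i != e -> off i e (lev a b) < 0 \/ off i e (lev a b) = 0 /\
    0 < off i e chi;
  co_e' : forall i, i \in T -> i != e' -> off i e' (lev a' b') < 0 \/ off i e' (lev a' b') = 0 /\
    off i e' chi < 0;
  co_min : forall i, i \in T -> 0 <= off i e chi;
  co_max : forall i, i \in T -> off i e' chi <= 0 }.

(** The wedge [lev a b < Y], [lev a' b' < Y'] in the strip grows by one level at a time. Its apex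
    has transversal coordinate [(g * Y' - g' * Y) / del]; advancing the side that moves the apex
    back towards [mid] keeps it near the middle. Each added piece of a level then runs from there to
    one border of the strip, as [add_level] requires. *)
Theorem corner_strip : corner -> front eta a b w1 w2 -> front eta a' b' w1 w2 ->
  exists H0, forall lo hi, H0 <= hi - lo -> exists L, forall h, X h ->
    (forall x y, Z.abs x <= L -> Z.abs y <= L -> lo <= chi x y <= hi -> inv_at h x y) ->
    forall x y, lo <= chi x y <= hi -> 0 <= lev a b x y + lev a' b' x y -> inv_at h x y.
Proof.
move=> [g0 g'0 del0 chiD chiB rel [qT eT e'T] [cq ce ce'] q1 q2 e1 e2 emin emax] [D1 D10 fr1]
  [D2 D20 fr2].
pose D := Z.max D1 D2; pose E := D + Z.of_nat n + 3.
pose S := Z.abs a + Z.abs b + Z.abs a' + Z.abs b' + Z.abs (chi 1 0) + Z.abs (chi 0 1).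
pose Ds := S * E.
have E0 : 0 < E by rewrite /E /D; lia.
have b1 dx dy : Z.abs dx <= E -> Z.abs dy <= E -> Z.abs (lev a b dx dy) <= Ds.
  by move=> hx hy; apply: Z.le_trans (lev_bound hx hy) _; apply: Z.mul_le_mono_nonneg_r;
    rewrite /S; lia.
have b2 dx dy : Z.abs dx <= E -> Z.abs dy <= E -> Z.abs (lev a' b' dx dy) <= Ds.
  by move=> hx hy; apply: Z.le_trans (lev_bound hx hy) _; apply: Z.mul_le_mono_nonneg_r;
    rewrite /S; lia.
have b3 dx dy : Z.abs dx <= E -> Z.abs dy <= E -> Z.abs (chi dx dy) <= Ds.
  by move=> hx hy; apply: Z.le_trans (chiB _ _ _ hx hy) _; apply: Z.mul_le_mono_nonneg_r;
    rewrite /S; lia.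
have Ds0 : 0 <= Ds by apply: Z.mul_nonneg_nonneg; rewrite /S; lia.
have psiD x1 y1 dx dy : lev a b (x1 + dx) (y1 + dy) = lev a b x1 y1 + lev a b dx dy by exact: levD.
have psi'D x1 y1 dx dy : lev a' b' (x1 + dx) (y1 + dy) = lev a' b' x1 y1 + lev a' b' dx dy by
  exact: levD.
clearbody Ds; clear S.
(* The distance of the middle from the borders: [2 * Ds] for the border zone, the rest for the
   deviation of the apex and for the points within [Ds] of the other side of the wedge. *)
pose G := 2 * Ds + (g + g') * (1 + Ds).
have q1' i : i \in T -> off i q (lev a b) <= 0.
  move=> iT; have [->|iq] := eqVneq i q; first by rewrite !Z.sub_diag /lev; lia.
  by have [|[]] := q1 i iT iq; lia.
have q2' i : i \in T -> off i q (lev a' b') <= 0.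
  move=> iT; have [->|iq] := eqVneq i q; first by rewrite !Z.sub_diag /lev; lia.
  by have [|[]] := q2 i iT iq; lia.
exists (2 * G + 2) => lo hi Hlo.
pose mid := lo + G; move: (erefl mid); rewrite {2}/mid; move: mid => mid Emid.
(* The bounds required by [apex_behind] for the two sides. *)
pose XB := 2 * g * Ds + del * Z.abs lo; pose XB' := 2 * g' * Ds + del * Z.abs hi.
have XB0 : 0 <= XB.
  by rewrite /XB; have := Z.mul_nonneg_nonneg del (Z.abs lo) ltac:(lia) ltac:(lia);
    have := Z.mul_nonneg_nonneg g Ds ltac:(lia) Ds0; lia.
have XB'0 : 0 <= XB'.
  by rewrite /XB'; have := Z.mul_nonneg_nonneg del (Z.abs hi) ltac:(lia) ltac:(lia);
    have := Z.mul_nonneg_nonneg g' Ds ltac:(lia) Ds0; lia.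
have gDs : 0 <= g * Ds by apply: Z.mul_nonneg_nonneg; lia.
have g'Ds : 0 <= g' * Ds by apply: Z.mul_nonneg_nonneg; lia.
pose inv Y Y' := Z.abs (g * Y' - g' * Y - del * mid) <= g + g'.
have [X0 [X0' [hX0 hX0' inv0]]] : exists X0 X0', [/\ XB <= X0, XB' <= X0' & inv X0 X0'].
  exact: apex_ex.
exists ((Z.abs a + Z.abs a' + Z.abs b + Z.abs b') * (X0 + X0')) => h Xh box.
pose St Y Y' := forall x y, lev a b x y < Y -> lev a' b' x y < Y' -> lo <= chi x y <= hi ->
  0 <= lev a b x y + lev a' b' x y -> inv_at h x y.
have X00 : 0 <= X0 by clear - hX0 XB0; lia.
have X0'0 : 0 <= X0' by clear - hX0' XB'0; lia.
have XX0 : 0 <= X0 + X0' by clear - X00 X0'0; lia.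
have St0 : St X0 X0'.
  move=> x y l1 l2 lc l0; have ex : del * x = a * lev a' b' x y - a' * lev a b x y by clear;
    rewrite /lev; lia.
  have ey : del * y = b * lev a' b' x y - b' * lev a b x y by clear; rewrite /lev; lia.
  have u1 : Z.abs (lev a b x y) <= X0 + X0' by clear - l1 l2 l0 X00 X0'0; lia.
  have u2 : Z.abs (lev a' b' x y) <= X0 + X0' by clear - l1 l2 l0 X00 X0'0; lia.
  apply: box => //.
    apply: Z.le_trans (cramer_bound del0 ex u1 u2) _.
    by apply: Z.mul_le_mono_nonneg_r => //; clear; lia.
  apply: Z.le_trans (cramer_bound del0 ey u1 u2) _.
  by apply: Z.mul_le_mono_nonneg_r => //; clear; lia.
have stepL Y Y' : XB <= Y -> XB' <= Y' -> inv Y Y' -> St Y Y' -> St (Y + 1) Y'.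
  rewrite /inv => hY hY' hi' hSt x y l1 l2 lc l0.
  have [l1'|l1'] : lev a b x y < Y \/ lev a b x y = Y by lia.
    exact: hSt.
  have AL := @add_level n T (inv_at h) q e D E Ds (lev a b) (lev a' b') chi psiD psi'D chiD.
  apply: (AL _ _ _ _ _ _ _ _ _ _ _ Y Y' lo) => //; rewrite ?/E; try lia.
  - by move=> x' y'; exact: inv_at_vertex.
  - by move=> x' y'; exact: inv_at_vertex.
  - by move=> x' y' Hf; apply: (fr1 h Xh) => dx dy hx hy hd; apply: Hf => //; rewrite /D; lia.
  - move=> x' y' dx dy ly ly' lc' hx hy hd hd' hc'.
    have c1 := b1 _ _ hx hy; have c2 := b2 _ _ hx hy; have c3 := b3 _ _ hx hy.
    have r' := rel x' y'; rewrite (psi'D x') in hd'; rewrite (chiD x') in hc'.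
    apply: hSt; rewrite ?(psiD x') ?(psi'D x') ?(chiD x'); try lia.
    + split; first exact: hc'.
      have : chi x' y' <= mid + (g + g').
        apply: (scaled_le del0); first lia.
        have := Z.mul_le_mono_nonneg_l (lev a' b' x' y') Y' g ltac:(lia) ltac:(lia);
          rewrite ly in r'; lia.
      by rewrite /G in Emid Hlo; lia.
    + rewrite ly in r'; have := apex_behind g0 g'0 del0 Ds0 hY r' lc'; lia.
  - move=> x' y' ly lc' ly'; have r' := rel x' y'; rewrite ly in r'.
    have := Z.mul_le_mono_nonneg_l (Y' - Ds) (lev a' b' x' y') g ltac:(lia) ltac:(lia) => p.
    have := @scaled_le del (g + g' + g * Ds) mid (chi x' y') del0 ltac:(lia) ltac:(lia).
    rewrite /G in Emid; lia.
have stepU Y Y' : XB <= Y -> XB' <= Y' -> inv Y Y' -> St Y Y' -> St Y (Y' + 1).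
  rewrite /inv => hY hY' hi' hSt x y l1 l2 lc l0.
  have [l2'|l2'] : lev a' b' x y < Y' \/ lev a' b' x y = Y' by lia.
    exact: hSt.
  have chiN x1 y1 dx dy : - chi (x1 + dx) (y1 + dy) = - chi x1 y1 + - chi dx dy by rewrite chiD;
    lia.
  have AL := @add_level n T (inv_at h) q e' D E Ds (lev a' b') (lev a b) (fun x y => - chi x y)
    psi'D psiD chiN.
  apply: (AL _ _ _ _ _ _ _ _ _ _ _ Y' Y (- hi)) => //; rewrite ?/E; try lia.
  - by move=> dx dy hx hy; have := b3 _ _ hx hy; lia.
  - by move=> x' y'; exact: inv_at_vertex.
  - by move=> x' y'; exact: inv_at_vertex.
  - by move=> x' y' Hf; apply: (fr2 h Xh) => dx dy hx hy hd; apply: Hf => //; rewrite /D; lia.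
  - by move=> i iT iq; have [?|[? ?]] := q2 i iT iq; [left|right; split; lia].
  - by move=> i iT iq; have [?|[? ?]] := e2 i iT iq; [left|right; split; lia].
  - by move=> i iT; have := emax i iT; lia.
  - move=> x' y' dx dy ly ly' lc' hx hy hd hd' hc'.
    have c1 := b1 _ _ hx hy; have c2 := b2 _ _ hx hy; have c3 := b3 _ _ hx hy.
    have r' := rel x' y'; rewrite (psiD x') in hd'; rewrite (chiD x') in hc'.
    apply: hSt; rewrite ?(psiD x') ?(psi'D x') ?(chiD x'); try lia.
    + split; last by clear - hc'; lia.
      have : mid <= chi x' y' + (g + g').
        apply: (scaled_le del0); first lia.
        have := Z.mul_le_mono_nonneg_l (lev a b x' y') Y g' ltac:(lia) ltac:(lia);
          rewrite ly in r'; lia.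
      by rewrite /G in Emid Hlo; lia.
    + rewrite ly in r'; have r'' : del * - chi x' y' = g' * lev a b x' y' - g * Y' by lia.
      have hY'' : 2 * g' * Ds + del * Z.abs (- hi) <= Y' by rewrite Z.abs_opp.
      have := apex_behind g'0 g0 del0 Ds0 hY'' r'' lc'; lia.
  - move=> x' y' ly lc' ly'; have r' := rel x' y'; rewrite ly in r'.
    have := Z.mul_le_mono_nonneg_l (Y - Ds) (lev a b x' y') g' ltac:(lia) ltac:(lia) => p.
    have := @scaled_le del (g + g' + g' * Ds) (chi x' y') mid del0 ltac:(lia) ltac:(lia).
    rewrite /G in Emid Hlo; lia.
have ind (s : nat) : exists Y Y', [/\ Y + Y' = X0 + X0' + Z.of_nat s, XB <= Y, XB' <= Y',
  inv Y Y' & St Y Y'].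
  elim: s => [|s [Y [Y' [sY hY hY' iY sSt]]]]; first by exists X0, X0'; split => //; lia.
  have [c|c] : del * mid <= g * Y' - g' * Y \/ g * Y' - g' * Y < del * mid by lia.
    exists (Y + 1), Y'; split => //; try lia; last exact: stepL.
    by move: iY; rewrite /inv; lia.
  exists Y, (Y' + 1); split => //; try lia; last exact: stepU.
  by move: iY; rewrite /inv; lia.
move=> x y lc l0.
pose u := lev a b x y; pose v := lev a' b' x y.
have Kuv : 0 <= (g + g') * (Z.abs u + Z.abs v + 2) by apply: Z.mul_nonneg_nonneg; lia.
have [Y [Y' [sY hY hY' iY sSt]]] := ind (Z.to_nat ((g + g') * (Z.abs u + Z.abs v + 2) + Z.abs (del
  * mid))).
have [uY vY'] : u < Y /\ v < Y'.
  apply: (apex_advance g0 g'0 XX0 _ iY); rewrite sY Z2Nat.id //.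
  by apply: Z.add_nonneg_nonneg => //; exact: Z.abs_nonneg.
exact: sSt.
Qed.

End Corner.
End HalfStrips.

(** * Two nonhorizontal directions *)

Section TwoDirections.
Variables (A : finType) (n : nat).
Notation cfg := (Z -> Z -> A).
Notation C := ('I_n * 'I_3)%type.
Notation N := (Nper A n).

Lemma in_hull_periodic (eta h : cfg) u v : in_hull eta h -> periodic u v eta -> periodic u v h.
Proof.
move=> Xh per x y; have [s [t E]] := Xh (Z.abs x + Z.abs y + Z.abs u + Z.abs v).
rewrite !E; try lia; rewrite -[RHS]per; congr eta; lia.
Qed.

Lemma periodic_shift (h : cfg) u v s t : periodic u v (shiftc s t h) -> periodic u v h.
Proof.
move=> per x y; have := per (x - s) (y - t); rewrite /shiftc !Z.sub_add => <-; congr h; lia.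
Qed.

(** A period across the line carries the difference at the origin into the strip of agreement. *)
Lemma periodic_not_nd (eta : cfg) u v a b : periodic u v eta -> lev a b u v <> 0 -> ~ nd eta a b.
Proof.
move=> per l0 H; have [h [h' [Xh Xh' agr ne]]] := H (Z.abs (lev a b u v)).
have ph := in_hull_periodic Xh per; have ph' := in_hull_periodic Xh' per.
apply: ne; have [l1|l1] : lev a b u v < 0 \/ 0 < lev a b u v by lia.
  rewrite -ph -(ph' 0) !Z.add_0_l; apply: agr; lia.
have := ph (- u) (- v); have := ph' (- u) (- v); rewrite !Z.add_opp_diag_l => -> ->.
by apply: agr; move: l1; rewrite /lev; lia.
Qed.

Lemma prefl_nd (eta : cfg) a b : nd eta a b -> nd (yrefl (xrefl eta)) (- a) (- b).
Proof. by move=> /nd_xrefl/nd_yrefl. Qed.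

Lemma prefl_lc (eta : cfg) k : low_complexity n eta k -> low_complexity n (yrefl (xrefl eta)) k.
Proof. by move=> lc; exact/low_complexity_yrefl/low_complexity_xrefl. Qed.

Lemma strip_agree_right (eta : cfg) k a b (h h' : cfg) l0 x1 y1 : low_complexity n eta k ->
  prim a b -> 0 < b ->
  in_hull eta h -> in_hull eta h' ->
  (forall x y, l0 <= lev a b x y < l0 + lev_width n a b -> h x y = h' x y) ->
  l0 <= lev a b x1 y1 -> h x1 y1 <> h' x1 y1 -> periodic (N * a) (N * b) h.
Proof.
move=> lc ab b0 Xh Xh' agr l1; apply: contra_notP => nper.
have [T gT] := generating_ex lc; have [c [k0 rel]] := relation_ex gT.
move: {1 3}(lev a b x1 y1) l1 (erefl (lev a b x1 y1)) => l l1 El.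
move: l l1 x1 y1 El; apply: Z_ind_up => l l1 IH x1 y1 El.
have [lw|lw] : l < l0 + lev_width n a b \/ l0 + lev_width n a b <= l by lia.
  by apply: agr; lia.
apply: contrapT => ne; apply: nper; apply: (@periodic_shift _ _ _ x1 y1).
apply: (strip_periodic gT rel ab b0 (in_hull_shift x1 y1 Xh) (in_hull_shift x1 y1 Xh')).
  by move=> x y lxy; apply: (IH (lev a b (x + x1) (y + y1))) => //; rewrite levD; lia.
by rewrite /shiftc !Z.add_0_l.
Qed.

Lemma strip_agree_periodic (eta : cfg) k a b (h h' : cfg) l0 x1 y1 : low_complexity n eta k ->
  prim a b -> 0 < b ->
  in_hull eta h -> in_hull eta h' ->
  (forall x y, l0 <= lev a b x y < l0 + lev_width n a b -> h x y = h' x y) ->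
  h x1 y1 <> h' x1 y1 -> periodic (N * a) (N * b) h.
Proof.
move=> lc ab b0 Xh Xh' agr ne.
have [l1|l1] : l0 <= lev a b x1 y1 \/ lev a b x1 y1 < l0 by lia.
  exact: strip_agree_right lc ab b0 Xh Xh' agr l1 ne.
have per : periodic (N * a) (N * b) (yrefl (xrefl h)).
  apply: (@strip_agree_right (yrefl (xrefl eta)) k a b _ (yrefl (xrefl h')) (1 - l0 - lev_width n a
    b) (- x1) (- y1) (prefl_lc lc) ab b0).
  - exact/in_hull_yrefl/in_hull_xrefl.
  - exact/in_hull_yrefl/in_hull_xrefl.
  - by move=> x y l; apply: agr; move: l; rewrite /lev; lia.
  - have : 0 <= lev_width n a b by rewrite /lev_width; lia.
    by move: l1; rewrite /lev; lia.
  - by rewrite /yrefl /xrefl !Z.opp_involutive.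
move=> x y; have := per (- (x + N * a)) (- (y + N * b));
  rewrite /yrefl /xrefl !Z.opp_involutive => <-.
by congr h; lia.
Qed.

(** A single extreme point would be a vertex determined by the strip. In three rows, two extreme
    points are one or two steps apart, and a midpoint fills the second case. The sign [s] selects
    the side of [T]. *)
Lemma face_pair (eta : cfg) k (T : {set C}) a b s : generating eta k T -> prim a b -> 0 < b ->
  s = 1 \/ s = -1 ->
  nd eta (s * a) (s * b) ->
  exists x y, [/\ in_cells T x y, in_cells T (x + a) (y + b) &
    forall i, i \in T -> s * lev a b (cx i) (cy i) <= s * lev a b x y].
Proof.
move=> gT ab b0 s1 ndab; have [c [k0 rel]] := relation_ex gT.
have [h [h' [Xh Xh' agr ne]]] := ndab (lev_width n a b).
have [i0 i0T] := T_nonempty rel.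
have cT := gen_convex gT.
have [p pT pmax] := arg_max_cell (P := fun i => i \in T) (fun i => s * lev a b (cx i) (cy i)) i0T.
have [r rT [rp rl]] : exists2 r, r \in T & r <> p /\ lev a b (cx r) (cy r) = lev a b (cx p) (cy p).
  apply: contrapT => H; apply: ne.
  have lt i : i \in T -> i != p -> s * lev a b (cx i) (cy i) < s * lev a b (cx p) (cy p).
    move=> iT /eqP ip; have := pmax i iT.
    suff : lev a b (cx i) (cy i) <> lev a b (cx p) (cy p) by nia.
    by move=> e; apply: H; exists i.
  have cp : convex (T :\ p).
    apply: (@convex_lex _ T p (s * b) (- (s * a)) 0 0 cT) => i iT ip.
    by left; have := lt i iT ip; rewrite /flev /lev; lia.
  have := @vertex_rule _ _ _ _ _ gT p h h' (- cx p) (- cy p) (- cx p) (- cy p) pT cp Xh Xh'.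
  rewrite !Z.add_opp_diag_l; apply => i iT ip; apply: agr.
  have := lt i iT ip; have := @lev_widthP _ a b i p; have := @lev_widthP _ a b p i; rewrite /lev.
  by case: s1 => ->; lia.
have [t [tx ty]] : exists t, cx r - cx p = t * a /\ cy r - cy p = t * b.
  by apply: prim_col => //; move: rl; rewrite /lev; lia.
have t0 : t <> 0 by move=> t0; apply: rp; apply: cell_inj; lia.
have bp := cell_bounds p; have br := cell_bounds r.
have pC := in_cellsE pT; have rC := in_cellsE rT.
have res x y : in_cells T x y -> in_cells T (x + a) (y + b) ->
  lev a b x y = lev a b (cx p) (cy p) ->
    exists x y, [/\ in_cells T x y, in_cells T (x + a) (y + b) &
    forall i, i \in T -> s * lev a b (cx i) (cy i) <= s * lev a b x y].
  by move=> h1 h2 l; exists x, y; split => // i iT; rewrite l; exact: pmax.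
have [t1|[t1|[[t2 b1]|[t2 b1]]]] : t = 1 \/ t = -1 \/ (t = 2 /\ b = 1) \/ (t = -2 /\ b = 1) by nia.
- subst t; apply: (res _ _ pC) => //.
  by have -> : cx p + a = cx r; [lia|have -> : cy p + b = cy r by lia].
- subst t; apply: (res _ _ rC) => //.
  by have -> : cx r + a = cx p; [lia|have -> : cy r + b = cy p by lia].
- subst t b; have y0 : cy p = 0 by lia.
  have y2 : cy r = 2 by lia.
  have h0 := pC; have h2 := rC; rewrite y0 in h0; rewrite y2 in h2.
  apply: (res _ _ h0); last by rewrite y0.
  by apply: (in_cells_mid cT h0 h2); lia.
- subst t b; have y0 : cy r = 0 by lia.
  have y2 : cy p = 2 by lia.
  have h0 := rC; have h2 := pC; rewrite y0 in h0; rewrite y2 in h2.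
  apply: (res _ _ h0); last by rewrite -y0.
  by apply: (in_cells_mid cT h0 h2); lia.
Qed.

(* [T] is a lattice hexagon with sides in the directions [(1, 0)], [(s1, 1)], [(s2, 1)]. *)
Record hexagon (T : {set C}) (x0 m s1 s2 : Z) : Prop := Hexagon {
  hex_m : 1 <= m;
  hex_s : s1 < s2;
  hexP : forall x y, in_cells T x y <->
    [\/ y = 0 /\ x0 <= x < x0 + m, y = 1 /\ x0 + s1 <= x < x0 + s2 + m |
        y = 2 /\ x0 + s1 + s2 <= x < x0 + s1 + s2 + m] }.

(** By [nd_neg], both directions occur on both sides of [T]. On the right, the two edges have to
    follow each other within three rows, so each has height one, and the one with the larger
    horizontal step is the lower. On the left the order is reversed, and the rows are filled in
    between. *)
Lemma hexagon_ex (eta : cfg) k (T : {set C}) a1 b1 a2 b2 : low_complexity n eta k ->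
  generating eta k T ->
  prim a1 b1 -> prim a2 b2 -> 0 < b1 -> 0 < b2 -> (a1, b1) <> (a2, b2) -> nd eta a1 b1 ->
    nd eta a2 b2 ->
  exists x0 m s1 s2, hexagon T x0 m s1 s2 /\
    [/\ b1 = 1, b2 = 1 & (a1 = s1 /\ a2 = s2) \/ (a1 = s2 /\ a2 = s1)].
Proof.
move=> lc gT p1 p2 b10 b20 ne nd1 nd2; have cT := gen_convex gT.
have one_l a b : nd eta a b -> nd eta (1 * a) (1 * b) by rewrite !Z.mul_1_l.
have neg_l a b : prim a b -> 0 < b -> nd eta a b -> nd eta (-1 * a) (-1 * b).
  move=> ab b0 H; have -> : -1 * a = - a by lia.
  by have -> : -1 * b = - b; [lia|apply: (nd_neg lc) => //; lia].
have in_bounds x y : in_cells T x y -> 0 <= y <= 2.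
  by move=> [i iT [_ <-]]; have := cell_bounds i; lia.
have le_in s a b x y x' y' : in_cells T x' y' ->
    (forall i, i \in T -> s * lev a b (cx i) (cy i) <= s * lev a b x y) ->
      s * lev a b x' y' <= s * lev a b x y.
  by move=> [i iT [<- <-]]; exact.
have odd a b : prim a b -> b = 2 -> exists g, a = 2 * g + 1.
  move=> [p [q E]] b2'; have := Zeven.Z_modulo_2 a => -[[g ag]|[g ag]]; exists g => //.
  by subst b a; lia.
wlog [c1 [c2 [x [cc [h0 h1 h2 r1 r2] [ndc1 ndc2] ac]]]] : / exists c1 c2 x, [/\ c2 < c1,
    [/\ in_cells T x 0, in_cells T (x + c1) 1, in_cells T (x + c1 + c2) 2,
     (forall i, i \in T -> 1 * lev c1 1 (cx i) (cy i) <= 1 * lev c1 1 x 0) &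
     (forall i, i \in T -> 1 * lev c2 1 (cx i) (cy i) <= 1 * lev c2 1 (x + c1) 1)],
    nd eta c1 1 /\ nd eta c2 1 & [/\ b1 = 1, b2 = 1 & (a1 = c2 /\ a2 = c1) \/ (a1 = c1 /\
      a2 = c2)]].
  move=> H; apply: H.
  have [x [y [P0 P1 Pm]]] := face_pair gT p1 b10 (or_introl erefl) (one_l _ _ nd1).
  have [u [v [Q0 Q1 Qm]]] := face_pair gT p2 b20 (or_introl erefl) (one_l _ _ nd2).
  have y0 := in_bounds _ _ P0; have y1 := in_bounds _ _ P1.
  have v0 := in_bounds _ _ Q0; have v1 := in_bounds _ _ Q1.
  have PQ0 := le_in _ _ _ _ _ _ _ Q0 Pm; have PQ1 := le_in _ _ _ _ _ _ _ Q1 Pm.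
  have QP0 := le_in _ _ _ _ _ _ _ P0 Qm; have QP1 := le_in _ _ _ _ _ _ _ P1 Qm.
  have o1 := odd _ _ p1; have o2 := odd _ _ p2.
  have ne' : a1 <> a2 \/ b1 <> b2.
    by have [e|e] := Z.eq_dec a1 a2; [right => e'; apply: ne; rewrite e e'|left].
  have [[b11 b21 [[y0' v0']|[y0' v0']]]] : [/\ b1 = 1, b2 = 1 & (y = 0 /\ v = 1) \/ (y = 1 /\
    v = 0)].
    clear - PQ0 PQ1 QP0 QP1 o1 o2 ne' y0 y1 v0 v1 b10 b20; rewrite /lev in PQ0 PQ1 QP0 QP1.
    have yE : y = 0 \/ y = 1 by lia.
    have vE : v = 0 \/ v = 1 by lia.
    have [b1'|b1'] : b1 = 1 \/ b1 = 2 by lia.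
      have [b2'|b2'] : b2 = 1 \/ b2 = 2 by lia.
        by subst b1 b2; case: yE => ?; case: vE => ?; subst y v; split => //; lia.
      by have [g ag] := o2 b2'; subst b1 b2 a2; case: yE => ?; case: vE => ?; subst y v; split; lia.
    have [g ag] := o1 b1'; subst b1 a1.
    have [b2'|b2'] : b2 = 1 \/ b2 = 2 by lia.
      by subst b2; case: yE => ?; case: vE => ?; subst y v; split; lia.
    by have [g' ag'] := o2 b2'; subst b2 a2; case: yE => ?; case: vE => ?; subst y v; split; lia.
  - subst b1 b2 y v; have e : u = x + a1 by move: PQ0 PQ1 QP0 QP1; rewrite /lev; lia.
    subst u; exists a1, a2, x; split => //; last by split => //; right.
    move: PQ0 PQ1 QP0 QP1; rewrite /lev; lia.
  - subst b1 b2 y v; have e : x = u + a2 by move: PQ0 PQ1 QP0 QP1; rewrite /lev; lia.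
    subst x; exists a2, a1, u; split => //; last by split => //; left.
    move: PQ0 PQ1 QP0 QP1; rewrite /lev; lia.
have pc1 : prim c1 1 by exists 0, 1; lia.
have pc2 : prim c2 1 by exists 0, 1; lia.
have lt01 : 0 < 1 by [].
have [u [v [P0 P1 Pm]]] := face_pair gT pc2 lt01 (or_intror erefl) (neg_l _ _ pc2 lt01 ndc2).
have [u' [v' [Q0 Q1 Qm]]] := face_pair gT pc1 lt01 (or_intror erefl) (neg_l _ _ pc1 lt01 ndc1).
have v0 := in_bounds _ _ P0; have v1 := in_bounds _ _ P1.
have v'0 := in_bounds _ _ Q0; have v'1 := in_bounds _ _ Q1.
have PQ0 := le_in _ _ _ _ _ _ _ Q0 Pm; have PQ1 := le_in _ _ _ _ _ _ _ Q1 Pm.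
have QP0 := le_in _ _ _ _ _ _ _ P0 Qm; have QP1 := le_in _ _ _ _ _ _ _ P1 Qm.
have [vE v'E uE] : [/\ v = 0, v' = 1 & u' = u + c2].
  rewrite /lev in PQ0 PQ1 QP0 QP1.
  have vE : v = 0 \/ v = 1 by lia.
  have v'E : v' = 0 \/ v' = 1 by lia.
  by case: vE => ?; case: v'E => ?; subst v v'; split; lia.
subst v v' u'.
have ux : u <= x by have := le_in _ _ _ _ _ _ _ P0 r1; rewrite /lev; lia.
exists u, (x - u + 1), c2, c1; split => //; split => //; first by lia.
move=> a b; split.
  move=> ab; have := in_bounds _ _ ab.
  have := le_in _ _ _ _ _ _ _ ab r1; have := le_in _ _ _ _ _ _ _ ab r2.
  have := le_in _ _ _ _ _ _ _ ab Pm; have := le_in _ _ _ _ _ _ _ ab Qm.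
  rewrite /lev => ? ? ? ? b2'; have [?|[?|?]] : b = 0 \/ b = 1 \/ b = 2 by lia.
  1-3: subst b.
  - by constructor 1; lia.
  - by constructor 2; lia.
  - by constructor 3; lia.
case=> -[-> ab].
- by apply: (in_cells_row cT P0 h0); lia.
- by apply: (in_cells_row cT P1 h1); lia.
- by apply: (in_cells_row cT Q1 h2); lia.
Qed.

Lemma hexagon_of (eta : cfg) k (T : {set C}) s1 s2 : low_complexity n eta k -> generating eta k T ->
  s1 < s2 -> nd eta s1 1 -> nd eta s2 1 -> exists x0 m, hexagon T x0 m s1 s2.
Proof.
move=> lc gT ss nd1 nd2; have p s : prim s 1 by exists 0, 1; lia.
have ne : (s1, 1) <> (s2, 1) by move=> [e]; lia.
have [x0 [m [t1 [t2 [hx [_ _ st]]]]]] := hexagon_ex lc gT (p s1) (p s2) ltac:(lia) ltac:(lia) ne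
  nd1 nd2.
exists x0, m; have tt := hex_s hx.
by have [-> ->] : s1 = t1 /\ s2 = t2 by lia.
Qed.

End TwoDirections.

(** * A single nonhorizontal nondeterministic direction *)

Section Spreading.
Variables (A : finType) (n : nat).
Notation cfg := (Z -> Z -> A).
Notation C := ('I_n * 'I_3)%type.
Notation N := (Nper A n).

Lemma inv_at_shift w1 w2 (h : cfg) s t x y : inv_at w1 w2 (shiftc s t h) x y <-> inv_at w1 w2 h (x
  + s) (y + t).
Proof.
rewrite /inv_at /shiftc; have -> : x + w1 + s = x + s + w1 by lia.
by have -> : y + w2 + t = y + t + w2 by lia.
Qed.

(** The right boundary has a corner at row 1. The transversal functional is the height, so
    [corner_strip] fills a horizontal strip. *)
Lemma three_rows_corner (eta : cfg) k (T : {set C}) R0 R1 R2 : generating eta k T ->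
  in_cells T R0 0 -> in_cells T R1 1 -> in_cells T R2 2 ->
  (forall i, i \in T -> cx i <= (if cy i =? 0 then R0 else if cy i =? 1 then R1 else R2)) ->
  R2 - R1 < R1 - R0 ->
  exists q e e' : C, corner T (R1 - R0) 1 (R2 - R1) 1 (fun _ y => y) 1 1 q e e'.
Proof.
move=> gT [e eT [ex ey]] [q qT [qx qy]] [e' e'T [e'x e'y]] R lt; have cT := gen_convex gT.
have rw i : i \in T -> [\/ cy i = 0 /\ cx i <= R0, cy i = 1 /\ cx i <= R1 | cy i = 2 /\ cx i <= R2].
  move=> iT; have := R i iT; have := cell_bounds i.
  case: (Z.eqb_spec (cy i) 0) => [c0|c0]; first by constructor 1; lia.
  case: (Z.eqb_spec (cy i) 1) => [c1|c1]; first by constructor 2; lia.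
  by constructor 3; lia.
have ne (i j : C) : i != j -> cx i = cx j -> cy i = cy j -> False.
  by move=> /eqP ij h1 h2; apply: ij; apply: cell_inj.
have nE i : i != e -> cx i <> R0 \/ cy i <> 0.
  by move=> ie; have := ne i e ie; lia.
have nQ i : i != q -> cx i <> R1 \/ cy i <> 1.
  by move=> ie; have := ne i q ie; lia.
have nE' i : i != e' -> cx i <> R2 \/ cy i <> 2.
  by move=> ie; have := ne i e' ie; lia.
exists q, e, e'; split => //; try lia.
- by move=> x y; rewrite /lev; lia.
- split.
  + apply: (@convex_lex _ T q 1 (R0 - R1) 0 1 cT) => i iT iq; rewrite /flev.
    by have := nQ i iq; case: (rw i iT) => -[? ?]; nia.
  + apply: (@convex_lex _ T e 1 (R0 - R1) 0 (-1) cT) => i iT ie; rewrite /flev.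
    by have := nE i ie; case: (rw i iT) => -[? ?]; nia.
  + apply: (@convex_lex _ T e' 1 (R1 - R2) 0 1 cT) => i iT ie; rewrite /flev.
    by have := nE' i ie; case: (rw i iT) => -[? ?]; nia.
- by move=> i iT iq; rewrite /lev; have := nQ i iq; case: (rw i iT) => -[? ?]; nia.
- by move=> i iT iq; rewrite /lev; have := nQ i iq; case: (rw i iT) => -[? ?]; nia.
- by move=> i iT iq; rewrite /lev; have := nE i iq; case: (rw i iT) => -[? ?]; nia.
- by move=> i iT iq; rewrite /lev; have := nE' i iq; case: (rw i iT) => -[? ?]; nia.
- by move=> i iT; case: (rw i iT) => -[? ?]; lia.
- by move=> i iT; case: (rw i iT) => -[? ?]; lia.
Qed.

Lemma row_max (T : {set C}) r i0 : i0 \in T -> cy i0 = r ->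
  exists2 R, in_cells T R r & forall i, i \in T -> cy i = r -> cx i <= R.
Proof.
move=> i0T i0r.
have P0 : (i0 \in T) && (cy i0 =? r) by rewrite i0T i0r Z.eqb_refl.
have [i /andP[iT /Z.eqb_eq ir] mi] := arg_max_cell (P := fun i => (i \in T) && (cy i =? r)) (fun i
  => cx i) P0.
exists (cx i); first by exists i.
by move=> j jT jr; apply: mi; rewrite jT jr Z.eqb_refl.
Qed.

Definition unique_nd (eta : cfg) a b := forall a' b', prim a' b' -> 0 < b' -> nd eta a' b' ->
  a' = a /\ b' = b.

Lemma corner_spread (eta : cfg) k (T : {set C}) R0 R1 R2 w1 w2 : generating eta k T ->
  in_cells T R0 0 -> in_cells T R1 1 -> in_cells T R2 2 ->
  (forall i, i \in T -> cx i <= (if cy i =? 0 then R0 else if cy i =? 1 then R1 else R2)) ->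
  R2 - R1 < R1 - R0 -> front eta (R1 - R0) 1 w1 w2 -> front eta (R2 - R1) 1 w1 w2 ->
  exists H0, forall H, H0 <= H -> exists L, forall h, in_hull eta h ->
    (forall x y, Z.abs x <= L -> 0 <= y <= H -> inv_at w1 w2 h x y) ->
    forall x y, 0 <= x -> 0 <= y <= H -> inv_at w1 w2 h x y.
Proof.
move=> gT c0 c1 c2 R lt f1 f2; have [q [e [e' co]]] := three_rows_corner gT c0 c1 c2 R lt.
have [H0 HS] := corner_strip gT co f1 f2.
exists (Z.max 0 H0) => H HH; have [L HL] := HS 0 H ltac:(lia).
(* A horizontal translation by [K] puts all points with [0 <= x] beyond the oblique end of the half
   strip. *)
pose K := (Z.abs (R1 - R0) + Z.abs (R2 - R1)) * H.
exists (L + K) => h Xh box x y x0 yH.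
have K0 : 0 <= K by rewrite /K; nia.
suff : inv_at w1 w2 (shiftc (- K) 0 h) (x + K) y.
  by move/inv_at_shift; rewrite Z.add_opp_r Z.add_simpl_r Z.add_0_r.
apply: HL => //; first exact: in_hull_shift.
  by move=> x' y' hx hy hc; apply/inv_at_shift; apply: box; lia.
move: K0; rewrite /lev /K.
have := Z.mul_le_mono_nonneg_l y H (Z.abs (R1 - R0)) ltac:(lia) ltac:(lia).
have := Z.mul_le_mono_nonneg_l y H (Z.abs (R2 - R1)) ltac:(lia) ltac:(lia).
have := Z.mul_le_mono_nonneg_r (R1 - R0) (Z.abs (R1 - R0)) y ltac:(lia) ltac:(lia).
have := Z.mul_le_mono_nonneg_r (R2 - R1) (Z.abs (R2 - R1)) y ltac:(lia) ltac:(lia).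
move: (Z.abs (R1 - R0)) (Z.abs (R2 - R1)) => u v; clear - x0 yH; lia.
Qed.

(** Either the face spans all rows of [T], or it has two points in adjacent rows and the third row
    ends strictly before its line. The edge to that third row then has another direction,
    deterministic by uniqueness, so that both edges at the corner are fronts. *)
Lemma right_spread (eta : cfg) k a b : low_complexity n eta k -> prim a b -> 0 < b ->
  nd eta a b -> unique_nd eta a b ->
  exists H0, forall H, H0 <= H -> exists L, forall h, in_hull eta h ->
    (forall x y, Z.abs x <= L -> 0 <= y <= H -> inv_at (N * a) (N * b) h x y) ->
    forall x y, 0 <= x -> 0 <= y <= H -> inv_at (N * a) (N * b) h x y.
Proof.
move=> lc ab b0 ndab uq; have [T gT] := generating_ex lc; have [c [k0 rel]] := relation_ex gT.
have cT := gen_convex gT; have [i0 i0T] := T_nonempty rel.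
have [M [X0 [Y0 [m [mf m3 Y00 mb]]]]] := max_face_ex cT ab b0 i0T.
have m0 : (0 < m)%N by lia.
have [h [h' [Xh Xh' agr ne]]] := ndab (lev_width n a b).
have m1 := max_face_ge2 gT mf ab m0 Xh Xh' agr ne.
have fr := front_parallel lc ab.
have [rng|] := pselect (forall i, i \in T -> Y0 <= cy i <= Y0 + (Z.of_nat m - 1) * b).
  exact: (single_strip gT ab b0 fr mf m0 rng).
move=> /existsNP[i1 /not_implyP[i1T out]].
have bi1 := cell_bounds i1.
have b1 : b = 1 by nia.
subst b; have m2 : m = 2%N by lia.
subst m; have w0 : in_cells T (X0 + 0 * a) (Y0 + 0 * 1) by apply: (mf_in mf).
have w1 : in_cells T (X0 + 1 * a) (Y0 + 1 * 1) by apply: (mf_in mf).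
have lw := mf_lev mf.
have ex0 : X0 + 0 * a = X0 by lia.
have ex1 : X0 + 1 * a = X0 + a by lia.
rewrite ex0 in w0; rewrite ex1 in w1.
have [R Rc Rm] := row_max i1T erefl.
have [r rT [rx ry]] := Rc.
have ltM : lev a 1 R (cy i1) < M.
  have : lev a 1 R (cy i1) <> M.
    rewrite -rx -ry => /(mf_eq mf rT)[j j2 [_ jy]]; rewrite ry in jy; lia.
  by have := mf_le mf rT; rewrite rx ry; lia.
have front' c1 : c1 <> a -> front eta c1 1 (N * a) (N * 1).
  move=> ca; apply: front_not_nd => H; have pc : prim c1 1 by exists 0, 1; lia.
  by have [] := uq _ _ pc ltac:(lia) H.
have [Y0'|Y0'] : Y0 = 0 \/ Y0 = 1 by lia.
- subst Y0; have y2 : cy i1 = 2 by lia.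
  rewrite y2 in Rc Rm ltM; rewrite /lev in ltM lw.
  have aE : X0 + a - X0 = a by lia.
  apply: (corner_spread gT w0 w1 Rc); rewrite ?aE //; last by apply: front'; lia.
    move=> i iT; have := mf_le mf iT; have := Rm i iT; have := cell_bounds i.
    case: (Z.eqb_spec (cy i) 0) => [e0|e0]; first by rewrite e0 /lev; lia.
    case: (Z.eqb_spec (cy i) 1) => [e1|e1]; first by rewrite e1 /lev; lia.
    by move=> ? h2 _; apply: h2; lia.
  by lia.
- subst Y0; have y2 : cy i1 = 0 by lia.
  rewrite y2 in Rc Rm ltM; rewrite /lev in ltM lw.
  have aE : X0 + a - X0 = a by lia.
  apply: (corner_spread gT Rc w0 w1); rewrite ?aE //; last by apply: front'; lia.
    move=> i iT; have := mf_le mf iT; have := Rm i iT; have := cell_bounds i.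
    case: (Z.eqb_spec (cy i) 0) => [e0|e0]; first by move=> ? h2 _; apply: h2.
    case: (Z.eqb_spec (cy i) 1) => [e1|e1]; first by rewrite e1 /lev; lia.
    by move=> ? _; have -> : cy i = 2; [lia|rewrite /lev; lia].
  by lia.
Qed.

Lemma row_spread (eta : cfg) k a b : low_complexity n eta k -> prim a b -> 0 < b ->
  nd eta a b -> unique_nd eta a b ->
  exists H0, forall H, H0 <= H -> exists L, forall h, in_hull eta h ->
    (forall x y, Z.abs x <= L -> 0 <= y <= H -> inv_at (N * a) (N * b) h x y) ->
    forall x y, 0 <= y <= H -> inv_at (N * a) (N * b) h x y.
Proof.
move=> lc ab b0 ndab uq; have [H1 R1] := right_spread lc ab b0 ndab uq.
have pN a1 b1 : prim a1 b1 -> prim (- a1) b1.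
  by move=> [p [q E]]; exists (- p), q; lia.
have ndx (et : cfg) a1 b1 : low_complexity n et k -> prim a1 b1 -> 0 < b1 -> nd et a1 b1 ->
  nd (xrefl et) (- a1) b1.
  move=> lc' p1 b10 H; have /nd_xrefl := nd_neg lc' p1 ltac:(lia) H.
  by rewrite Z.opp_involutive.
have uq' : unique_nd (xrefl eta) (- a) b.
  move=> a' b' p' b'0 H; have := ndx _ _ _ (low_complexity_xrefl lc) p' b'0 H.
  by rewrite xreflK => /(uq _ _ (pN _ _ p') b'0); lia.
have [H2 R2] := right_spread (low_complexity_xrefl lc) (pN _ _ ab) b0 (ndx _ _ _ lc ab b0 ndab) uq'.
exists (Z.max H1 H2) => H HH; have [L1 S1] := R1 H ltac:(lia); have [L2 S2] := R2 H ltac:(lia).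
exists (Z.max L1 L2) => h Xh box x y yH.
have [x0|x0] : 0 <= x \/ 0 <= - x by lia.
  by apply: S1 => // x' y' hx hy; apply: box => //; lia.
have := S2 (xrefl h) (in_hull_xrefl Xh) _ (- x) y x0 yH.
rewrite /inv_at /xrefl Z.opp_involutive => <-; first by congr h; lia.
move=> x' y' hx hy; have := box (- x') y' ltac:(lia) hy; rewrite /inv_at => <-; congr h; lia.
Qed.

(** A translate of [eta] agrees on some [k - 1] rows with its own translate by [N * (a, b)]. If the
    two differed elsewhere, [eta] would be horizontally periodic, against [(a, b)]; so they
    coincide, and this period excludes the horizontal directions. *)
Theorem unique_nd_not_horizontal (eta : cfg) k a b : low_complexity n eta k -> prim a b -> 0 < b ->
  nd eta a b -> unique_nd eta a b -> ~ nd eta 1 0 /\ ~ nd eta (-1) 0.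
Proof.
move=> lc ab b0 ndab uq; have [T gT] := generating_ex lc; have [c [k0 rel]] := relation_ex gT.
have N0 := Nper_gt0 A n; have k3 := lc_k3 lc.
have [H0 R] := row_spread lc ab b0 ndab uq.
have [L S] := R (Z.max 2 H0) ltac:(lia).
have [f [f' [Xf Xf' agr ne]]] := ndab (lev_width n a b).
have fper := strip_periodic gT rel ab b0 Xf Xf' agr ne.
have [u [v E]] := Xf (Z.abs L + Z.max 2 H0 + Z.abs (N * a) + Z.abs (N * b)).
have rowinv : forall x y, 0 <= y <= Z.max 2 H0 -> inv_at (N * a) (N * b) (shiftc u v eta) x y.
  apply: S; first exact/in_hull_shift/in_hull_refl.
  by move=> x y hx hy; rewrite /inv_at /shiftc -!E ?fper //; lia.
have Xe : in_hull eta (shiftc u v eta) by exact/in_hull_shift/in_hull_refl.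
have nper0 : ~ periodic N 0 (shiftc u v eta).
  by move=> /periodic_shift/periodic_not_nd H; case: (H a b _ ndab); rewrite /lev; nia.
have per : periodic (N * a) (N * b) eta.
  apply: (@periodic_shift _ _ _ _ u v) => x y; apply: contrapT => ne'; apply: nper0.
  have Xe' := in_hull_shift (N * a) (N * b) Xe.
  apply: (rows_agree_periodic lc Xe Xe' (Y := 0) (x1 := x) (y1 := y)); last first.
    by rewrite /shiftc in ne' *; move=> e; apply: ne'; rewrite e.
  by move=> x' y' hy; symmetry; apply: (rowinv x' y'); lia.
by split; apply: (periodic_not_nd per); rewrite /lev; nia.
Qed.

End Spreading.

(** * Two nonhorizontal directions force a horizontal one *)

Section NoHorizontal.
Variables (A : finType) (n : nat).
Notation cfg := (Z -> Z -> A).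
Notation C := ('I_n * 'I_3)%type.
Notation N := (Nper A n).

Lemma hexagon_cells (T : {set C}) x0 m s1 s2 i : hexagon T x0 m s1 s2 -> i \in T ->
  [\/ cy i = 0 /\ x0 <= cx i < x0 + m, cy i = 1 /\ x0 + s1 <= cx i < x0 + s2 + m |
      cy i = 2 /\ x0 + s1 + s2 <= cx i < x0 + s1 + s2 + m].
Proof. by move=> hx iT; apply/(hexP hx)/in_cellsE. Qed.

(** The upper right corner, between the side of direction [(s1, 1)] and the top side. The functional
    [s2 * y - x] is constant along the remaining side, so the strip has direction [(s2, 1)]. *)
Lemma hexagon_corner (eta : cfg) k (T : {set C}) x0 m s1 s2 : generating eta k T ->
  hexagon T x0 m s1 s2 ->
  exists q e e' : C, corner T s1 1 (-1) 0 (fun x y => s2 * y - x) (s2 - s1) 1 q e e'.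
Proof.
move=> gT hx; have cT := gen_convex gT; have m1 := hex_m hx; have ss := hex_s hx.
have [q qT [qx qy]] : in_cells T (x0 + s1 + s2 + m - 1) 2 by apply/(hexP hx); constructor 3; lia.
have [e eT [ex ey]] : in_cells T (x0 + s2 + m - 1) 1 by apply/(hexP hx); constructor 2; lia.
have [e' e'T [e'x e'y]] : in_cells T (x0 + s1 + s2) 2 by apply/(hexP hx); constructor 3; lia.
have ne (i j : C) : i != j -> cx i <> cx j \/ cy i <> cy j.
  move=> /eqP ij; have [h1|h1] := Z.eq_dec (cx i) (cx j); last by left.
  by right=> h2; apply: ij; exact: cell_inj.
have rw := hexagon_cells hx.
exists q, e, e'; split => //; try lia.
- by move=> dx dy E hx' hy'; rewrite !Z.mul_0_r !Z.mul_1_r; nia.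
- by move=> x y; rewrite /lev; lia.
- split.
  + apply: (@convex_lex _ T q 1 (- s1) 0 1 cT) => i iT iq; rewrite /flev.
    by have := ne _ _ iq; rewrite qx qy; case: (rw i iT) => -[-> ?]; lia.
  + apply: (@convex_lex _ T e 1 (- s1) 0 (-1) cT) => i iT iq; rewrite /flev.
    by have := ne _ _ iq; rewrite ex ey; case: (rw i iT) => -[-> ?]; lia.
  + apply: (@convex_lex _ T e' 0 1 (-1) 0 cT) => i iT iq; rewrite /flev.
    by have := ne _ _ iq; rewrite e'x e'y; case: (rw i iT) => -[-> ?]; lia.
- by move=> i iT iq; rewrite /lev; have := ne _ _ iq; rewrite qx qy; case: (rw i iT) => -[-> ?];
  lia.
- by move=> i iT iq; rewrite /lev; have := ne _ _ iq; rewrite qx qy; case: (rw i iT) => -[-> ?];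
  lia.
- by move=> i iT iq; rewrite /lev; have := ne _ _ iq; rewrite ex ey; case: (rw i iT) => -[-> ?];
  lia.
- by move=> i iT iq; rewrite /lev; have := ne _ _ iq; rewrite e'x e'y; case: (rw i iT) => -[-> ?];
  lia.
- by move=> i iT; rewrite ex ey; case: (rw i iT) => -[-> ?]; lia.
- by move=> i iT; rewrite e'x e'y; case: (rw i iT) => -[-> ?]; lia.
Qed.

Lemma strip_spread_up (eta : cfg) k s1 s2 : low_complexity n eta k -> s1 < s2 -> nd eta s1 1 ->
  nd eta s2 1 ->
  ~ nd eta (-1) 0 -> exists H0, forall H, H0 <= H -> exists L, forall h, in_hull eta h ->
    (forall x y, Z.abs x <= L -> Z.abs y <= L -> inv_at (N * s1) (N * 1) h x y) ->
    forall x y, Z.abs (s2 * y - x) <= H -> 0 <= x - s1 * y + y -> inv_at (N * s1) (N * 1) h x y.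
Proof.
move=> lc ss nd1 nd2 ndh; have [T gT] := generating_ex lc.
have [x0 [m hx]] := hexagon_of lc gT ss nd1 nd2.
have [q [e [e' co]]] := hexagon_corner gT hx.
have p1 : prim s1 1 by exists 0, 1; lia.
have [H0 HS] := corner_strip gT co (front_parallel lc p1) (front_not_nd (N * s1) (N * 1) ndh).
exists (Z.max 0 H0) => H HH; have [L HL] := HS (- H) H ltac:(lia).
exists L => h Xh box x y hc hb; apply: (HL h Xh) => //; last by rewrite /lev; lia.
  by move=> x' y' hx' hy' _; exact: box.
by lia.
Qed.

(** With both horizontal sides deterministic, a strip along [(s2, 1)] can be followed upwards and,
    after a point reflection, downwards. On it a translate of [eta] agrees with its translate by
    [N * (s1, 1)]: either they are equal, against [(s2, 1)], or there is a period [N * (s2, 1)],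
    against [(s1, 1)]. *)
Theorem two_nd_horizontal (eta : cfg) k s1 s2 : low_complexity n eta k -> s1 < s2 ->
  nd eta s1 1 -> nd eta s2 1 ->
  nd eta 1 0 \/ nd eta (-1) 0.
Proof.
move=> lc ss nd1 nd2; apply: contrapT => /not_orP[ndh ndh'].
have p s : prim s 1 by exists 0, 1; lia.
have N0 := Nper_gt0 A n.
pose eta' := yrefl (xrefl eta); have lc' := prefl_lc lc : low_complexity n eta' k.
have pnd s : nd eta s 1 -> nd eta' s 1.
  move=> H; have := prefl_nd (nd_neg lc (p s) ltac:(lia) H).
  by rewrite !Z.opp_involutive.
have ndh2 : ~ nd eta' (-1) 0.
  by move=> /nd_yrefl; rewrite yreflK => /nd_xrefl; rewrite xreflK.
have [H1 R1] := strip_spread_up lc ss nd1 nd2 ndh'.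
have [H2 R2] := strip_spread_up lc' ss (pnd _ nd1) (pnd _ nd2) ndh2.
(* [cw] is the change of [s2 * y - x] under the translation by [N * (s1, 1)]. The point reflection
   moves the base point of the invariance by this translation, so the reflected strip must be wider
   by [cw]. *)
pose cw := N * (s2 - s1); pose W := lev_width n s2 1.
have cw0 : 0 < cw by rewrite /cw; apply: Z.mul_pos_pos; lia.
have W0 : 0 <= W by rewrite /W /lev_width; lia.
pose H := Z.abs H1 + Z.abs H2 + W.
have H0 : 0 <= H by clear - W0; rewrite /H; lia.
have [L1 S1] := R1 H ltac:(clear - W0; rewrite /H; lia).
have [L2 S2] := R2 (H + cw) ltac:(clear - W0 cw0; rewrite /H; lia).
pose G := (H + N) * (1 + Z.abs s2).
pose L := Z.abs L1 + Z.abs L2 + N * Z.abs s1 + N + G.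
have [T gT] := generating_ex lc; have [c [k0 rel]] := relation_ex gT.
have [f [f' [Xf Xf' agr ne]]] := nd1 (lev_width n s1 1).
have fper := strip_periodic gT rel (p s1) ltac:(lia) Xf Xf' agr ne.
have [u [v E]] := Xf (L + N * Z.abs s1 + N).
pose h := shiftc u v eta.
have Xh : in_hull eta h by exact/in_hull_shift/in_hull_refl.
have G0 : H + N <= G.
  rewrite /G -{1}(Z.mul_1_r (H + N)); apply: Z.mul_le_mono_nonneg_l; clear - N0 H0; lia.
have Ns1 : Z.abs (N * s1) = N * Z.abs s1 by rewrite Z.abs_mul; congr Z.mul; clear - N0; lia.
have Ns1' : 0 <= N * Z.abs s1 by rewrite -Ns1; exact: Z.abs_nonneg.
have box x y : Z.abs x <= L -> Z.abs y <= L -> inv_at (N * s1) (N * 1) h x y.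
  move=> hx hy; rewrite /inv_at /h /shiftc -!E ?fper //; clear - hx hy N0 Ns1 Ns1'; lia.
have strip x y : Z.abs (s2 * y - x) <= H -> inv_at (N * s1) (N * 1) h x y.
  move=> hc; have [b0|[b1|b1]] : 0 <= x - s1 * y + y \/ - N <= x - s1 * y + y < 0 \/ x - s1 * y + y
    < - N by clear; lia.
  - apply: (S1 h Xh) => // x' y' hx hy; apply: box; clear - hx hy Ns1' N0 G0 H0; rewrite /L; lia.
  - have hy : Z.abs y <= H + N.
      have : Z.abs ((s2 - s1 + 1) * y) <= H + N by clear - hc b1; lia.
      by rewrite Z.abs_mul; clear - ss; nia.
    have hy2 : Z.abs (s2 * y) <= Z.abs s2 * (H + N).
      by rewrite Z.abs_mul; apply: Z.mul_le_mono_nonneg_l => //; exact: Z.abs_nonneg.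
    apply: box; first by clear - hc hy2 Ns1' N0; rewrite /L /G; lia.
    by clear - hy G0 Ns1' N0; rewrite /L; lia.
  have := S2 (yrefl (xrefl h)) (in_hull_yrefl (in_hull_xrefl Xh)) _ (- x - N * s1) (- y - N * 1).
  rewrite /inv_at /yrefl /xrefl => H'; have := H' _ _ _.
  have -> : - (- x - N * s1) = x + N * s1 by lia.
  have -> : - (- y - N * 1) = y + N * 1 by lia.
  have -> : - (- x - N * s1 + N * s1) = x by lia.
  have -> : - (- y - N * 1 + N * 1) = y by lia.
  move=> H''; symmetry; apply: H''.
  + move=> x' y' hx hy; have := box (- x' - N * s1) (- y' - N * 1); rewrite /inv_at.
    have -> : - x' - N * s1 + N * s1 = - x' by lia.
    have -> : - y' - N * 1 + N * 1 = - y' by lia.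
    have -> : - (x' + N * s1) = - x' - N * s1 by lia.
    have -> : - (y' + N * 1) = - y' - N * 1 by lia.
    move=> ->; [by []| |]; clear - hx hy Ns1 Ns1' N0 G0 H0; rewrite /L; lia.
  + by clear - hc cw0; rewrite /cw in cw0 *; lia.
  + by clear - b1; lia.
have Xh' := in_hull_shift (N * s1) (N * 1) Xh.
have nper2 : ~ periodic (N * s2) (N * 1) h.
  move=> /periodic_shift/periodic_not_nd nn; apply: (nn s1 1 _ nd1); rewrite /lev; clear - N0 ss;
    nia.
have per : periodic (N * s1) (N * 1) h.
  move=> x y; apply: contrapT => ne'; apply: nper2.
  apply: (strip_agree_periodic (l0 := - H) lc (p s2) ltac:(lia) Xh Xh' _ (x1 := x) (y1 := y));
    last exact: nesym.
  move=> x' y' l; symmetry; apply: (strip x' y').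
  by move: l; rewrite -/W /lev /H; clear - W0; lia.
move: per => /periodic_shift/periodic_not_nd nn; apply: (nn s2 1 _ nd2); rewrite /lev;
  clear - N0 ss; nia.
Qed.

End NoHorizontal.

(** * Three directions *)

Section LinePair.
Variables (A : finType) (n : nat).
Notation cfg := (Z -> Z -> A).
Notation C := ('I_n * 'I_3)%type.
Notation wpat := {ffun C -> option A}.

Lemma pats_ext (eta : cfg) (T : {set C}) (t t' : wpat) : t \in pats eta T -> t' \in pats eta T ->
  (forall i, i \in T -> t i = t' i) -> t = t'.
Proof.
rewrite !inE => /asboolP[x [y ->]] /asboolP[x' [y' ->]] E; apply/pat_eqP => i iT.
by have := E i iT; rewrite !ffunE iT => -[].
Qed.

Lemma patE (T : {set C}) (h : cfg) x y i : i \in T -> pat T h x y i = Some (h (x + cx i) (y + cy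
  i)).
Proof. by rewrite ffunE => ->. Qed.

Variables (eta : cfg) (k : nat) (T : {set C}).
Hypothesis gT : generating eta k T.
Notation P := (pats eta T).

Lemma vertex_pats q (t t' : wpat) : convex (T :\ q) -> q \in T -> t \in P -> t' \in P ->
  (forall i, i \in T -> i <> q -> t i = t' i) -> t = t'.
Proof.
move=> cq qT tP t'P E; apply: (pats_ext tP t'P) => i iT.
have [->|/eqP] := eqVneq i q; last exact: E.
move: tP t'P E; rewrite !inE => /asboolP[x [y ->]] /asboolP[x' [y' ->]] E.
rewrite !patE //; congr Some; apply: (vertex_rule gT qT cq (in_hull_refl _) (in_hull_refl _)) => j
  jT /eqP jq.
by have := E j jT jq; rewrite !patE // => -[].
Qed.

Variables (s : Z) (qa qb : C) (K : Z).

Definition agree_off (t t' : wpat) := forall i, i \in T -> i <> qa -> i <> qb -> t i = t' i.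

(* The two windows [pA], [pB] that a nondeterministic pair for the direction [(s, 1)] shows on
   its first line of disagreement. *)
Record line_pair (pA pB : wpat) (good : wpat -> Prop) : Prop := LinePair {
  lp_P : pA \in P /\ pB \in P;
  lp_off : agree_off pA pB;
  lp_ne : pA qa <> pB qa /\ pA qb <> pB qb;
  lp_uniq : forall t t', t \in P -> t' \in P -> t <> t' -> agree_off t t' ->
    (t = pA \/ t = pB) /\ (t' = pA \/ t' = pB);
  lp_line : forall t, t = pA \/ t = pB -> forall i j, i \in T -> j \in T -> i <> qa -> i <> qb ->
    cx j = cx i + s -> cy j = cy i + 1 -> t j = t i;
  lp_type : (pA qa = pA qb /\ pB qa = pB qb) \/ (pA qa <> pA qb /\ pB qa <> pB qb);
  lp_good0 : pA qa = pA qb -> good pA /\ good pB;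
  lp_goodP : forall t, good t -> t \in P;
  lp_good_line : forall t, good t -> pA qa = pA qb -> forall i j, i \in T -> j \in T ->
    cx j = cx i + s -> cy j = cy i + 1 -> t j = t i;
  lp_good_step : forall t, good t -> exists2 t', good t' &
    forall i j, i \in T -> j \in T -> cx j = cx i + 1 -> cy j = cy i -> t' i = t j }.

Hypothesis qaT : qa \in T.
Hypothesis qbT : qb \in T.
Hypothesis K_ge0 : 0 <= K.
Hypothesis qab : cx qb = cx qa + s /\ cy qb = cy qa + 1.
Hypothesis qmax : forall i, i \in T -> i <> qa -> i <> qb ->
  lev s 1 (cx qa) (cy qa) - K <= lev s 1 (cx i) (cy i) < lev s 1 (cx qa) (cy qa).
Hypothesis cover : forall l, - K <= l < 0 -> exists i, [/\ i \in T, i <> qa, i <> qb &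
  lev s 1 (cx i) (cy i) = lev s 1 (cx qa) (cy qa) + l].

Let qne : qb <> qa.
Proof. by move=> e; have := qab.2; rewrite e; lia. Qed.

Let lqb : lev s 1 (cx qb) (cy qb) = lev s 1 (cx qa) (cy qa).
Proof. by case: qab => -> ->; rewrite /lev; lia. Qed.

Let vertex_qa : convex (T :\ qa).
Proof.
apply: (@convex_lex _ T qa 1 (- s) 0 (-1) (gen_convex gT)) => i iT /eqP ia.
have [->|/eqP ib] := eqVneq i qb.
  by right; case: qab => ex ey; rewrite /flev ex ey; split; lia.
by left; have := qmax iT ia ib; rewrite /lev /flev; lia.
Qed.

Let vertex_qb : convex (T :\ qb).
Proof.
apply: (@convex_lex _ T qb 1 (- s) 0 1 (gen_convex gT)) => i iT /eqP ib.
have [->|/eqP ia] := eqVneq i qa.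
  by right; case: qab => ex ey; rewrite /flev ex ey; split; lia.
by left; have := qmax iT ia ib; move: lqb; rewrite /lev /flev; lia.
Qed.

Let T' : {set C} := T :\ qa :\ qb.

Let T'P i : i \in T' <-> [/\ i \in T, i <> qa & i <> qb].
Proof. by rewrite !inE; split=> [/and3P[/eqP ? /eqP ? ?]|[-> /eqP -> /eqP ->]]. Qed.

Let convex_T' : convex T'.
Proof.
have -> : T' = below s 1 (lev s 1 (cx qa) (cy qa)) T.
  apply/setP => i; apply/idP/idP => [/T'P[iT ia ib]|/belowP[iT l]].
    by apply/belowP; split => //; have := qmax iT ia ib; lia.
  by apply/T'P; split => // e; move: l; rewrite e ?lqb; lia.
exact: (convex_cut _ _ _ (gen_convex gT)).
Qed.

(** Removing the two points of the face has excess one, so a single pair of patterns is responsible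
    for all ambiguity. *)
Lemma line_unique (pA pB t t' : wpat) : pA \in P -> pB \in P -> pA <> pB -> agree_off pA pB ->
  t \in P -> t' \in P -> t <> t' -> agree_off t t' ->
  (t = pA \/ t = pB) /\ (t' = pA \/ t' = pB).
Proof.
move=> AP BP AB oAB tP t'P tt ott.
have pT' : T' \proper T.
  by apply: (sub_proper_trans (subD1set _ _)); apply: properD1.
have ex := gen_excess gT convex_T' pT'.
have cT' : (#|T| - #|T'| - 1 = 1)%N.
  rewrite /T' (cardsD1 qa T) qaT (cardsD1 qb (T :\ qa)) !inE qbT (introN eqP qne) /=.
  by move: #|T :\ qa :\ qb| => z; clear; lia.
rewrite cT' in ex.
have re u u' : agree_off u u' -> restr T' u = restr T' u'.
  move=> o; apply/ffunP => i; rewrite !ffunE; case: ifP => // /T'P[iT ia ib]; exact: o.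
have := excess1_unique ex AP BP tP t'P (introN eqP AB) (introN eqP tt) (re _ _ oAB) (re _ _ ott).
by rewrite !inE => /andP[/orP[] /eqP-> /orP[] /eqP->]; split; (by left) || (by right).
Qed.

Lemma eq_of_qa (t t' : wpat) : t \in P -> t' \in P -> agree_off t t' -> t qa = t' qa -> t = t'.
Proof.
move=> tP t'P o e; apply: (vertex_pats vertex_qb qbT tP t'P) => i iT ib.
by have [->|/eqP ia] := eqVneq i qa; last exact: o.
Qed.

Lemma eq_of_qb (t t' : wpat) : t \in P -> t' \in P -> agree_off t t' -> t qb = t' qb -> t = t'.
Proof.
move=> tP t'P o e; apply: (vertex_pats vertex_qa qaT tP t'P) => i iT ia.
by have [->|/eqP ib] := eqVneq i qb; last exact: o.
Qed.

(** Along the line of first disagreement all windows of [f] and [g] are [pA] or [pB], and the letter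
    at [qb] is the letter at [qa] in the next window; this gives the two types. If the letters at
    [qa] and [qb] are equal, [const] extends the invariance under [(s, 1)] upwards: successive
    windows agree off the face and, if different, would be [pA] and [pB], which differ at [qa]. The
    [good] patterns are the windows of [f] and [g] on nonnegative levels. *)
Theorem line_pair_ex : nd eta s 1 -> exists pA pB good, line_pair pA pB good.
Proof.
move=> /(_ (lev_width n s 1))[f [g [Xf Xg agr ne]]].
pose wn (F : cfg) x y := pat T F (x - cx qa) (y - cy qa).
have wP F x y : in_hull eta F -> wn F x y \in P by move=> XF; exact: pat_hull.
have wE F x y i : i \in T -> wn F x y i = Some (F (x + (cx i - cx qa)) (y + (cy i - cy qa))).
  by move=> iT; rewrite /wn patE //; congr (Some (F _ _)); lia.
have wqa F x y : wn F x y qa = Some (F x y).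
  by rewrite wE //; congr (Some (F _ _)); lia.
have wqb F x y : wn F x y qb = Some (F (x + s) (y + 1)).
  by case: qab => ex ey; rewrite wE //; congr (Some (F _ _)); lia.
pose W F j := wn F (j * s) j.
have Woff j : agree_off (W f j) (W g j).
  move=> i iT ia ib; rewrite /W !wE //; congr Some; apply: agr.
  have := qmax iT ia ib; have := @lev_widthP _ s 1 qa i; rewrite /lev; lia.
have Wup F j : W F j qb = W F (j + 1) qa.
  by rewrite /W wqb wqa; congr (Some (F _ _)); lia.
have Wne j : W f j <> W g j.
  have up i : W f i = W g i -> W f (i + 1) = W g (i + 1).
    by move=> e; apply: eq_of_qa; rewrite ?wP // -!Wup e.
  have dn i : W f i = W g i -> W f (i - 1) = W g (i - 1).
    by move=> e; apply: eq_of_qb; rewrite ?wP // !Wup Z.sub_add e.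
  have upn (m : nat) i : W f i = W g i -> W f (i + Z.of_nat m) = W g (i + Z.of_nat m).
    elim: m => [|m IH] e; first by rewrite Z.add_0_r.
    by rewrite Nat2Z.inj_succ -Z.add_1_r Z.add_assoc; apply/up/IH.
  have dnn (m : nat) i : W f i = W g i -> W f (i - Z.of_nat m) = W g (i - Z.of_nat m).
    elim: m => [|m IH] e; first by rewrite Z.sub_0_r.
    by rewrite Nat2Z.inj_succ -Z.add_1_r Z.sub_add_distr; apply/dn/IH.
  move=> e; suff : W f 0 = W g 0 by move=> /ffunP/(_ qa); rewrite /W !wqa => -[].
  have [j0|j0] : 0 <= j \/ j <= 0 by lia.
    by have := dnn (Z.to_nat j) _ e; rewrite Z2Nat.id // Z.sub_diag.
  by have := upn (Z.to_nat (- j)) _ e; rewrite Z2Nat.id ?Z.add_opp_diag_r //; lia.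
pose pA := W f 0; pose pB := W g 0.
have AP : pA \in P by exact: wP.
have BP : pB \in P by exact: wP.
have uq := line_unique AP BP (Wne 0) (Woff 0).
have WAB j : (W f j = pA \/ W f j = pB) /\ (W g j = pA \/ W g j = pB).
  by apply: uq; rewrite ?wP.
have inAB F j : F = f \/ F = g -> W F j = pA \/ W F j = pB.
  by case=> ->; have [] := WAB j.
have offA F j i : F = f \/ F = g -> i \in T -> i <> qa -> i <> qb -> W F j i = pA i.
  by move=> Ff iT ia ib; case: (inAB F j Ff) => -> //; rewrite (Woff 0).
have ABqa : pA qa <> pB qa by move=> e; apply: (Wne 0); apply: eq_of_qa.
have ABqb : pA qb <> pB qb by move=> e; apply: (Wne 0); apply: eq_of_qb.
have Wline F j i i' : F = f \/ F = g -> i \in T -> i' \in T -> cx i' = cx i + s ->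
  cy i' = cy i + 1 ->
    W F j i' = W F (j + 1) i.
  by move=> _ iT i'T ex ey; rewrite /W !wE //; congr (Some (F _ _)); clear - ex ey; lia.
pose good t := exists F x y, [/\ F = f \/ F = g, 0 <= lev s 1 x y & t = wn F x y].
have const F : F = f \/ F = g -> pA qa = pA qb -> pB qa = pB qb ->
    forall x y, - K <= lev s 1 x y -> F (x + s) (y + 1) = F x y.
  move=> Ff cA cB; have XF : in_hull eta F by case: Ff => ->.
  have cAB t : t = pA \/ t = pB -> t qa = t qb by case=> ->.
  suff H : forall l, - K <= l -> forall x y, lev s 1 x y = l -> F (x + s) (y + 1) = F x y.
    by move=> x y l; exact: (H _ l).
  apply: Z_ind_up => l l0 IH x y lxy.
  have [ln|[lz|lp]] : l < 0 \/ l = 0 \/ 0 < l by lia.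
  (* On negative levels the point is a cell off the face of some window, where [pA] and [pB]
     agree. *)
  - have [i [iT ia ib li]] := cover (conj l0 ln).
    pose j := y - (cy i - cy qa).
    have xE : x = j * s + (cx i - cx qa) by move: li lxy; rewrite /j /lev; lia.
    have yE : y = j + (cy i - cy qa) by rewrite /j; lia.
    have := offA F j i Ff iT ia ib; rewrite -(offA F (j + 1) i Ff iT ia ib) /W !wE // => -[e].
    by rewrite xE yE e; congr F; clear; lia.
  - have xE : x = y * s by move: lxy; rewrite /lev; lia.
    by have := cAB _ (inAB F y Ff); rewrite /W wqa wqb -xE => -[].
  - have o : agree_off (wn F x y) (wn F (x + s) (y + 1)).
      move=> i iT ia ib; rewrite !wE //; congr Some.
      have := IH (lev s 1 (x + (cx i - cx qa)) (y + (cy i - cy qa))) _ _ _ erefl.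
      have -> : x + (cx i - cx qa) + s = x + s + (cx i - cx qa) by lia.
      have -> : y + (cy i - cy qa) + 1 = y + 1 + (cy i - cy qa) by lia.
      by move=> -> //; have := qmax iT ia ib; move: lxy; rewrite /lev; lia.
    suff : wn F x y = wn F (x + s) (y + 1) by move=> /ffunP/(_ qa); rewrite !wqa => -[].
    apply: contrapT => ne'; have [h1 h2] := uq _ _ (wP _ _ _ XF) (wP _ _ _ XF) ne' o.
    apply: ne'; apply: eq_of_qa; rewrite ?wP //.
    by rewrite (cAB _ h1) wqb wqa.
have types : (pA qa = pA qb /\ pB qa = pB qb) \/ (pA qa <> pA qb /\ pB qa <> pB qb).
  have [h1 h2] := WAB 1; have e1 := Wup f 0; have e2 := Wup g 0;
    rewrite -/pA -/pB Z.add_0_l in e1 e2.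
  have ne1 := Wne 1.
  case: h1 => h1; case: h2 => h2; rewrite h1 h2 in e1 e2 ne1 => //; first by left.
  by right; rewrite e1 e2; split => //; exact: nesym.
have constB : pA qa = pA qb -> pB qa = pB qb by case: types => -[].
exists pA, pB, good; split => //.
- exact: Woff.
- move=> t tAB i j iT jT ia ib ex ey; case: tAB => ->.
    by rewrite (Wline f 0 i j (or_introl erefl)) // (offA f) //; left.
  by rewrite (Wline g 0 i j (or_intror erefl)) // (offA g) //; [rewrite (Woff 0)|right].
- move=> _; split; [exists f, 0, 0|exists g, 0, 0]; split => //; try (by rewrite /lev; lia).
    by left.
  by right.
- by move=> t [F [x [y [[]-> _ ->]]]]; exact: wP.
- move=> t [F [x [y [Ff l ->]]]] cA i j iT jT ex ey.
  rewrite !wE //; congr Some.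
  rewrite -(const F Ff cA (constB cA) (x + (cx i - cx qa))); first by congr F; lia.
  have [->|/eqP ia] := eqVneq i qa; first by rewrite !Z.sub_diag !Z.add_0_r; lia.
  have [->|/eqP ib] := eqVneq i qb; first by move: l lqb; rewrite /lev; lia.
  by have := qmax iT ia ib; move: l; rewrite /lev; lia.
- move=> t [F [x [y [Ff l ->]]]]; exists (wn F (x + 1) y).
    by exists F, (x + 1), y; split => //; move: l; rewrite /lev; lia.
  by move=> i j iT jT ex ey; rewrite !wE //; congr (Some (F _ _)); clear - ex ey; lia.
Qed.

End LinePair.

Lemma Z_least (P : Z -> Prop) M l : M <= l -> P l -> exists l0, [/\ M <= l0 <= l,
  P l0 & forall l', M <= l' < l0 -> ~ P l'].
Proof.
move=> Ml Pl; apply: contrapT => /forallNP H.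
suff nP : forall l', M <= l' -> l' <= l -> ~ P l' by exact: (nP l Ml (Z.le_refl l)).
by apply: Z_ind_up => l' Ml' IH l'l Pl'; case: (H l'); split => // l'' l''b; apply: IH; lia.
Qed.

Lemma window_extend (B : Type) (s t : Z -> B) (d : Z) (u w : Z) : 0 < d <= w ->
  (forall x, s (x + d) = s x) -> (forall x, t (x + d) = t x) ->
  (forall x, u <= x < u + w -> s x = t x) -> forall x, s x = t x.
Proof.
move=> dw sd td E x.
have := Z.div_mod (x - u) d ltac:(lia); have := Z.mod_pos_bound (x - u) d ltac:(lia).
set r := _ mod _; set q := _ / _ => rb xE.
have -> : x = u + r + q * d by lia.
by rewrite (period_mul sd) (period_mul td); apply: E; lia.
Qed.

(** * First differing windows in the hexagonal case *)

Section Hexagon.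
Variables (A : finType) (n : nat).
Notation cfg := (Z -> Z -> A).
Notation C := ('I_n * 'I_3)%type.
Notation wpat := {ffun C -> option A}.
Notation N := (Nper A n).

Variables (eta : cfg) (k : nat) (T : {set C}) (x0 m s1 s2 : Z).
Hypothesis gT : generating eta k T.
Hypothesis hx : hexagon T x0 m s1 s2.
Hypothesis nd1 : nd eta s1 1.
Hypothesis nd2 : nd eta s2 1.
Notation P := (pats eta T).

Let m1 := hex_m hx.
Let ss := hex_s hx.

(** The right ends of the three rows: [q0], [q1] span the side of direction [(s2, 1)], and [q1],
    [q2] that of direction [(s1, 1)]. *)
Variables (q0 q1 q2 : C).
Hypothesis q0E : [/\ q0 \in T, cx q0 = x0 + m - 1 & cy q0 = 0].
Hypothesis q1E : [/\ q1 \in T, cx q1 = x0 + s2 + m - 1 & cy q1 = 1].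
Hypothesis q2E : [/\ q2 \in T, cx q2 = x0 + s1 + s2 + m - 1 & cy q2 = 2].

Let q0T : q0 \in T. Proof. by case: q0E. Qed.
Let q1T : q1 \in T. Proof. by case: q1E. Qed.
Let q2T : q2 \in T. Proof. by case: q2E. Qed.

Let ne_cell (i j : C) : i <> j -> cx i <> cx j \/ cy i <> cy j.
Proof.
move=> ij; have [h1|h1] := Z.eq_dec (cx i) (cx j); last by left.
by right=> h2; apply: ij; exact: cell_inj.
Qed.

Lemma hexagon_line1 : exists pA pB good, line_pair eta T s1 q1 q2 pA pB good.
Proof.
have [_ x1 y1] := q1E; have [_ x2 y2] := q2E.
apply: (line_pair_ex gT (K := m + (s2 - s1) - 1)) => //; try lia.
  move=> i iT /ne_cell i1 /ne_cell i2; rewrite x1 y1 in i1 *; rewrite x2 y2 in i2.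
  by move: i1 i2; rewrite /lev; case: (hexagon_cells hx iT) => -[-> ?]; lia.
move=> l l0; have [i iT [ix iy]] : in_cells T (x0 + s2 + m - 1 + l) 1.
  by apply/(hexP hx); constructor 2; lia.
exists i; split => //; rewrite ?ix ?iy ?x1 ?y1.
- by move=> e; move: ix; rewrite e x1; lia.
- by move=> e; move: iy; rewrite e y2.
- by rewrite /lev; lia.
Qed.

Lemma hexagon_line2 : exists pA pB good, line_pair eta T s2 q0 q1 pA pB good.
Proof.
have [_ x1 y1] := q1E; have [_ x2 y2] := q0E.
apply: (line_pair_ex gT (K := m + (s2 - s1) - 1)) => //; try lia.
  move=> i iT /ne_cell i2 /ne_cell i1; rewrite x1 y1 in i1; rewrite x2 y2 in i2 *.
  by move: i1 i2; rewrite /lev; case: (hexagon_cells hx iT) => -[-> ?]; lia.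
move=> l l0; have [i iT [ix iy]] : in_cells T (x0 + s2 + m - 1 + l) 1.
  by apply/(hexP hx); constructor 2; lia.
exists i; split => //; rewrite ?ix ?iy ?x2 ?y2.
- by move=> e; move: iy; rewrite e y2.
- by move=> e; move: ix; rewrite e x1; lia.
- by rewrite /lev; lia.
Qed.

Variables (pA pB pD pE : wpat) (good1 good2 : wpat -> Prop).
Hypothesis lp1 : line_pair eta T s1 q1 q2 pA pB good1.
Hypothesis lp2 : line_pair eta T s2 q0 q1 pD pE good2.

Definition agree_off3 (t t' : wpat) := forall i, i \in T -> i <> q0 -> i <> q1 -> i <> q2 ->
  t i = t' i.

Let q01 : q0 <> q1. Proof. by move=> e; have [_ _ h] := q1E; have [_ _] := q0E; rewrite e h. Qed.
Let q02 : q0 <> q2. Proof. by move=> e; have [_ _ h] := q2E; have [_ _] := q0E; rewrite e h. Qed.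
Let q12 : q1 <> q2. Proof. by move=> e; have [_ _ h] := q2E; have [_ _] := q1E; rewrite e h. Qed.

Let Tr : {set C} := T :\ q0 :\ q1 :\ q2.

Let TrP i : i \in Tr <-> [/\ i \in T, i <> q0, i <> q1 & i <> q2].
Proof. by rewrite !inE; split=> [/and4P[/eqP ? /eqP ? /eqP ? ?]|[-> /eqP -> /eqP -> /eqP ->]]. Qed.

Let TrE i : i \in Tr <-> [\/ cy i = 0 /\ x0 <= cx i < x0 + m - 1, cy i = 1 /\
  x0 + s1 <= cx i < x0 + s2 + m - 1 |
      cy i = 2 /\ x0 + s1 + s2 <= cx i < x0 + s1 + s2 + m - 1].
Proof.
have [_ u0 v0] := q0E; have [_ u1 v1] := q1E; have [_ u2 v2] := q2E.
split.
  move=> /TrP[iT /ne_cell i0 /ne_cell i1 /ne_cell i2].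
  case: (hexagon_cells hx iT) => -[h1 h2]; [constructor 1|constructor 2|constructor 3]; lia.
move=> H; apply/TrP; split.
- have [j jT [jx jy]] : in_cells T (cx i) (cy i).
    by apply/(hexP hx); case: H => -[h1 h2]; [constructor 1|constructor 2|constructor 3]; lia.
  by rewrite -(cell_inj jx jy).
- by move=> e; subst i; case: H; lia.
- by move=> e; subst i; case: H; lia.
- by move=> e; subst i; case: H; lia.
Qed.

Let convex_Tr : convex Tr.
Proof.
split=> i j l /TrE hi /TrE hl.
  move=> yij yjl xx; apply/TrE; case: hi => -[? ?]; case: hl => -[? ?]; try lia.
  - by constructor 1; lia.
  - by constructor 2; lia.
  - by constructor 3; lia.
by move=> y0 y1 y2 xx; apply/TrE; constructor 2; case: hi => -[? ?]; case: hl => -[? ?]; lia.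
Qed.

Let proper_Tr : Tr \proper T.
Proof.
apply/properP; split; first by apply/fintype.subsetP => i /TrP[].
by exists q0 => //; apply/negP => /TrP[].
Qed.

Let excess_Tr : (#|P| <= #|[set restr Tr w | w in P]| + 2)%N.
Proof.
have := gen_excess gT convex_Tr proper_Tr.
rewrite (_ : (#|T| - #|Tr| - 1 = 2)%N) //.
rewrite /Tr (cardsD1 q0 T) q0T (cardsD1 q1 (T :\ q0)) (cardsD1 q2 (T :\ q0 :\ q1)) !inE q1T q2T.
rewrite (introN eqP (nesym q01)) (introN eqP (nesym q02)) (introN eqP (nesym q12)) /=.
by move: #|T :\ q0 :\ q1 :\ q2| => z; clear; lia.
Qed.

Let restr_off t t' : agree_off3 t t' -> restr Tr t = restr Tr t'.
Proof. by move=> o; apply/ffunP => i; rewrite !ffunE; case: ifP => // /TrP[iT ? ? ?]; exact: o. Qed.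

(* The case [b = pD \/ b = pE] accounts for line pairs that overlap in one window. *)
Lemma off3_unique t t' : t \in P -> t' \in P -> t <> t' -> agree_off3 t t' ->
  exists a b, [/\ (a = pA /\ b = pB) \/ (a = pB /\ b = pA), a <> pD /\ a <> pE,
    (t = a \/ t = b) \/ (t = pD \/ t = pE) &
    [\/ b = pD \/ b = pE, (t = a \/ t = b) /\ (t' = a \/ t' = b) | t = pD \/ t = pE]].
Proof.
move=> tP t'P tt o.
have [AP BP] := lp_P lp1; have [DP EP] := lp_P lp2.
have [neA1 neA2] := lp_ne lp1; have [neD1 neD2] := lp_ne lp2.
have AB : pA <> pB by move=> e; apply: neA1; rewrite e.
have DE : pD <> pE by move=> e; apply: neD1; rewrite e.
have A0 : pA q0 = pB q0 by apply: (lp_off lp1).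
have oAB : agree_off3 pA pB by move=> i iT _ i1 i2; exact: (lp_off lp1).
have oDE : agree_off3 pD pE by move=> i iT i0 i1 _; exact: (lp_off lp2).
have gen a b : a \in P -> b \in P -> a <> b -> a <> pD /\ a <> pE -> agree_off3 a b ->
    ((t = a \/ t = b) \/ (t = pD \/ t = pE)) /\
    [\/ b = pD \/ b = pE, (t = a \/ t = b) /\ (t' = a \/ t' = b) | t = pD \/ t = pE].
  move=> aP bP ab [aD aE] oab.
  have aDE : a \notin [set pD; pE].
    by rewrite !inE; apply/negP => /orP[] /eqP.
  have [] := excess2_unique excess_Tr aP bP DP EP tP t'P (introN eqP ab) (introN eqP DE) (introN
    eqP tt) aDE
    (restr_off oab) (restr_off oDE) (restr_off o).
  rewrite !inE -!orbA => /or4P ht _ H; split.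
    by case: ht => /eqP ->; [left; left|left; right|right; left|right; right].
  case: H => [/orP[] /eqP ->|[[/orP h /orP h']|[/orP h _]]].
  - by constructor 1; left.
  - by constructor 1; right.
  - by constructor 2; split; [case: h => /eqP ->|case: h' => /eqP ->]; (by left) || (by right).
  - by constructor 3; case: h => /eqP ->; (by left) || (by right).
(* If [pA] is one of [pD], [pE], then [pB] is not, because [pA] and [pB] agree at [q0] while [pD]
   and [pE] differ there; the roles are then exchanged. *)
have [aDE|naDE] := pselect (pA <> pD /\ pA <> pE).
  by exists pA, pB; have [h1 h2] := gen _ _ AP BP AB aDE oAB; split => //; left.
have bDE : pB <> pD /\ pB <> pE.
  have hA : pA = pD \/ pA = pE by apply: contrapT => /not_orP.
  split=> e; case: hA => e'.
  - by apply: AB; rewrite e e'.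
  - by apply: neD1; rewrite -e -e' A0.
  - by apply: neD1; rewrite -e -e' A0.
  - by apply: AB; rewrite e e'.
exists pB, pA; have [h1 h2] := gen _ _ BP AP (nesym AB) bDE (fun i iT h0 h1 h2 => esym (oAB i iT h0
  h1 h2)).
by split => //; right.
Qed.

Section Row.
Variables (h : cfg) (d : Z).
Hypothesis Xh : in_hull eta h.
Hypothesis hN : periodic N 0 h.
Hypothesis dm : 0 < d <= m - 1.
Hypothesis d2 : forall x, h (x + d) (-2) = h x (-2).
Hypothesis d1 : forall x, h (x + d) (-1) = h x (-1).

(** [xi] is the abscissa of the left end of the bottom row; for [y = -2] the window covers the rows
    -2, -1 and 0. *)
Definition win (g : cfg) xi y := pat T g (xi - x0) y.

Lemma winE g xi y i : i \in T -> win g xi y i = Some (g (xi + (cx i - x0)) (y + cy i)).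
Proof. by move=> iT; rewrite /win patE //; congr (Some (g _ _)); lia. Qed.

Let winP xi y : win h xi y \in P. Proof. exact: pat_hull. Qed.

Lemma hex_cell dx dy : [\/ dy = 0 /\ 0 <= dx < m, dy = 1 /\ s1 <= dx < s2 + m | dy = 2 /\
  s1 + s2 <= dx < s1 + s2 + m] ->
  exists i, [/\ i \in T, cx i - x0 = dx & cy i = dy].
Proof.
move=> H; have [i iT [ix iy]] : in_cells T (x0 + dx) dy.
  by apply/(hexP hx); case: H => -[h1 h2]; [constructor 1|constructor 2|constructor 3]; lia.
by exists i; split => //; lia.
Qed.

(** The bottom row without its right end has [m - 1] cells, at least one common period of both rows;
    this is where the bound on [d] matters. *)
Lemma row_relation s u : (forall x, u <= x < u + (m - 1) -> h (x + s) (-1) = h x (-2)) ->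
  forall x, h (x + s) (-1) = h x (-2).
Proof.
move=> E; apply: (window_extend (d := d) dm _ _ E) => // x.
by rewrite (_ : x + d + s = x + s + d) ?d1 //; lia.
Qed.

Lemma row_forward s u : (forall x, u <= x -> h (x + s) 0 = h x (-1)) ->
  forall x, h (x + s) 0 = h x (-1).
Proof.
move=> E x; have N0 := Nper_gt0 A n.
have per y z : h (y + Z.abs (u - x) * N) z = h y z.
  by apply: (@period_mul _ (fun y => h y z)) => t; have := hN t z; rewrite Z.add_0_r.
rewrite -(per (x + s)) -(per x) (_ : x + s + _ = x + Z.abs (u - x) * N + s); last lia.
by apply: E; nia.
Qed.

Let step_off (t : wpat) xi : (exists2 t0, t0 = win h xi (-2) & forall i j, i \in T -> j \in T ->
  cx j = cx i + 1 -> cy j = cy i -> t i = t0 j) ->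
  agree_off3 (win h (xi + 1) (-2)) t.
Proof.
move=> [_ -> E] i iT i0 i1 i2.
have : i \in Tr by apply/TrP.
move=> /TrE H; have [j jT [jx jy]] : in_cells T (cx i + 1) (cy i).
  by apply/(hexP hx); case: H => -[h1 h2]; [constructor 1|constructor 2|constructor 3];
    clear - h1 h2; lia.
rewrite (E i j) // !winE //; congr (Some (h _ _)); clear - jx jy; lia.
Qed.

Lemma line2_relation xi : win h xi (-2) = pD \/ win h xi (-2) = pE ->
  forall x, h (x + s2) (-1) = h x (-2).
Proof.
move=> wD; apply: (@row_relation _ xi) => x xb.
have [i [iT ix iy]] : exists i, [/\ i \in T, cx i - x0 = x - xi & cy i = 0].
  by apply: hex_cell; constructor 1; lia.
have [j [jT jx jy]] : exists i, [/\ i \in T, cx i - x0 = x - xi + s2 & cy i = 1].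
  by apply: hex_cell; constructor 2; lia.
have [_ u0 v0] := q0E; have [_ u1 v1] := q1E.
have := lp_line lp2 wD iT jT; rewrite !winE // ix iy jx jy.
have -> : xi + (x - xi + s2) = x + s2 by clear; lia.
have -> : xi + (x - xi) = x by clear; lia.
move=> H; have [] // : Some (h (x + s2) (-1)) = Some (h x (-2)).
by apply: H; [move=> e; move: ix; rewrite e u0; clear - xb; lia|move=> e; move: iy;
  rewrite e v1|clear - ix jx; lia|by []].
Qed.

(** Rows -2 and -1 being translates, each window in this band has equal letters at [q0] and [q1], so
    [pD] and [pE] are of the type with equal letters. Moving right, a window agrees off the right
    ends with a good pattern; if it differs from it, the uniqueness of collisions makes it [pD] or
    [pE], hence good again. The good windows show the translation in the upper two rows. *)
Lemma line2_rows xi : win h xi (-2) = pD \/ win h xi (-2) = pE ->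
  (forall x, h (x + s2) (-1) = h x (-2)) /\ (forall x, h (x + s2) 0 = h x (-1)).
Proof.
move=> wD; have rel := line2_relation wD; split => //.
have [_ u0 v0] := q0E; have [_ u1 v1] := q1E.
have w01 zeta : win h zeta (-2) q0 = win h zeta (-2) q1.
  rewrite !winE // u0 v0 u1 v1 -rel; congr (Some (h _ _)); lia.
have Dc : pD q0 = pD q1 /\ pE q0 = pE q1.
  case: (lp_type lp2) => // -[nD nE]; exfalso.
  by have := w01 xi; case: wD => ->.
have Dc' t : t = pD \/ t = pE -> t q0 = t q1 by case: Dc => ? ? [] ->.
have [gD gE] := lp_good0 lp2 Dc.1.
have g (t : nat) : good2 (win h (xi + Z.of_nat t) (-2)).
  elim: t => [|t IH]; first by rewrite Z.add_0_r; case: wD => ->.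
  have [sg sgood sgE] := lp_good_step lp2 IH.
  have -> : xi + Z.of_nat t.+1 = xi + Z.of_nat t + 1 by clear; lia.
  have o : agree_off3 (win h (xi + Z.of_nat t + 1) (-2)) sg.
    by apply: step_off; exists (win h (xi + Z.of_nat t) (-2)).
  have [->//|ne] := pselect (win h (xi + Z.of_nat t + 1) (-2) = sg).
  have sg01 : sg q0 = sg q1.
    by symmetry; apply: (lp_good_line lp2 sgood Dc.1) => //; rewrite ?u0 ?v0 ?u1 ?v1; lia.
  set tau := win h _ _ in ne o *.
  suff : tau = pD \/ tau = pE by case=> ->.
  have [neA1 neA2] := lp_ne lp1.
  have A0 : pA q0 = pB q0 by apply: (lp_off lp1).
  have [a [b [hab [aD aE] ht]]] := off3_unique (winP _ _) (lp_goodP lp2 sgood) ne o.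
  have ab0 : a q0 = b q0 by case: hab => -[-> ->].
  have ab1 : a q1 <> b q1 by case: hab => -[-> ->] //; exact: nesym.
  have t01 : tau q0 = tau q1 by exact: w01.
  case=> [bD|[ta sa]|//].
    have b01 := Dc' b bD; case: ht => // -[ta|tb]; last by rewrite /tau tb.
    by case: ab1; rewrite -b01 -ab0 -ta; exact: esym t01.
  by case: ta => ta; case: sa => sa; rewrite /tau ta in t01 ne; rewrite sa in sg01 ne;
    case: ne => //; case: ab1; rewrite -t01 -sg01 ab0.
apply: (@row_forward _ (xi + s1)) => x xb.
have [i [iT ix iy]] : exists i, [/\ i \in T, cx i - x0 = s1 & cy i = 1] by apply: hex_cell;
  constructor 2; lia.
have [j [jT jx jy]] : exists i, [/\ i \in T, cx i - x0 = s1 + s2 & cy i = 2] by apply: hex_cell;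
  constructor 3; clear - m1; lia.
have := lp_good_line lp2 (g (Z.to_nat (x - xi - s1))) Dc.1 iT jT.
rewrite !winE // ix iy jx jy Z2Nat.id; last by clear - xb; lia.
have -> : xi + (x - xi - s1) + (s1 + s2) = x + s2 by clear; lia.
have -> : xi + (x - xi - s1) + s1 = x by clear; lia.
by move=> H; have [] // : Some (h (x + s2) 0) = Some (h x (-1)); apply: H; clear - ix iy jx jy; lia.
Qed.

Lemma line1_relation xi : win h xi (-2) = pA \/ win h xi (-2) = pB ->
  forall x, h (x + s1) (-1) = h x (-2).
Proof.
move=> wA; apply: (@row_relation _ xi) => x xb.
have [i [iT ix iy]] : exists i, [/\ i \in T, cx i - x0 = x - xi & cy i = 0].
  by apply: hex_cell; constructor 1; lia.
have [j [jT jx jy]] : exists i, [/\ i \in T, cx i - x0 = x - xi + s1 & cy i = 1].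
  by apply: hex_cell; constructor 2; lia.
have [_ u1 v1] := q1E; have [_ u2 v2] := q2E.
have := lp_line lp1 wA iT jT; rewrite !winE // ix iy jx jy.
have -> : xi + (x - xi + s1) = x + s1 by clear; lia.
have -> : xi + (x - xi) = x by clear; lia.
move=> H; have [] // : Some (h (x + s1) (-1)) = Some (h x (-2)).
by apply: H; [move=> e; move: iy; rewrite e v1|move=> e; move: iy; rewrite e v2|clear - ix jx;
  lia|by []].
Qed.

(** Again windows stay good when moving right. The letter at [q0] is recovered from the cell [i1] of
    row 1 by the relation of the lower rows, so a window and a good pattern can differ only at [q1]
    and [q2]. *)
Lemma line1_rows xi : win h xi (-2) = pA \/ win h xi (-2) = pB -> pA q1 = pA q2 ->
  (forall x, h (x + s1) (-1) = h x (-2)) /\ (forall x, h (x + s1) 0 = h x (-1)).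
Proof.
move=> wA Ac; have rel := line1_relation wA; split => //.
have [_ u0 v0] := q0E; have [_ u1 v1] := q1E; have [_ u2 v2] := q2E.
have [gA gB] := lp_good0 lp1 Ac.
have [i1 [i1T i1x i1y]] : exists i, [/\ i \in T, cx i - x0 = m - 1 + s1 & cy i = 1].
  by apply: hex_cell; constructor 2; lia.
have g (t : nat) : good1 (win h (xi + Z.of_nat t) (-2)).
  elim: t => [|t IH]; first by rewrite Z.add_0_r; case: wA => ->.
  have [sg sgood sgE] := lp_good_step lp1 IH.
  have -> : xi + Z.of_nat t.+1 = xi + Z.of_nat t + 1 by clear; lia.
  have o : agree_off3 (win h (xi + Z.of_nat t + 1) (-2)) sg.
    by apply: step_off; exists (win h (xi + Z.of_nat t) (-2)).
  have [->//|ne] := pselect (win h (xi + Z.of_nat t + 1) (-2) = sg).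
  have o' : agree_off T q1 q2 (win h (xi + Z.of_nat t + 1) (-2)) sg.
    move=> i iT i1' i2'; have [->|/eqP i0] := eqVneq i q0; last exact: o.
    have <- : sg i1 = sg q0.
      by apply: (lp_good_line lp1 sgood Ac) => //; rewrite ?u0 ?v0; clear - i1x i1y; lia.
    rewrite -(o i1) //.
    - rewrite !winE // u0 v0 i1x i1y -(rel (_ + _)); congr (Some (h _ _)); clear; lia.
    - by move=> e; move: i1y; rewrite e v0.
    - by move=> e; move: i1x; rewrite e u1; clear - ss; lia.
    - by move=> e; move: i1y; rewrite e v2.
  by have [[->|->] _] := lp_uniq lp1 (winP _ _) (lp_goodP lp1 sgood) ne o'.
apply: (@row_forward _ (xi + s2)) => x xb.
have [i [iT ix iy]] : exists i, [/\ i \in T, cx i - x0 = s2 & cy i = 1] by apply: hex_cell;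
  constructor 2; lia.
have [j [jT jx jy]] : exists i, [/\ i \in T, cx i - x0 = s1 + s2 & cy i = 2] by apply: hex_cell;
  constructor 3; clear - m1; lia.
have := lp_good_line lp1 (g (Z.to_nat (x - xi - s2))) Ac iT jT.
rewrite !winE // ix iy jx jy Z2Nat.id; last by clear - xb; lia.
have -> : xi + (x - xi - s2) + (s1 + s2) = x + s1 by clear; lia.
have -> : xi + (x - xi - s2) + s2 = x by clear; lia.
by move=> H; have [] // : Some (h (x + s1) 0) = Some (h x (-1)); apply: H; clear - ix iy jx jy; lia.
Qed.

End Row.
Section Exit.
Variables (h e : cfg) (d r x1 y1 : Z).
Hypothesis Xh : in_hull eta h.
Hypothesis Xe : in_hull eta e.
Hypothesis hN : periodic N 0 h.
Hypothesis dm : 0 < d <= m - 1.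
Hypothesis d2 : forall x, h (x + d) (-2) = h x (-2).
Hypothesis d1 : forall x, h (x + d) (-1) = h x (-1).
Hypothesis box : forall x y, Z.abs x <= r -> -3 <= y <= 1 -> h x y = e x y.
Hypothesis r_big : 2 * (m + Z.abs s1 + Z.abs s2) + 2 <= r.
Hypothesis x1_pos : 0 < x1.
Hypothesis y1E : y1 = -2 \/ y1 = -1.
Hypothesis diff1 : h x1 y1 <> e x1 y1.

Let exits y xi := exists i, i \in T /\ h (xi + (cx i - x0)) (y + cy i) <> e (xi + (cx i - x0)) (y +
  cy i).

Let cxB i : i \in T -> Z.abs (cx i - x0) <= m + Z.abs s1 + Z.abs s2.
Proof. by move=> iT; case: (hexagon_cells hx iT) => -[_ H]; lia. Qed.

Let no_exit0 y : -3 <= y <= -1 -> ~ exits y 0.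
Proof.
move=> yb [i [iT ne]]; apply: ne; have := cell_bounds i; have := cxB iT => h1 h2.
by apply: box; lia.
Qed.

(* A difference elsewhere than at a right end would already be met one step to the left. *)
Let first_exit y xi : -3 <= y <= -1 -> 0 <= xi -> exits y xi -> (forall xi', 0 <= xi' < xi ->
  ~ exits y xi') ->
  [/\ win h xi y <> win e xi y, agree_off3 (win h xi y) (win e xi y) &
    forall q p, [\/ q = q0, q = q1 | q = q2] -> 0 <= p < xi + (cx q - x0) ->
      h p (y + cy q) = e p (y + cy q)].
Proof.
move=> yb xi0 [i [iT ne]] least; split.
- by move=> /ffunP/(_ i); rewrite !winE // => -[].
- move=> i' i'T n0 n1 n2; rewrite !winE //; congr Some; apply: contrapT => ne'.
  have : i' \in Tr by apply/TrP.
  move=> /TrE H; have [j jT [jx jy]] : in_cells T (cx i' + 1) (cy i').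
    by apply/(hexP hx); case: H => -[h1 h2]; [constructor 1|constructor 2|constructor 3];
      clear - h1 h2; lia.
  have xi1 : xi <> 0 by move=> e0; apply: (no_exit0 yb); exists i; rewrite -e0.
  apply: (least (xi - 1)); first by clear - xi0 xi1; lia.
  exists j; split => //; rewrite jx jy.
  by have -> : xi - 1 + (cx i' + 1 - x0) = xi + (cx i' - x0) by clear; lia.
- move=> q p qq pb; have qT : q \in T by case: qq => ->.
  have := cell_bounds q; have := cxB qT => h1 h2.
  have [pr|pr] : p <= r \/ r < p by lia.
    by apply: box; lia.
  apply: contrapT => ne'; apply: (least (p - (cx q - x0))); first by lia.
  by exists q; split => //; rewrite Z.sub_add.
Qed.

(** The bands that start at rows -3 and -2 both contain the rows -2 and -1, one of which carries the
    given difference. *)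
Let exit_ex y : y = -3 \/ y = -2 -> exists xi, [/\ 0 <= xi, exits y xi & forall xi',
  0 <= xi' < xi -> ~ exits y xi'].
Proof.
move=> yb; have x1r : r < x1.
  by apply: contrapT => ?; apply: diff1; apply: box; lia.
have [q [qT qy]] : exists q, q \in T /\ y + cy q = y1.
  have [_ _ ?] := q0E; have [_ _ ?] := q1E; have [_ _ ?] := q2E.
  have [?|[?|?]] : y1 = y + 0 \/ y1 = y + 1 \/ y1 = y + 2 by lia.
  - by exists q0; split => //; lia.
  - by exists q1; split => //; lia.
  - by exists q2; split => //; lia.
have qB := cxB qT.
have ex : exits y (x1 - (cx q - x0)) by exists q; rewrite Z.sub_add qy.
have p0 : 0 <= x1 - (cx q - x0) by lia.
have [xi [xib xie least]] := Z_least p0 ex.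
by exists xi; split => //; lia.
Qed.

(** The first differing window in rows -2 to 0 belongs to one of the line pairs, and the claim
    follows unless it is [pA] or [pB] with unequal letters at [q1] and [q2]. In that case the band
    above copies a piece of row -1 into row 0, and the band below makes row -1 a translate of row -2
    by [s2] as well as by [s1]. The resulting period [s2 - s1], carried to the letter at [q2], makes
    the two letters equal. *)
Theorem exit_rows : exists s, [/\ s = s1 \/ s = s2, forall x, h (x + s) (-1) = h x (-2) &
  forall x, h (x + s) 0 = h x (-1)].
Proof.
have [_ u0 v0] := q0E; have [_ u1 v1] := q1E; have [_ u2 v2] := q2E.
have hP xi y : win h xi y \in P by exact: pat_hull.
have eP xi y : win e xi y \in P by exact: pat_hull.
have [xi [xi0 xie least]] := exit_ex (or_intror erefl).
have [ne o noE] := @first_exit (-2) xi ltac:(lia) xi0 xie least.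
have inS y zeta : win h zeta y <> win e zeta y -> agree_off3 (win h zeta y) (win e zeta y) ->
    (win h zeta y = pA \/ win h zeta y = pB) \/ (win h zeta y = pD \/ win h zeta y = pE).
  move=> ne' o'; have [a [b [hab _ [hS|hS] _]]] := off3_unique (hP _ _) (eP _ _) ne' o';
    last by right.
  by left; case: hab => -[ea eb]; rewrite ea eb in hS; case: hS => hS; [left|right|right|left].
have [wD|wnD] := pselect (win h xi (-2) = pD \/ win h xi (-2) = pE).
  by have [h1 h2] := line2_rows Xh hN dm d2 d1 wD; exists s2; split => //; right.
have [wA|//] := inS _ _ ne o.
case: (lp_type lp1) => [[Ac _]|[An Bn]].
  by have [h1 h2] := line1_rows Xh hN dm d2 d1 wA Ac; exists s1; split => //; left.
exfalso; have rel1 := line1_relation dm d2 d1 wA.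
have notAB t : t = pA \/ t = pB -> t q1 <> t q2 by case=> ->.
(* the difference must show at [q2], for otherwise the window would be [pD] or [pE] *)
have e2 : h (xi + (cx q2 - x0)) 0 <> e (xi + (cx q2 - x0)) 0.
  move=> e2; apply: wnD; apply: (proj1 (lp_uniq lp2 (hP _ _) (eP _ _) ne _)).
  move=> i iT i0 i1; have [->|/eqP i2] := eqVneq i q2; last exact: o.
  by rewrite !winE // v2 e2.
have q2B := cxB q2T; have q1B := cxB q1T; have q0B := cxB q0T.
have big : r < xi + (cx q2 - x0).
  by apply: contrapT => ?; apply: e2; apply: box; lia.
(* The cell [q2] of the window at [xi] is the cell [q1] of the window at [xi + s1] one row
   higher. *)
have ex1 : exits (-1) (xi + s1).
  exists q1; split => //; rewrite v1.
  by have -> : xi + s1 + (cx q1 - x0) = xi + (cx q2 - x0) by lia.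
have p1 : 0 <= xi + s1 by lia.
have [zeta [zb ze zleast]] := Z_least p1 ex1.
have zleast' : forall z, 0 <= z < zeta -> ~ exits (-1) z by move=> z ?; apply: zleast; lia.
have [ne' o' noE'] := @first_exit (-1) zeta ltac:(lia) ltac:(lia) ze zleast'.
have z0 : h (zeta + (cx q0 - x0)) (-1) = e (zeta + (cx q0 - x0)) (-1).
  have [l|l] : zeta + (cx q0 - x0) < 0 \/ 0 <= zeta + (cx q0 - x0) by lia.
    by apply: box; lia.
  have := noE q1 (zeta + (cx q0 - x0)); rewrite v1; apply; first by constructor 2.
  lia.
have zE : zeta = xi + s1.
  apply: contrapT => zne; apply: ne'; apply: (vertex_pats gT (q := q2)) => //.
    apply: (@convex_lex _ T q2 1 (- s1) 0 1 (gen_convex gT)) => i iT /eqP/ne_cell;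
      rewrite /flev u2 v2.
    by case: (hexagon_cells hx iT) => -[-> ib]; clear - ib ss; lia.
  move=> i iT i2; have [->|/eqP i0] := eqVneq i q0; first by rewrite !winE // v0 z0.
  have [->|/eqP i1] := eqVneq i q1; last exact: o'.
  rewrite !winE // v1; congr Some.
  have [l|l] : zeta + (cx q1 - x0) < 0 \/ 0 <= zeta + (cx q1 - x0) by lia.
    by apply: box; lia.
  have := noE q2 (zeta + (cx q1 - x0)); rewrite v2; apply; first by constructor 3.
  lia.
have wA' : win h (xi + s1) (-1) = pA \/ win h (xi + s1) (-1) = pB.
  rewrite -zE; apply: (proj1 (lp_uniq lp1 (hP _ _) (eP _ _) ne' _)).
  move=> i iT i1 i2; have [->|/eqP i0] := eqVneq i q0; last exact: o'.
  by rewrite !winE // v0 z0.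
(* [pA] and [pB] agree off [q1] and [q2], so the windows in the two bands have the same middle row
   up to its right end. *)
have row0 x : s1 <= x < s2 + m - 1 -> h (xi + s1 + x) 0 = h (xi + x) (-1).
  move=> xb; have [i [iT ix iy]] : exists i, [/\ i \in T, cx i - x0 = x & cy i = 1].
    by apply: hex_cell; constructor 2; lia.
  have i1 : i <> q1 by move=> ei; move: ix; rewrite ei u1; clear - xb; lia.
  have i2 : i <> q2 by move=> ei; move: iy; rewrite ei v2.
  have off := lp_off lp1 iT i1 i2.
  have : win h (xi + s1) (-1) i = win h xi (-2) i.
    by case: wA' => ->; case: wA => ->.
  by rewrite !winE // ix iy => -[].
(* the band below exits through [pD] or [pE], which makes row [-1] invariant under [s2 - s1] *)
have [th [th0 the thleast]] := exit_ex (or_introl erefl).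
have [ne3 o3 _] := @first_exit (-3) th ltac:(lia) th0 the thleast.
have wD3 : win h th (-3) = pD \/ win h th (-3) = pE.
  have [wA3|//] := inS _ _ ne3 o3; case: (notAB _ wA3).
  rewrite !winE // u1 u2 v1 v2; congr Some.
  by rewrite -[RHS]/(h _ (-1)) -[LHS]/(h _ (-2)) -rel1; congr h; lia.
have rel2 : forall x, h (x + s2) (-1) = h x (-2).
  apply: (row_relation dm d2 d1 (u := th + s1)) => x xb.
  have [i [iT ix iy]] : exists i, [/\ i \in T, cx i - x0 = x - th & cy i = 1].
    by apply: hex_cell; constructor 2; lia.
  have [j [jT jx jy]] : exists i, [/\ i \in T, cx i - x0 = x - th + s2 & cy i = 2].
    by apply: hex_cell; constructor 3; lia.
  have := lp_line lp2 wD3 iT jT; rewrite !winE // ix iy jx jy.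
  have -> : th + (x - th + s2) = x + s2 by clear; lia.
  have -> : th + (x - th) = x by clear; lia.
  move=> H; have [] // : Some (h (x + s2) (-1)) = Some (h x (-2)).
  by apply: H; [move=> ei; move: iy; rewrite ei v0|move=> ei; move: ix; rewrite ei u1;
    clear - xb ss; lia|clear - ix jx; lia|by []].
have per1 x : h (x + s2) (-1) = h (x + s1) (-1) by rewrite rel1 rel2.
have per1' x : h (x - (s2 - s1)) (-1) = h x (-1).
  by have := per1 (x - s2); rewrite Z.sub_add => ->; congr h; lia.
have per2 x : h (x - (s2 - s1)) (-2) = h x (-2).
  by rewrite -!rel1 -[RHS]per1'; congr h; lia.
have : win h xi (-2) = win h (xi - (s2 - s1)) (-2).
  apply: (vertex_pats gT (q := q2)) => //.
    apply: (@convex_lex _ T q2 1 (- s1) 0 1 (gen_convex gT)) => i iT /eqP/ne_cell;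
      rewrite /flev u2 v2.
    by case: (hexagon_cells hx iT) => -[-> ib]; clear - ib ss; lia.
  move=> i iT i2; rewrite !winE //; congr Some.
  have -> : xi - (s2 - s1) + (cx i - x0) = xi + (cx i - x0) - (s2 - s1) by clear; lia.
  have := ne_cell i2; rewrite u2 v2; case: (hexagon_cells hx iT) => -[-> ib] i2'.
  - by rewrite -[RHS]/(h _ (-2)) per2.
  - by rewrite -[RHS]/(h _ (-1)) per1'.
  have := row0 (cx i - x0 - s1) ltac:(clear - ib i2' ss; lia).
  have := row0 (cx i - x0 - (s2 - s1) - s1) ltac:(clear - ib i2' ss; lia).
  have -> : xi + s1 + (cx i - x0 - (s2 - s1) - s1) = xi + (cx i - x0) - (s2 - s1) by clear; lia.
  have -> : xi + s1 + (cx i - x0 - s1) = xi + (cx i - x0) by clear; lia.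
  rewrite -[-2 + 2]/0 => -> ->; rewrite -[LHS]per1'; congr h; lia.
move=> /ffunP/(_ q2); rewrite !winE // v2 => -[].
have := row0 (m - 1 + s1) ltac:(lia).
have -> : xi + s1 + (m - 1 + s1) = xi - (s2 - s1) + (cx q2 - x0) by lia.
move=> -> E; apply: (notAB _ wA); rewrite !winE // v1 v2; congr Some.
rewrite -[RHS]/(h _ 0) E -[LHS]/(h _ (-1)) -[LHS]per1'; congr h; lia.
Qed.

End Exit.
End Hexagon.

(** * From pairs agreeing on rows to parallel directions *)

Section ThreeDirections.
Variables (A : finType) (n : nat).
Notation cfg := (Z -> Z -> A).
Notation C := ('I_n * 'I_3)%type.
Notation N := (Nper A n).

(** Smaller than [N]: the top side has [m] points and leaves at most [m - 1] ambiguous patterns,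
    each containing [m - 1] letters of both lower rows. Coding the two rows as one sequence of pairs
    gives them a common period. *)
Lemma hexagon_row_period (eta : cfg) k (T : {set C}) x0 m s1 s2 (h g : cfg) :
  generating eta k T -> hexagon T x0 m s1 s2 -> in_hull eta h -> in_hull eta g ->
  (forall x y, - lev_width n (-1) 0 <= y < 0 -> h x y = g x y) -> h 0 0 <> g 0 0 ->
  exists d, [/\ 0 < d <= m - 1, forall x, h (x + d) (-2) = h x (-2) & forall x,
    h (x + d) (-1) = h x (-1)].
Proof.
move=> gT hx Xh Xg agr ne; have m1 := hex_m hx; have ss := hex_s hx.
have ab : prim (-1) 0 by exists (-1), 0.
have levE x y : lev (-1) 0 x y = y by rewrite /lev; lia.
pose X0 := x0 + s1 + s2 + m - 1; pose m' := Z.to_nat m.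
have mE : Z.of_nat m' = m by rewrite /m' Z2Nat.id; lia.
have m'0 : (0 < m')%N by lia.
have mf : max_face T (-1) 0 2 X0 2 m'.
  split.
  - by move=> i iT; rewrite levE; have := cell_bounds i; lia.
  - by rewrite levE.
  - by move=> j jm; apply/(hexP hx); constructor 3; rewrite /X0; lia.
  - move=> i iT; rewrite levE => iy; have := hexagon_cells hx iT; rewrite iy.
    by case=> -[? ?]; try lia; exists (X0 - cx i); rewrite /X0; lia.
have agr' x y : - lev_width n (-1) 0 <= lev (-1) 0 x y < 0 -> h x y = g x y.
  by rewrite levE; exact: agr.
have amb := face_windows_ambiguous gT mf ab m'0 Xh Xg agr' (levE 0 0) ne.
have [w wT [wx wy]] : in_cells T X0 2 by apply/(hexP hx); constructor 3; rewrite /X0; lia.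
have pT : below (-1) 0 2 T \proper T.
  apply/properP; split; first by apply/fintype.subsetP => i /belowP[].
  by exists w => //; apply/negP => /belowP[_]; rewrite levE wy.
have card_amb : (#|ambiguous eta T (below (-1) 0 2 T)| <= m' - 1)%N.
  have cb : convex (below (-1) 0 2 T) by exact: (convex_cut _ _ _ (gen_convex gT)).
  have := card_ambiguous_pats gT cb pT; have := max_face_card mf m'0.
  by move: #|ambiguous _ _ _| #|T| #|below _ _ _ T| => *; lia.
pose s t : A * A := (h t (-2), h (t + s1) (-1)).
pose kap t := pat (below (-1) 0 2 T) h (t - x0) (-2).
have kapS t : kap t \in ambiguous eta T (below (-1) 0 2 T).
  have := amb (t - x0 + X0) 0 (levE _ _).
  by have -> : t - x0 + X0 - X0 = t - x0 by lia.
have kdet t1 t2 : kap t1 = kap t2 -> forall i, (i < m' - 1)%N ->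
  s (t1 + Z.of_nat i) = s (t2 + Z.of_nat i).
  move=> /pat_eqP E i im.
  have [i0 i0T [i0x i0y]] : in_cells T (x0 + Z.of_nat i) 0 by apply/(hexP hx); constructor 1; lia.
  have [i1 i1T [i1x i1y]] : in_cells T (x0 + s1 + Z.of_nat i) 1 by apply/(hexP hx); constructor 2;
    lia.
  have b0 : i0 \in below (-1) 0 2 T by apply/belowP; split => //; rewrite levE i0y.
  have b1 : i1 \in below (-1) 0 2 T by apply/belowP; split => //; rewrite levE i1y.
  have := E _ b0; have := E _ b1; rewrite i0x i0y i1x i1y /s.
  have e0 t : t - x0 + (x0 + Z.of_nat i) = t + Z.of_nat i by lia.
  have e1 t : t - x0 + (x0 + s1 + Z.of_nat i) = t + Z.of_nat i + s1 by lia.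
  by rewrite !e0 !e1 => -> ->.
have [d d1 sd] := morse_hedlund_code card_amb kapS kdet.
exists (Z.of_nat d); split; first by lia.
  by move=> x; have [] := sd x.
move=> x; have [_] := sd (x - s1); rewrite Z.sub_add => <-; congr h; lia.
Qed.

Section Claim.
Variables (eta : cfg) (k : nat) (s1 s2 : Z) (h g : cfg).

(** Bundled so that the whole situation can be reflected by [row_pair_xrefl]. *)
Record row_pair : Prop := RowPair {
  rp_lc : low_complexity n eta k;
  rp_s : s1 < s2;
  rp_nd1 : nd eta s1 1;
  rp_nd2 : nd eta s2 1;
  rp_h : in_hull eta h;
  rp_g : in_hull eta g;
  rp_agree : forall x y, - lev_width n (-1) 0 <= y < 0 -> h x y = g x y;
  rp_ne : h 0 0 <> g 0 0;
  rp_per : periodic N 0 h }.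

Lemma exit_right (e : cfg) r x1 y1 : row_pair -> in_hull eta e ->
  2 * (Z.of_nat n + Z.abs s1 + Z.abs s2) + 2 <= r ->
  (forall x y, Z.abs x <= r -> -3 <= y <= 1 -> h x y = e x y) -> 0 < x1 -> y1 = -2 \/ y1 = -1 ->
  h x1 y1 <> e x1 y1 ->
  exists s, [/\ s = s1 \/ s = s2, forall x, h (x + s) (-1) = h x (-2) & forall x,
    h (x + s) 0 = h x (-1)].
Proof.
move=> [lc ss nd1 nd2 Xh Xg agr ne hN] Xe rb box x10 y1E df.
have [T gT] := generating_ex lc; have [x0 [m hx]] := hexagon_of lc gT ss nd1 nd2.
have m1 := hex_m hx.
have [d [dm d2 d1]] := hexagon_row_period gT hx Xh Xg agr ne.
have [q0 q0T [x0E y0E]] : in_cells T (x0 + m - 1) 0 by apply/(hexP hx); constructor 1; lia.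
have [q1 q1T [x1E y1E']] : in_cells T (x0 + s2 + m - 1) 1 by apply/(hexP hx); constructor 2; lia.
have [q2 q2T [x2E y2E]] : in_cells T (x0 + s1 + s2 + m - 1) 2 by apply/(hexP hx); constructor 3;
  lia.
have [q qT [qx qy]] : in_cells T x0 0 by apply/(hexP hx); constructor 1; lia.
have h0 : [/\ q0 \in T, cx q0 = x0 + m - 1 & cy q0 = 0] by [].
have h1 : [/\ q1 \in T, cx q1 = x0 + s2 + m - 1 & cy q1 = 1] by [].
have h2 : [/\ q2 \in T, cx q2 = x0 + s1 + s2 + m - 1 & cy q2 = 2] by [].
have [pA [pB [g1 lp1]]] := hexagon_line1 gT hx nd1 h0 h1 h2.
have [pD [pE [g2 lp2]]] := hexagon_line2 gT hx nd2 h0 h1 h2.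
apply: (exit_rows gT hx h0 h1 h2 lp1 lp2 Xh Xe hN dm d2 d1 box _ x10 y1E df).
by have := cell_bounds q0; have := cell_bounds q; lia.
Qed.

End Claim.

Lemma row_pair_xrefl eta k s1 s2 h g : row_pair eta k s1 s2 h g ->
  row_pair (xrefl eta) k (- s2) (- s1) (xrefl h) (xrefl g).
Proof.
move=> [lc ss nd1 nd2 Xh Xg agr ne hN].
have p s : prim s 1 by exists 0, 1; lia.
have ndx s : nd eta s 1 -> nd (xrefl eta) (- s) 1.
  by move=> H; have /nd_xrefl := nd_neg lc (p s) ltac:(lia) H; rewrite Z.opp_involutive.
split; rewrite /xrefl //; try exact: in_hull_xrefl; try lia.
- exact: low_complexity_xrefl.
- exact: ndx.
- exact: ndx.
- by move=> x y; exact: agr.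
- by move=> x y; rewrite -[LHS]hN; congr h; lia.
Qed.

(** The translate [e] of [eta] must differ from [h] in row -2 or -1: otherwise [e] would be
    horizontally periodic, against the direction [(s1, 1)]. A difference on the left is reflected to
    the right. *)
Lemma row_pair_shift eta k s1 s2 h g : row_pair eta k s1 s2 h g ->
  exists s, [/\ s = s1 \/ s = s2, forall x, h (x + s) (-1) = h x (-2) & forall x,
    h (x + s) 0 = h x (-1)].
Proof.
move=> rp; have [lc ss nd1 nd2 Xh Xg agr ne hN] := rp.
have N0 := Nper_gt0 A n; have k3 := lc_k3 lc.
pose r := 2 * (Z.of_nat n + Z.abs s1 + Z.abs s2) + 5.
have [u [v E]] := Xh r; pose e := shiftc u v eta.
have Xe : in_hull eta e by exact/in_hull_shift/in_hull_refl.
have box x y : Z.abs x <= r -> -3 <= y <= 1 -> h x y = e x y.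
  by move=> hx hy; rewrite E //; lia.
have [x1 [y1 [y1E df]]] : exists x1 y1, (y1 = -2 \/ y1 = -1) /\ h x1 y1 <> e x1 y1.
  apply: contrapT => H; suff : periodic N 0 e.
    move=> /periodic_shift/periodic_not_nd nn; apply: (nn s1 1 _ nd1); rewrite /lev; lia.
  have eq x y : y = -2 \/ y = -1 -> e x y = h x y.
    by move=> yE; apply: contrapT => ne'; apply: H; exists x, y; split => //; exact: nesym.
  have [[x [y ne']]|same] := pselect (exists x y, e x y <> h x y).
    apply: (rows_agree_periodic lc Xe Xh (Y := -2) _ ne') => x' y' yb; apply: eq; lia.
  have eh x y : e x y = h x y by apply: contrapT => ne'; apply: same; exists x, y.
  by move=> x y; rewrite !eh hN.
have rb : 2 * (Z.of_nat n + Z.abs s1 + Z.abs s2) + 2 <= r by rewrite /r; lia.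
have [x1p|x1n] : 0 < x1 \/ x1 <= 0 by lia.
  exact: exit_right rp Xe rb box x1p y1E df.
have x1n' : 0 < - x1.
  suff : x1 <> 0 by lia.
  by move=> x10; apply: df; apply: box; rewrite ?x10 /r; lia.
have [s [sE sr1 sr2]] : exists s, [/\ s = - s2 \/ s = - s1, forall x,
  xrefl h (x + s) (-1) = xrefl h x (-2) &
    forall x, xrefl h (x + s) 0 = xrefl h x (-1)].
  apply: (exit_right (row_pair_xrefl rp) (in_hull_xrefl Xe) (r := r) (x1 := - x1) (y1 := y1)) => //.
  - by rewrite /r; lia.
  - by move=> x y hx hy; apply: box; lia.
  - by rewrite /xrefl Z.opp_involutive.
exists (- s); split; first by lia.
  by move=> x; have := sr1 (- x); rewrite /xrefl Z.opp_involutive => <-; congr h; lia.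
by move=> x; have := sr2 (- x); rewrite /xrefl Z.opp_involutive => <-; congr h; lia.
Qed.

(** The shifts [s] of [f] and [t] of [g] may be different. As [f] and [g] share rows -1 and -2,
    going down by [s] and then [t], or by [t] and then [s], leads from the letter of either at the
    origin to the same letter at [(- t - s, -2)]. *)
Theorem two_nd_not_down (eta : cfg) k s1 s2 : low_complexity n eta k -> s1 < s2 ->
  nd eta s1 1 -> nd eta s2 1 ->
  ~ nd eta (-1) 0.
Proof.
move=> lc ss nd1 nd2 ndh; have k3 := lc_k3 lc.
have W3 : 3 <= lev_width n (-1) 0 by rewrite /lev_width; lia.
have [f [g [Xf Xg agr ne]]] := ndh (lev_width n (-1) 0).
have agr' x y : - lev_width n (-1) 0 <= y < 0 -> f x y = g x y.
  by move=> yb; apply: agr; rewrite /lev; lia.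
have per (f' g' : cfg) : in_hull eta f' -> in_hull eta g' ->
  (forall x y, - lev_width n (-1) 0 <= y < 0 -> f' x y = g' x y) ->
    f' 0 0 <> g' 0 0 -> periodic N 0 f'.
  move=> X1 X2 ag ne'; apply: (rows_agree_periodic lc X1 X2 (Y := -3) _ ne') => x y yb; apply: ag;
    lia.
have ne' := nesym ne.
have agr'' x y : - lev_width n (-1) 0 <= y < 0 -> g x y = f x y by move=> yb; rewrite agr'.
have [s [sE f1 f2]] : exists s, [/\ s = s1 \/ s = s2, forall x,
  f (x + s) (-1) = f x (-2) & forall x, f (x + s) 0 = f x (-1)].
  by apply: (@row_pair_shift eta k s1 s2 f g); split => //; exact: per Xf Xg agr' ne.
have [t [tE g1 g2]] : exists s, [/\ s = s1 \/ s = s2, forall x,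
  g (x + s) (-1) = g x (-2) & forall x, g (x + s) 0 = g x (-1)].
  by apply: (@row_pair_shift eta k s1 s2 g f); split => //; exact: per Xg Xf agr'' ne'.
have e1 x : g x (-1) = f x (-1) by apply: agr''; lia.
have e2 x : g x (-2) = f x (-2) by apply: agr''; lia.
apply: ne; have := f2 (- s); have := g2 (- t); rewrite !Z.add_opp_diag_l => -> ->.
rewrite e1; have := g1 (- t - s); have := f1 (- t - s); rewrite e1 e2 !Z.sub_add.
have -> : - t - s + t = - s by lia.
by move=> -> ->.
Qed.

Theorem no_two_nd (eta : cfg) k a1 b1 a2 b2 : low_complexity n eta k -> prim a1 b1 -> prim a2 b2 ->
  0 < b1 -> 0 < b2 -> (a1, b1) <> (a2, b2) -> nd eta a1 b1 -> ~ nd eta a2 b2.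
Proof.
move=> lc p1 p2 b10 b20 ne nd1 nd2; have [T gT] := generating_ex lc.
have [x0 [m [s1 [s2 [hx [e1 e2 es]]]]]] := hexagon_ex lc gT p1 p2 b10 b20 ne nd1 nd2.
have ss := hex_s hx; have [n1 n2] : nd eta s1 1 /\ nd eta s2 1.
  by subst b1 b2; case: es => -[<- <-].
have [h|h] := two_nd_horizontal lc ss n1 n2; last exact: two_nd_not_down lc ss n1 n2 h.
have p s : prim s 1 by exists 0, 1; lia.
have ndy s : nd eta s 1 -> nd (yrefl eta) (- s) 1 by exact: nd_yrefl.
apply: (@two_nd_not_down (yrefl eta) k (- s2) (- s1) (low_complexity_yrefl lc) _ (ndy _ n2) (ndy _
  n1)); first lia.
exact: nd_yrefl h.
Qed.

(** A nonexpansive line only guarantees nondeterminism on one of its sides, not on a chosen one. *)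
Definition some_nd (eta : cfg) a b := nd eta a b \/ nd eta (- a) (- b).

Theorem nd_directions (eta : cfg) k a1 b1 a2 b2 : low_complexity n eta k -> prim a1 b1 ->
  prim a2 b2 ->
  some_nd eta a1 b1 -> some_nd eta a2 b2 -> a1 * b2 = a2 * b1.
Proof.
move=> lc p1 p2.
have norm a b : prim a b -> some_nd eta a b ->
    exists a' b', [/\ prim a' b', (a' = a /\ b' = b) \/ (a' = - a /\ b' = - b) &
      (0 < b' /\ nd eta a' b') \/ (b' = 0 /\ (nd eta 1 0 \/ nd eta (-1) 0))].
  move=> p H; have [b0|[b0|b0]] : 0 < b \/ b = 0 \/ 0 < - b by lia.
  - exists a, b; split => //; first by left.
    left; split => //; case: H => // /(nd_neg lc (primN p) ltac:(lia)).
    by rewrite !Z.opp_involutive.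
  - exists a, b; split => //; first by left.
    right; split => //; subst b; have [a1'|a1'] : a = 1 \/ a = -1.
      by move: p => [u [v E]]; apply: (Z.mul_eq_1 a u); lia.
      by subst a; case: H; [left|right].
    by subst a; case: H; [right|left].
  - exists (- a), (- b); split; [exact: primN|by right|left; split => //].
    by case: H => // /(nd_neg lc p ltac:(lia)).
move=> /(norm _ _ p1)[a1' [b1' [q1 e1 h1]]] /(norm _ _ p2)[a2' [b2' [q2 e2 h2]]].
suff : a1' * b2' = a2' * b1' by case: e1 => -[-> ->]; case: e2 => -[-> ->]; lia.
have noh a b : prim a b -> 0 < b -> nd eta a b -> nd eta 1 0 \/ nd eta (-1) 0 -> False.
  move=> p b0 ndab hh; have uq : unique_nd eta a b.
    move=> a' b' p' b'0 nd'; apply: contrapT => ne.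
    apply: (no_two_nd lc p p' b0 b'0 _ ndab nd') => -[ea eb]; apply: ne; split; lia.
  by have [n1 n2] := unique_nd_not_horizontal lc p b0 ndab uq; case: hh.
case: h1 => -[b1p n1]; case: h2 => -[b2p n2].
- apply: contrapT => ne; apply: (no_two_nd lc q1 q2 b1p b2p _ n1 n2) => -[ea eb].
  by apply: ne; rewrite ea eb.
- by case: (noh _ _ q1 b1p n1 n2).
- by case: (noh _ _ q2 b2p n2 n1).
- by rewrite b1p b2p; lia.
Qed.

End ThreeDirections.

(** * Orbit closures *)

Section Topology.
Local Open Scope classical_set_scope.
Local Open Scope Z_scope.
Variables (A : finType).

Definition zconfig (f : config A) : Z -> Z -> A := fun x y => f (int_of_Z x, int_of_Z y).
Definition iconfig (h : Z -> Z -> A) : config A := fun p => h (Z_of_int p.1) (Z_of_int p.2).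

Lemma iconfigK h : zconfig (iconfig h) = h.
Proof. by apply/funext => x; apply/funext => y; rewrite /iconfig /zconfig /= !int_of_ZK. Qed.

Lemma zconfig_shift u f : zconfig (shift_config u f) = shiftc (Z_of_int u.1) (Z_of_int u.2)
  (zconfig f).
Proof.
apply/funext => x; apply/funext => y; rewrite /zconfig /shift_config /shiftc.
by congr (f _); congr pair; rewrite /=; lia.
Qed.

Definition cylinder (f : config A) (r : Z) : set (config A) := [set g |
  forall x y, Z.abs x <= r -> Z.abs y <= r -> zconfig g x y = zconfig f x y].

Definition cylinders (f : config A) : set_system (config A) := [set B | exists r,
  cylinder f r `<=` B].

Lemma cylinders_filter f : ProperFilter (cylinders f).
Proof.
apply: Build_ProperFilter_ex.
  by move=> B [r H]; exists f; apply: H.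
split.
- by exists 0.
- move=> P Q [r H] [r' H']; exists (Z.max r r') => g Hg.
  by split; [apply: H|apply: H'] => x y hx hy; apply: Hg; lia.
- by move=> P Q PQ [r H]; exists r => g /H; exact: PQ.
Qed.

Lemma config_cvg (F : set_system (config A)) (f : config A) : Filter F ->
  (F --> f) <-> (forall p, F [set g | g p = f p]).
Proof.
move=> FF; have H := @pointwise_cvgP (discrete_topology (int * int)%type) (discrete_topology A) F f
  FF.
split=> [/H E p|E]; first by have /discrete_cvg := E p.
by apply/H => p; apply/discrete_cvg; exact: E.
Qed.

Lemma cylinder_nbhs (f : config A) (B : set (config A)) : nbhs f B <-> cylinders f B.
Proof.
have FF := cylinders_filter f.
split.
  suff : cylinders f --> f by move=> H; apply: H.
  apply/config_cvg => -[x y]; exists (Z.abs (Z_of_int x) + Z.abs (Z_of_int y)) => g Hg.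
  by have := Hg (Z_of_int x) (Z_of_int y); rewrite /zconfig !Z_of_intK; apply; lia.
move=> [r rB]; apply: (filterS rB).
have pt : forall p, nbhs f [set g : config A | g p = f p] by apply/config_cvg; exact: cvg_id.
pose pts := [seq (i, j) | i <- iota 0 (2 * Z.to_nat r).+1, j <- iota 0 (2 * Z.to_nat r).+1].
pose z (p : nat * nat) : int * int := (int_of_Z (Z.of_nat p.1 - r), int_of_Z (Z.of_nat p.2 - r)).
have Gpts : nbhs f [set g : config A | forall p, p \in pts -> g (z p) = f (z p)].
  elim: pts => [|p s IH]; first by apply: filterE => i.
  by apply: (filterS _ (filterI (pt (z p)) IH)) => g [/= E1 E2] p'; rewrite inE => /orP[/eqP->|/E2].
apply: (filterS _ Gpts) => g /= Eg x y hx hy.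
have := Eg (Z.to_nat (x + r), Z.to_nat (y + r)).
rewrite /zconfig /z /= !Z2Nat.id; [|lia..].
rewrite !Z.add_simpl_r; apply.
by apply: allpairs_f; rewrite mem_iota; lia.
Qed.

Lemma orbit_closure_hull (eta f : config A) : orbit_closure eta f <-> in_hull (zconfig eta)
  (zconfig f).
Proof.
split.
  move=> H r; have /cylinder_nbhs/H[_ [[u _ <-] Hu]] : cylinders f (cylinder f r) by exists r.
  exists (Z_of_int u.1), (Z_of_int u.2) => x y hx hy.
  by rewrite -(Hu x y hx hy) zconfig_shift.
move=> H B /cylinder_nbhs[r Br]; have [u [v E]] := H r.
exists (shift_config (int_of_Z u, int_of_Z v) eta); split; first by exists (int_of_Z u, int_of_Z v).
by apply: Br => x y hx hy; rewrite zconfig_shift /= !int_of_ZK E.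
Qed.

Lemma orbit_closure_shift (eta f : config A) u : orbit_closure eta f ->
  orbit_closure eta (shift_config u f).
Proof. by move=> /orbit_closure_hull H; apply/orbit_closure_hull; rewrite zconfig_shift;
  exact: in_hull_shift. Qed.

Variables (R : realType) (eta : config A) (d : config A -> config A -> R).
Notation X := (orbit_closure eta).
Hypothesis hd : compatible_metric X d.

(** Otherwise there are pairs at distance tending to 0 with different letters at the origin. The
    first components accumulate at some [f]; by compatibility of [d], both components of a suitable
    pair are close to [f] and have its letter. *)
Lemma metric_letter : exists2 delta : R, (0 < delta)%R &
  forall f g, X f -> X g -> (d f g < delta)%R -> f 0%R = g 0%R.
Proof.
apply: contrapT => /forall2NP H.
have ex (m : nat) : exists fg : config A * config A, [/\ X fg.1, X fg.2,
  (d fg.1 fg.2 < m.+1%:R^-1)%R & fg.1 0%R <> fg.2 0%R].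
  case: (H m.+1%:R^-1)%R => [|/existsNP[f /existsNP[g /not_implyP[Xf /not_implyP[Xg /not_implyP[dfg
    ne]]]]]].
    by rewrite invr_gt0 ltr0n.
  by exists (f, g).
have [hs hsP] := choice ex.
have [h hl] := limit_config (fun m => zconfig (hs m).1).
have Xh : X (iconfig h).
  apply/orbit_closure_hull; rewrite iconfigK; apply: in_hull_limit hl _ => m.
  by apply/orbit_closure_hull; case: (hsP m).
set f := iconfig h in Xh.
have zf : zconfig f = h by exact: iconfigK.
have zero (g : config A) : cylinder f 0 g -> g 0%R = f 0%R.
  by move=> /(_ 0 0); rewrite /zconfig; apply.
have [e e0 He] : exists2 e : R, (0 < e)%R & forall g, X g -> (d f g < e)%R -> g 0%R = f 0%R.
  apply/(cmetric_nbhs hd _ Xh); rewrite /within /=.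
  by apply/cylinder_nbhs; exists 0 => g /zero.
have [r Hr] : cylinders f [set g | X g -> (d f g < e / 2)%R].
  apply/cylinder_nbhs; apply/(cmetric_nbhs hd [set g | (d f g < e / 2)%R] Xh).
  by exists (e / 2)%R => //; rewrite divr_gt0.
have [M HM] : exists M : nat, (M.+1%:R^-1 < e / 2 :> R)%R.
  exists (Num.truncn (e / 2)^-1)%R; rewrite invf_plt ?posrE ?ltr0n ?divr_gt0 //.
  by rewrite truncnS_gt.
have [i Mi Ei] := hl r M.
have [Xi Xi' di ni] := hsP i.
have d1 : (d f (hs i).1 < e / 2)%R.
  by apply: (Hr (hs i).1) => // x y hx hy; rewrite zf -Ei.
have d0 : (d f f = 0)%R by apply/(cmetric_eq0 hd Xh Xh).
have d2 : (d f (hs i).2 < e)%R.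
  apply: le_lt_trans (cmetric_triangle hd Xh Xi Xi') _.
  rewrite [ltRHS](splitr e) ltrD //; apply: lt_trans di _; apply: le_lt_trans HM.
  by rewrite lef_pV2 ?posrE ?ltr0n // ler_nat ltnS.
apply: ni; rewrite (He _ Xi' d2) (He _ Xi) //.
by apply: lt_trans d1 _; rewrite ltr_pdivrMr // ltr_pMr // ltr1n.
Qed.

Lemma nonexpansive_pair (l : set (R * R)) : ~ expansive X d l -> forall r : R, (0 < r)%R ->
  exists f g, [/\ X f, X g, f <> g &
    forall u, (dist_to_set (embedZ2 R u) l < r)%R -> f u = g u].
Proof.
move=> nexp r r0; have [delta delta0 Hd] := metric_letter.
apply: contrapT => H; apply: nexp; exists r, delta; split => // f g Xf Xg E.
apply: contrapT => ne; apply: H; exists f, g; split => // u ur.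
have := Hd _ _ (orbit_closure_shift (u := u) Xf) (orbit_closure_shift (u := u) Xg) (E u ur).
by rewrite /shift_config add0r.
Qed.

Lemma complexity_pats (n k : nat) : (0 < k)%N -> (k <= 3)%N ->
  (#|pats (n := n) (zconfig eta) (rows n k)| <= complexity eta n k)%N.
Proof.
case: k => // k _ k3.
pose F (w : {ffun 'I_n * 'I_k.+1 -> A}) : {ffun 'I_n * 'I_3 -> option A} :=
  [ffun i : 'I_n * 'I_3 => if (i.2 < k.+1)%N then Some (w (i.1, inord i.2)) else None].
pose S : {set {ffun 'I_n * 'I_k.+1 -> A}} := [set w | `[< exists u,
  w = Defs.pattern eta n k.+1 u >]]%SET.
have -> : complexity eta n k.+1 = #|S| by rewrite cardsE.
apply: leq_trans (leq_imset_card F S); apply: subset_leq_card; apply/fintype.subsetP => w.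
rewrite inE => /asboolP[x [y ->]].
apply/imsetP; exists (Defs.pattern eta n k.+1 (int_of_Z x, int_of_Z y)).
  by rewrite inE; apply/asboolP; exists (int_of_Z x, int_of_Z y).
apply/ffunP => i; rewrite !ffunE inE; case: ifP => // ik; congr Some.
rewrite /zconfig /shift_config; congr (eta _); congr pair; rewrite /cx /cy /=; first by lia.
by rewrite inordK //; lia.
Qed.

End Topology.

(** * Nonexpansive lines *)

(** If both sides were deterministic, with widths [W1] and [W2], agreement on a band wider than both
    would spread line by line in both directions. The centre [c] is arbitrary because pairs can be
    translated. *)
Lemma pairs_some_nd (A : finType) (eta : Z -> Z -> A) a b :
  (forall W, 0 <= W -> exists f g c, [/\ in_hull eta f, in_hull eta g, exists x y, f x y <> g x y &
     forall x y, c - W <= lev a b x y <= c + W -> f x y = g x y]) -> some_nd eta a b.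
Proof.
move=> H; apply: contrapT => /not_orP[/existsNP[W1 H1] /existsNP[W2 H2]].
pose W := Z.abs W1 + Z.abs W2.
have [f [g [c [Xf Xg [x1 [y1 ne]] agr]]]] := H W ltac:(rewrite /W; lia).
have up a' b' W' l0 x y : W' <= W -> ~ (exists h h', [/\ in_hull eta h, in_hull eta h',
      forall x y, - W' <= lev a' b' x y < 0 -> h x y = h' x y & h 0 0 <> h' 0 0]) ->
    (forall x y, l0 - W <= lev a' b' x y <= l0 + W -> f x y = g x y) ->
      l0 - W <= lev a' b' x y -> f x y = g x y.
  move=> W'W det ag l1; have [l El] : exists l, lev a' b' x y = l by exists (lev a' b' x y).
  rewrite El in l1; move: l l1 x y El; apply: Z_ind_up => l l1 IH x y El.
  have [lW|lW] : l <= l0 + W \/ l0 + W < l by lia.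
    by apply: ag; lia.
  apply: contrapT => ne'; apply: det; exists (shiftc x y f), (shiftc x y g); split.
  - exact: in_hull_shift.
  - exact: in_hull_shift.
  - move=> x' y' l'; apply: (IH (lev a' b' (x' + x) (y' + y))) => //; rewrite levD; lia.
  - by rewrite /shiftc !Z.add_0_l.
apply: ne; have [l|l] : c - W <= lev a b x1 y1 \/ - c - W <= lev (- a) (- b) x1 y1 by rewrite levN;
  lia.
  by apply: (up a b W1 c) => //; rewrite /W; lia.
apply: (up (- a) (- b) W2 (- c)) => //; first by rewrite /W; lia.
by move=> x y; rewrite levN => l'; apply: agr; lia.
Qed.

(** * Real functionals on the window *)

Section RealSlopes.
Variable R : realType.
Local Open Scope ring_scope.

Definition zr (x : Z) : R := (int_of_Z x)%:~R.

Lemma zrD x y : zr (x + y)%ZZ = zr x + zr y.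
Proof. by rewrite /zr -intrD; congr (_%:~R); lia. Qed.

Lemma zrN x : zr (- x)%ZZ = - zr x.
Proof. by rewrite /zr -intrN; congr (_%:~R); lia. Qed.

Lemma zrB x y : zr (x - y)%ZZ = zr x - zr y.
Proof. by rewrite -Z.add_opp_r zrD zrN. Qed.

Lemma zrM x y : zr (x * y)%ZZ = zr x * zr y.
Proof. by rewrite /zr -intrM; congr (_%:~R); lia. Qed.

Lemma zr0 : zr 0 = 0. Proof. by []. Qed.
Lemma zr1 : zr 1 = 1. Proof. by []. Qed.

Lemma ler_zr x y : (zr x <= zr y) <-> (x <= y)%ZZ.
Proof. by rewrite /zr ler_int; split; lia. Qed.

Lemma ltr_zr x y : (zr x < zr y) <-> (x < y)%ZZ.
Proof. by rewrite /zr ltr_int; split; lia. Qed.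

Lemma zr_eq0 x : zr x = 0 <-> x = 0%ZZ.
Proof.
split=> [/eqP|->]; last exact: zr0.
by rewrite /zr intr_eq0 => /eqP; lia.
Qed.

Lemma seq_gap (I : eqType) (s : seq I) (F : I -> R) : (forall i, i \in s -> 0 < F i) ->
  exists2 e, 0 < e & forall i, i \in s -> e <= F i.
Proof.
elim: s => [|i s IH] H; first by exists 1.
have [|e e0 He] := IH; first by move=> j js; apply: H; rewrite inE js orbT.
exists (Num.min e (F i)); first by rewrite lt_min e0 H // mem_head.
move=> j; rewrite inE => /orP[/eqP->|/He ej]; first by rewrite ge_min lexx orbT.
by rewrite ge_min ej.
Qed.

Section Functional.
Variables (A : finType) (n : nat).
Notation C := ('I_n * 'I_3)%type.
Variables (eta : Z -> Z -> A) (k : nat) (T : {set C}) (m1 m2 : R).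
Hypothesis gT : generating eta k T.

Definition mu (x y : Z) : R := m1 * zr x + m2 * zr y.

Lemma muD x y dx dy : mu (x + dx)%ZZ (y + dy)%ZZ = mu x y + mu dx dy.
Proof. by rewrite /mu !zrD !mulrDr addrACA. Qed.

Lemma real_vertex q : (forall i, i \in T -> i != q -> mu (cx i) (cy i) < mu (cx q) (cy q)) ->
  convex (T :\ q).
Proof.
move=> H; have [cI cM] := gen_convex gT.
split=> i j l /setD1P[iq iT] /setD1P[lq lT].
  move=> yij yjl xx; apply/setD1P; split; last exact: cI xx.
  apply/eqP => jq; subst j.
  have := H i iT iq; have := H l lT lq; rewrite /mu -yjl yij !ltrD2r => h1 h2.
  have xi : (cx i < cx q)%ZZ by have : cx i <> cx q; [move=> e; case/eqP: iq; apply: cell_inj|lia].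
  have xl : (cx q < cx l)%ZZ by have : cx l <> cx q; [move=> e; case/eqP: lq; apply: cell_inj|lia].
  have /ltr_zr zi := xi; have /ltr_zr zl := xl.
  have [m0|m0] := lerP 0 m1.
    by have := ler_wpM2l m0 (ltW zl); rewrite leNgt h1.
  by have := ler_wnM2l (ltW m0) (ltW zi); rewrite leNgt h2.
move=> y0 y1 y2 xx; apply/setD1P; split; last exact: cM xx.
apply/eqP => jq; subst j.
have := H i iT iq; have := H l lT lq; rewrite /mu y0 y1 y2 => h1 h2.
have e : zr (cx i) + zr (cx l) = zr (cx q) + zr (cx q).
  by rewrite -!zrD; congr zr; lia.
have := ltrD h1 h2; rewrite addrACA [X in _ < X]addrACA -!mulrDr [zr (cx l) + _]addrC e.
by rewrite -!zrD ltxx.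
Qed.

(** The maximum of [mu] on [T] is attained at a single vertex, with a gap [e] to the other cells, so
    each round of the vertex rule gains at least [e]; the band only has to be as wide as a
    window. *)
Lemma propagate_real : {in T &, injective (fun i => mu (cx i) (cy i))} ->
  exists W, forall r c (f g : Z -> Z -> A), W <= r -> in_hull eta f -> in_hull eta g ->
  (forall x y, `|mu x y - c| < r -> f x y = g x y) -> forall x y, - r < mu x y - c -> f x y = g x y.
Proof.
move=> inj; pose W := 1 + \sum_(p : C * C) `|mu (cx p.1 - cx p.2)%ZZ (cy p.1 - cy p.2)%ZZ|.
have WP (i j : C) : `|mu (cx i - cx j)%ZZ (cy i - cy j)%ZZ| <= W - 1.
  have -> : W - 1 = \sum_(p : C * C) `|mu (cx p.1 - cx p.2)%ZZ (cy p.1 - cy p.2)%ZZ| by rewrite /W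
    addrC addKr.
  by rewrite (bigD1 ((i, j) : C * C)) //= lerDl sumr_ge0.
have swap (a b t : Z) : (t - a + b = t + (b - a))%ZZ by lia.
exists W => r c f g Wr Xf Xg agr.
have r0 : 0 < r by apply: lt_le_trans Wr; rewrite ltr_pwDl // sumr_ge0.
have [c' [k0 rel]] := relation_ex gT; have [i0 i0T] := T_nonempty rel.
have [q qT qmax] := Order.TotalTheory.arg_maxP (fun i : C => mu (cx i) (cy i)) i0T.
have lt i : i \in T -> i != q -> mu (cx i) (cy i) < mu (cx q) (cy q).
  by move=> iT iq; rewrite lt_neqAle (qmax _ iT : (_ <= _)) andbT; apply: contraNneq iq => /inj->.
have cq := real_vertex lt.
have [e e0 He] : exists2 e, 0 < e & forall i, i \in enum (T :\ q) ->
  e <= mu (cx q) (cy q) - mu (cx i) (cy i).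
  by apply: seq_gap => i; rewrite mem_enum => /setD1P[iq iT]; rewrite subr_gt0 lt.
have main (m : nat) x y : - r < mu x y - c -> mu x y - c < r + m%:R * e -> f x y = g x y.
  elim: m x y => [|m IH] x y h1 h2.
    by apply: agr; rewrite ltr_norml h1; rewrite mul0r addr0 in h2.
  have [h3|h3] := ltrP (mu x y - c) (r + m%:R * e); first exact: IH.
  have := @vertex_rule _ _ _ _ _ gT q f g (x - cx q) (y - cy q) (x - cx q) (y - cy q) qT cq Xf Xg.
  rewrite !Z.sub_add; apply => i iT iq.
  have w := WP i q; have gap : mu (cx i - cx q)%ZZ (cy i - cy q)%ZZ <= - e.
    have := He i; rewrite mem_enum !inE iq iT => /(_ isT).
    have -> : mu (cx i - cx q)%ZZ (cy i - cy q)%ZZ = mu (cx i) (cy i) - mu (cx q) (cy q).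
      by rewrite /mu !zrB; ring.
    lra.
  have me0 : 0 <= m%:R * e by rewrite mulr_ge0 // ltW.
  rewrite !swap; apply: IH; rewrite muD.
    move: w; rewrite ler_norml => /andP[w _]; lra.
  have em : m.+1%:R * e = m%:R * e + e by rewrite -addn1 natrD mulrDl mul1r.
  rewrite em in h2; lra.
move=> x y h; apply: (main (Num.truncn ((mu x y - c) / e)).+1) => //.
have : (mu x y - c) / e < (Num.truncn ((mu x y - c) / e)).+1%:R by exact: truncnS_gt.
rewrite ltr_pdivrMr // => h'; lra.
Qed.

End Functional.
End RealSlopes.

Lemma prim_ex x y : x <> 0 \/ y <> 0 -> exists g a b, [/\ prim a b, g <> 0, x = g * a & y = g * b].
Proof.
move=> xy0; have [a xa] := Z.gcd_divide_l x y; have [b yb] := Z.gcd_divide_r x y.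
have [u [v E]] := Z.gcd_bezout x y _ erefl.
exists (Z.gcd x y), a, b; move: (Z.gcd x y) E xa yb => g E xa yb.
have g0 : g <> 0 by move=> g0; move: xa yb; rewrite g0 !Z.mul_0_r => x0 y0; case: xy0.
split => //; [|lia|lia]; exists u, v; subst x y; apply: (Z.mul_reg_r _ _ g) => //; lia.
Qed.

Section Lines.
Local Open Scope classical_set_scope.
Local Open Scope ring_scope.
Variable R : realType.

Definition line (p v : R * R) : set (R * R) := [set (p.1 + t * v.1, p.2 + t * v.2) | t in [set: R]].

(** The factor may exceed the exact value [1 / |v|]: for an integral direction it is chosen so that
    the right-hand side is a difference of levels. *)
Lemma dist_line_le (p v : R * R) lam x y : v != (0, 0) -> 1 <= lam ^+ 2 * (v.1 ^+ 2 + v.2 ^+ 2) ->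
  dist_to_set (x, y) (line p v) <= `|lam * (v.2 * (x - p.1) - v.1 * (y - p.2))|.
Proof.
move=> v0 lam1; set del := (_ * _ - _ * _).
have N0 : v.1 ^+ 2 + v.2 ^+ 2 != 0.
  apply: contraTneq lam1 => ->; by rewrite mulr0 -ltNge ltr01.
have N1 : 0 <= v.1 ^+ 2 + v.2 ^+ 2 by rewrite addr_ge0 // sqr_ge0.
(* The parameter of the foot of the perpendicular from [(x, y)]. *)
pose t := ((x - p.1) * v.1 + (y - p.2) * v.2) / (v.1 ^+ 2 + v.2 ^+ 2).
pose z : R * R := (p.1 + t * v.1, p.2 + t * v.2).
apply: (@le_trans _ _ (euclidean_dist (x, y) z)).
  apply: ge_inf; last by exists z => //; exists t.
  by exists 0 => _ [w _ <-]; rewrite /euclidean_dist sqrtr_ge0.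
rewrite /euclidean_dist /z /=.
have -> : (x - (p.1 + t * v.1)) ^+ 2 + (y - (p.2 + t * v.2)) ^+ 2 = del ^+ 2 / (v.1 ^+ 2 + v.2 ^+
  2).
  by rewrite /t /del; field.
rewrite -sqrtr_sqr ler_wsqrtr // exprMn ler_pdivrMr ?lt0r ?N0 //.
by have := ler_wpM2r (sqr_ge0 del) lam1; rewrite mul1r; congr (_ <= _); ring.
Qed.

Variables (A : finType) (eta : config A) (d : config A -> config A -> R).
Local Notation X := (orbit_closure eta).
Hypothesis hd : compatible_metric X d.

Lemma nonexpansive_direction n k p v : v != (0, 0) -> low_complexity n (zconfig eta) k ->
  ~ expansive X d (line p v) ->
  exists a b s, [/\ prim a b, s != 0, v = (s * zr R a, s * zr R b) & some_nd (zconfig eta) a b].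
Proof.
move=> v0 lc nexp; have [T gT] := generating_ex lc.
have pair := nonexpansive_pair hd nexp.
have dist lam r (f g : config A) : 1 <= lam ^+ 2 * (v.1 ^+ 2 + v.2 ^+ 2) ->
    (forall u, dist_to_set (embedZ2 R u) (line p v) < r -> f u = g u) ->
    forall x y, `|lam * (v.2 * (zr R x - p.1) - v.1 * (zr R y - p.2))| < r ->
      zconfig f x y = zconfig g x y.
  move=> lam1 agr x y lt; apply: agr; apply: le_lt_trans lt.
  exact: (@dist_line_le p v lam (zr R x) (zr R y) v0 lam1).
have [[i [j [iT jT tie ij]]]|inj] := pselect (exists i j : 'I_n * 'I_3, [/\ i \in T, j \in T,
    v.2 * (zr R (cx i) - zr R (cx j)) = v.1 * (zr R (cy i) - zr R (cy j)) & i <> j]).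
  have [g [a [b [pab g0 xa yb]]]] : exists g a b, [/\ prim a b, (g <> 0)%ZZ,
    (cx i - cx j = g * a)%ZZ & (cy i - cy j = g * b)%ZZ].
    apply: prim_ex; have [e|] := pselect (cx i = cx j); last by lia.
    right => e'; apply: ij; apply: cell_inj; lia.
  have zg : zr R g != 0 by apply/eqP => /zr_eq0.
  have tie' : v.2 * zr R a = v.1 * zr R b.
    by apply: (mulfI zg); rewrite !(mulrCA (zr R g)) -!zrM -xa -yb !zrB.
  have [u [w E]] := pab; have zE : zr R u * zr R a + zr R w * zr R b = 1 by rewrite -!zrM -zrD E
    zr1.
  pose s := zr R u * v.1 + zr R w * v.2.
  have v1 : v.1 = s * zr R a.
    by rewrite /s -[LHS]mulr1 -zE mulrDr mulrDl; ring: tie'.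
  have v2 : v.2 = s * zr R b.
    by rewrite /s -[LHS]mulr1 -zE mulrDr mulrDl; ring: tie'.
  have s0 : s != 0.
    by apply: contraNneq v0 => s0; rewrite [v]surjective_pairing v1 v2 s0 !mul0r.
  exists a, b, s; split => //; first by rewrite [v]surjective_pairing v1 v2.
  apply: pairs_some_nd => W W0.
  (* The level [c0] of the line need not be an integer; the margin 2 absorbs its rounding. *)
  have r0 : 0 < zr R W + 2 by rewrite ltr_wpDl // -(zr0 R); apply/ler_zr.
  have [f [h [Xf Xh ne agr]]] := pair _ r0.
  pose c0 := zr R b * p.1 - zr R a * p.2.
  exists (zconfig f), (zconfig h), (Z_of_int (Num.floor c0)); split.
  - by apply/orbit_closure_hull.
  - by apply/orbit_closure_hull.
  - apply: contrapT => /forallNP H; apply: ne; apply/funext => -[x y].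
    have /forallNP/(_ (Z_of_int y))/contrapT := H (Z_of_int x).
    by rewrite /zconfig !Z_of_intK.
  move=> x y l; apply: (dist s^-1 (zr R W + 2) f h) => //.
    rewrite v1 v2.
    have -> : s^-1 ^+ 2 * ((s * zr R a) ^+ 2 + (s * zr R b) ^+ 2) = zr R (a * a + b * b) by rewrite
      zrD !zrM; field.
    rewrite -(zr1 R); apply/ler_zr; have := prim_neq0 pab; nia.
  have -> : s^-1 * (v.2 * (zr R x - p.1) - v.1 * (zr R y - p.2)) = zr R (lev a b x y) - c0.
    by rewrite v1 v2 /c0 /lev zrB !zrM; field.
  have fl : zr R (Z_of_int (Num.floor c0)) <= c0 by rewrite /zr Z_of_intK ge_floor.
  have fl' : c0 < zr R (Z_of_int (Num.floor c0)) + 1.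
    by rewrite /zr Z_of_intK -[X in _ + X]/(1%:~R) -intrD floorD1_gt.
  have [/(ler_zr R) h1 /(ler_zr R) h2] := l; move: h1 h2; rewrite zrB zrD => h1 h2.
  rewrite ltr_norml; apply/andP; split; lra.
exfalso; pose N := v.1 ^+ 2 + v.2 ^+ 2.
have N0 : 0 < N.
  rewrite lt0r addr_ge0 ?sqr_ge0 // andbT; apply: contraNneq v0 => /eqP.
  by rewrite paddr_eq0 ?sqr_ge0 // !sqrf_eq0 => /andP[/eqP a /eqP b];
    rewrite [v]surjective_pairing a b.
pose lam := (Num.sqrt N)^-1; have lam0 : 0 < lam by rewrite invr_gt0 sqrtr_gt0.
have lam1 : 1 <= lam ^+ 2 * N by rewrite /lam exprVn sqr_sqrtr ?(ltW N0) // mulVf // lt0r_neq0.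
have injmu e : e != 0 -> {in T &, injective (fun i => mu (e * v.2) (- e * v.1) (cx i) (cy i))}.
  move=> e0 i j iT jT E; apply: contrapT => ij; apply: inj; exists i, j; split => //.
  by apply: (mulfI e0); move: E; rewrite /mu => E; lra.
have [W1 H1] := propagate_real gT (injmu lam (lt0r_neq0 lam0)).
have [|W2 H2] := propagate_real gT (injmu (- lam) _); first by rewrite oppr_eq0 lt0r_neq0.
pose r := Num.max 1 (Num.max W1 W2); have r0 : 0 < r by rewrite lt_max ltr01.
have [f [g [Xf Xg ne agr]]] := pair r r0; apply: ne; apply/funext => -[X Y].
pose c := lam * (v.2 * p.1 - v.1 * p.2).
have E e x y : mu (e * v.2) (- e * v.1) x y - e * (v.2 * p.1 - v.1 * p.2) =
    e * (v.2 * (zr R x - p.1) - v.1 * (zr R y - p.2)) by rewrite /mu; ring.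
have near x y : `|lam * (v.2 * (zr R x - p.1) - v.1 * (zr R y - p.2))| < r ->
  zconfig f x y = zconfig g x y.
  exact: dist.
have hf : in_hull (zconfig eta) (zconfig f) by apply/orbit_closure_hull.
have hg : in_hull (zconfig eta) (zconfig g) by apply/orbit_closure_hull.
suff : zconfig f (Z_of_int X) (Z_of_int Y) = zconfig g (Z_of_int X) (Z_of_int Y).
  by rewrite /zconfig !Z_of_intK.
set x := Z_of_int X; set y := Z_of_int Y.
have [pos|neg] := lerP 0 (lam * (v.2 * (zr R x - p.1) - v.1 * (zr R y - p.2))).
  apply: (H1 r (lam * (v.2 * p.1 - v.1 * p.2)) _ _ _ hf hg); first by rewrite !le_max lexx orbT.
    by move=> x' y'; rewrite E; exact: near.
  by rewrite E; lra.
apply: (H2 r (- lam * (v.2 * p.1 - v.1 * p.2)) _ _ _ hf hg); first by rewrite !le_max lexx !orbT.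
  by move=> x' y'; rewrite E mulNr normrN; exact: near.
by rewrite E; lra.
Qed.

End Lines.

Local Open Scope ring_scope.

Theorem theorem1p4 (R : realType) (A : finType) (eta : int * int -> A)
    (d : config A -> config A -> R)
    (hd : compatible_metric (orbit_closure (eta : config A)) d)
    (hP : exists n k : nat,
        [/\ (0 < n)%N, (0 < k)%N, (k <= 3)%N &
            (complexity (eta : config A) n k <= n * k)%N])
    (l1 l2 : set (R * R)) (hl1 : is_line l1) (hl2 : is_line l2)
    (hne1 : ~ expansive (orbit_closure (eta : config A)) d l1)
    (hne2 : ~ expansive (orbit_closure (eta : config A)) d l2) :
  exists w : R * R, l2 = translate w l1.
Proof.
have [n [k [n0 k0 k3 P]]] := hP.
have [k' lc] := low_complexity_ex k3 (leq_trans (complexity_pats eta n k0 k3) P).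
have [p1 [v1 [v10 E1]]] := hl1; have [p2 [v2 [v20 E2]]] := hl2; subst l1 l2.
have [a1 [b1 [s1 [pr1 s10 Ev1 nd1]]]] := nonexpansive_direction hd v10 lc hne1.
have [a2 [b2 [s2 [pr2 s20 Ev2 nd2]]]] := nonexpansive_direction hd v20 lc hne2.
have par := nd_directions lc pr1 pr2 nd1 nd2.
have [j [Ea Eb]] : exists j, (a2 = j * a1 /\ b2 = j * b1)%ZZ by apply: prim_col pr1 _;
  rewrite /lev; lia.
have zj : zr R j != 0.
  by apply/eqP => /zr_eq0 j0; have := prim_neq0 pr2; rewrite Ea Eb j0 => -[].
pose c := s2 * zr R j / s1.
have c0 : c != 0 by rewrite !mulf_neq0 ?invr_eq0.
have Ec : v2 = (c * v1.1, c * v1.2).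
  by rewrite Ev1 Ev2 Ea Eb !zrM /c /=; congr pair; field.
exists (p2 - p1); apply/seteqP; split => [_ [t _ <-]|_ [_ [t _ <-] <-]].
  exists (p1.1 + (t * c) * v1.1, p1.2 + (t * c) * v1.2); first by exists (t * c).
  by rewrite Ec /=; congr pair => /=; ring.
by exists (t / c) => //; rewrite Ec /=; congr pair => /=; field.
Qed.
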